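(* Let $I=(c,d)$ with $-\infty\le c<d\le\infty$. Let $v:I\to[-\infty,\infty]$ be Lebesgue measurable with $v>0$ $\mathcal{L}^1$-a.e. on $I$, $\pi(v)\in L^1_{\mathrm{loc}}([c,d))$, $\lim_{b\to d-}\int_c^b v=\infty$, and let $w(x):=\left[\int_c^x v\right]^{-1}\in(0,\infty)$ for all $x\in I$. Let $\mathbf{g}\in L^0(I)$. The following statements are equivalent: (i) $\mathbf{g}\in(\mathrm{Cs}_{\infty,w}(I),\|\cdot\|_{\mathrm{Ch}_{\infty,w}(I)})'_{\mathrm{w}}$; (ii) $v\mathbf{g}\in L^1(I)$, $(\frac{1}{w}\mathbf{g})\cap BPV(I)\neq\emptyset$, and $\int_I v(t)\,\|\mathbf{g}\|_{L^\infty([t,d))}\,dt<\infty$. Moreover, for $\mathbf{g}$ satisfying these equivalent conditions, $$\|\mathbf{g}\|_{(\mathrm{Cs}_{\infty,w}(I),\|\cdot\|_{\mathrm{Ch}_{\infty,w}(I)})'_{\mathrm{w}}}\approx\|v\mathbf{g}\|_{L^1(I)}+\|\lambda_{\tilde g}\|,$$ where $\tilde g\in(\frac{1}{w}\mathbf{g})\cap BPV(I)$.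
   Context: $\mathcal{L}^1$ is Lebesgue measure on $I$; $\mathfrak{M}(I)$ is the set of all $\mathcal{L}^1$-measurable functions $f:I\to[-\infty,\infty]$; $L^0(I)$ is the set of classes of elements of $\mathfrak{M}(I)$ modulo equality $\mathcal{L}^1$-a.e.; classes are written in bold, and $\pi(f)$ denotes the class of $f\in\mathfrak{M}(I)$. Products such as $v\mathbf{g}$, $\frac1w\mathbf{g}$ are classes of products of representatives; $(\frac1w\mathbf{g})\cap BPV(I)$ is the set of representatives of the class $\frac1w\mathbf{g}$ that belong to $BPV(I)$. $L^1_{\mathrm{loc}}([c,d))$ is the set of $\mathbf{f}\in L^0(I)$ with $\|\chi_{(c,x)}\mathbf{f}\|_{L^1(I)}<\infty$ for all $x\in I$. $\mathrm{Cs}_{\infty,w}(I)$ is the set of $\mathbf{f}\in L^1_{\mathrm{loc}}([c,d))$ with $\|\mathbf{f}\|_{\mathrm{Cs}_{\infty,w}(I)}:=\operatorname{ess\,sup}_{x\in I}w(x)\int_c^x|f|<\infty$, and for $\mathbf{f}\in L^1_{\mathrm{loc}}([c,d))$, $\|\mathbf{f}\|_{\mathrm{Ch}_{\infty,w}(I)}:=\operatorname{ess\,sup}_{x\in I}\left|w(x)\int_c^x f\right|$, where $f\in\mathbf{f}$. Thus $(\mathrm{Cs}_{\infty,w}(I),\|\cdot\|_{\mathrm{Ch}_{\infty,w}(I)})$ is the space $\mathrm{Cs}_{\infty,w}(I)$ equipped with the norm $\|\cdot\|_{\mathrm{Ch}_{\infty,w}(I)}$. For a normed space $(Z,\|\cdot\|)$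 of elements of $L^0(I)$, the weak associated space is $$Z'_{\mathrm{w}}=(Z,\|\cdot\|)'_{\mathrm{w}}:=\Big\{\mathbf{g}\in L^0(I):\ \mathbf{f}\mathbf{g}\in L^1(I)\ \forall\,\mathbf{f}\in Z,\ \text{ and }\ \|\mathbf{g}\|_{Z'_{\mathrm{w}}}:=\sup_{h\in\mathbf{h}\in Z\setminus\{0\}}\frac{\left|\int_I hg\right|}{\|\mathbf{h}\|}<\infty,\ g\in\mathbf{g}\Big\}.$$ $BPV(I)$ is the space of all functions $f:I\to\mathbb{R}$ of bounded pointwise variation, i.e. $\sup\sum_{i}|f(x_{i})-f(x_{i-1})|<\infty$ over all finite $x_0<x_1<\dots<x_n$ in $I$. For $f\in BPV(I)$, $\lambda_f$ is the unique real (finite signed) Borel measure on $I$ with $\lambda_f((a,b])=f(b+)-f(a+)$ for all $a,b\in I$, $a\le b$; $\|\lambda\|:=|\lambda|(I)$, where $|\lambda|$ is the total variation of $\lambda$. $A\approx B$ means $c_1A\le B\le c_2A$ with absolute constants $c_1,c_2>0$ (independent of $I,v,w,\mathbf{g}$). *)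

(* Defs.v *)
From HB Require Import structures.
From mathcomp Require Import all_boot all_order all_algebra.
From mathcomp Require Import all_classical all_reals all_analysis.
From mathcomp Require Import measurable_realfun ess_sup_inf.

Set Implicit Arguments.
Unset Strict Implicit.
Unset Printing Implicit Defensive.

Import Order.TTheory GRing.Theory Num.Theory.
Import numFieldNormedType.Exports.

Local Open Scope classical_set_scope.
Local Open Scope ring_scope.
Local Open Scope ereal_scope.

(* R with the sigma-algebra of Lebesgue (not just Borel) measurable sets *)
Notation lebesgueR R := (caratheodory_type (R := R) ((@wlength R idfun)^*)%mu).
Notation leb R := (@completed_lebesgue_measure R).

(* Conventions. A function on an interval I is a function on R of which only the
   values on I are used. An element of L^0(I) is given by a representative
   f : R -> \bar R, measurable on I, and sets and norms of classes are sets and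
   functions of representatives, invariant under equality a.e. on I. Products in
   \bar R follow 0 * +oo = 0. *)

Section Defs.
Context {R : realType}.
Local Notation T := (lebesgueR R).
Local Notation mu := (leb R).
Implicit Types (I : set T) (c d : \bar R) (w : R -> R) (f g h : T -> \bar R).

Definition oitv c d : set T := [set x : R | c < x%:E < d].

(* [t, d) *)
Definition coitv (t : R) d : set T := [set x : R | t%:E <= x%:E < d].

(* the class of f in L^0(I), as a set of representatives *)
Definition L0class I f : set (T -> \bar R) :=
  [set h : T -> \bar R | measurable_fun I h /\ h = f %[ae mu in I]].

Definition L1loc c d : set (T -> \bar R) :=
  [set f : T -> \bar R | measurable_fun (oitv c d) f /\
    forall x, oitv c d x -> \int[mu]_(t in oitv c x%:E) `|f t| < +oo].

(* The functions under ess_sup are nonnegative on (c, d) when w is, so that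
   extending them by 0 does not change their essential supremum over (c, d). *)
Definition Cs_norm c d w f : \bar R :=
  ess_sup mu
    ((fun x => (w x)%:E * \int[mu]_(t in oitv c x%:E) `|f t|) \_ (oitv c d)).

Definition Cs c d w : set (T -> \bar R) :=
  [set f : T -> \bar R | L1loc c d f /\ Cs_norm c d w f < +oo].

Definition Ch_norm c d w f : \bar R :=
  ess_sup mu
    ((fun x => `|(w x)%:E * \int[mu]_(t in oitv c x%:E) f t|) \_ (oitv c d)).

(* Z: a space of elements of L^0(I); N: its norm *)
Definition weak_associated_norm I (Z : set (T -> \bar R))
    (N : (T -> \bar R) -> \bar R) g : \bar R :=
  ereal_sup [set `|\int[mu]_(x in I) (h x * g x)| / N h
            | h in [set h | Z h /\ ~ (h = cst 0 %[ae mu in I])]].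

Definition weak_associated I (Z : set (T -> \bar R))
    (N : (T -> \bar R) -> \bar R) : set (T -> \bar R) :=
  [set g : T -> \bar R | [/\ measurable_fun I g,
               forall f, Z f -> mu.-integrable I (fun x => f x * g x) &
               weak_associated_norm I Z N g < +oo]].

(* [itv_partition a b s] says that a :: s is strictly increasing and ends in b;
   all its points lie in the interval I as soon as a and b do. *)
Definition BPV (I : set R) (f : R -> R) : Prop :=
  has_ubound [set r | exists a b s,
    [/\ I a, I b, itv_partition a b s & r = variation a b f s]].

Definition borel_charge : Type := {charge set (measurableTypeR R) -> \bar R}%R.

(* a Borel charge on I is seen as a charge on R concentrated on I *)
Definition is_lambda (I : set R) (f : R -> R) (lam : borel_charge) : Prop :=
  (forall a b : R, I a -> I b -> (a <= b)%R ->
     lam [set` `]a, b]%R] = (lim (f x @[x --> b^'+]) - lim (f x @[x --> a^'+]))%:E) /\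
  (forall A : set (measurableTypeR R), measurable A -> lam A = lam (A `&` I)).

(* the charge lambda_f; its values on Borel sets are unique, and it exists when
   f is in BPV(I) and I is an open interval *)
Definition lambda_ (I : set R) (f : R -> R) : borel_charge :=
  xget (czero : {classic borel_charge}) [set lam | is_lambda I f lam].

(* |lam|(A); the choice of the Hahn decomposition is immaterial *)
Definition total_variation_charge (lam : borel_charge)
    (A : set (measurableTypeR R)) : \bar R :=
  charge_variation (projT2 (cid (projT2 (cid (Hahn_decomposition lam))))) A.

End Defs.

(* Main.v *)
Require Import Defs.
From HB Require Import structures.
From mathcomp Require Import all_boot all_order all_algebra.
From mathcomp Require Import all_classical all_reals all_analysis.
From mathcomp Require Import measurable_realfun ess_sup_inf.
From mathcomp Require Import lra ring.

(** Let V = 1/w be the primitive of v, and let k be a representative of the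
    class of V g, so that g = k / V almost everywhere. Let F be the primitive
    of a test function f. Integrating by parts,
      int f g = [F k / V] - int (F / V) dk + int (F / V) (k / V) v.
    If |F| <= N V, which is to say that the Ch norm of f is at most N, the
    three terms are bounded by 2 N sup |k|, N var k and N int v |g|. Moreover
    inf |k| = 0, because int v |k| / V is finite whereas V, hence
    log V = int v / V, is unbounded; so sup |k| <= var k and
      |int f g| <= N (3 var k + int v |g|).
    This is [itv_dual_le], extended to the whole interval by [dual_le]; with
    |f| and |k| in place of f and k it shows that f g is integrable
    ([dual_integrable]). The implication from (ii) to (i) follows, and so does
    the upper bound of the dual norm. The third condition of (ii) holds
    because the least nonincreasing majorant H of |k| / V satisfies
    int v H <= sup |k| + var k + int v |g|, again by parts
    ([tail_sup_integral_le]).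

    Conversely, let A be the dual norm of g. Testing with v sgn g gives
    int v |g| <= A ([weighted_dual_le]). For the variation of V g, let b_y be
    the ramp that climbs from 0 at y to 1 at y + dl. Then V b_y is the
    primitive of v b_y + V 1_[y, y + dl) / dl. As b_y decreases with y, a sum
    of differences of ramps at successive points, with arbitrary signs, is
    bounded by 1 in absolute value; pairing g with the corresponding functions
    shows that y |-> int (v b_y + V 1_[y, y + dl) / dl) g has variation at most
    A. So has y |-> int v b_y g, since v |g| has integral at most A. Hence the
    averages of V g over [y, y + dl) have variation at most 2 A, whatever dl
    ([average_bvar]). When dl goes to 0 they converge almost everywhere to V g
    by Lebesgue's differentiation theorem, and a pointwise limit of them along
    an ultrafilter is a representative of V g of variation at most 2 A
    ([bv_representative]).

    For the charge lambda, a representative of bounded variation equals its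
    right-limit function almost everywhere ([rlim_ae]), and the increments of
    the right-limit function are the values of lambda on half-open intervals;
    its variation is therefore at most |lambda|(I) ([is_lambda_bvar]), and
    |lambda|(I) is bounded by a multiple of it ([total_variation_lambda_le]).
    Since the averages of V g converge at every point to the right limits, the
    variation of the right-limit function is at most 2 A. With S = |lambda|(I)
    and B = int v |g| one gets A <= 3 S + B, B <= A and S <= 5 (2 A).

    Bounded variation is used through [dominated]: a nondecreasing p whose
    increments bound those of f. Estimates of sums then telescope. The
    integrations by parts are Abel summations on uniform partitions, the error
    being controlled by the absolute continuity of the integral. *)

Set Implicit Arguments.
Unset Strict Implicit.
Unset Printing Implicit Defensive.

Import Order.TTheory GRing.Theory Num.Theory.
Import numFieldNormedType.Exports.

Local Open Scope classical_set_scope.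
Local Open Scope ring_scope.

(** * Functions of bounded variation *)

Section dominated.
Context {R : realType}.
Implicit Types (I : set R) (f p P Q : R -> R).

(** A bound of the variation of f in the form of a function whose increments
    add up; when f has variation at most T, p can be chosen with values in
    [0, T]. *)
Definition dominated I f p := forall x y, I x -> I y -> x <= y ->
  `|f y - f x| <= p y - p x.

Definition bvar I f (T : R) := forall a b s, I a -> I b ->
  itv_partition a b s -> variation a b f s <= T.

Lemma BPVP I f : BPV I f <-> exists T, bvar I f T.
Proof.
split=> [[T uT]|[T fT]]; exists T.
  by move=> a b s Ia Ib abs; apply: uT; exists a, b, s.
by move=> _ [a [b [s [Ia Ib abs ->]]]]; exact: fT.
Qed.

(** The witness is the variation of f to the left of x, that is, over
    partitions of intervals [a, x] with a in I. *)
Lemma bvar_dominated I f T : bvar I f T ->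
  exists p, dominated I f p /\ forall x, I x -> 0 <= p x <= T.
Proof.
move=> fT.
pose A x := [set r | exists a s, [/\ I a, itv_partition a x s &
  r = variation a x f s]].
have A0 x : I x -> A x 0.
  by move=> Ix; exists x, [::]; rewrite variation_nil; split => //; split => /=.
have AT x : I x -> ubound (A x) T.
  by move=> Ix _ [a [s [Ia axs ->]]]; exact: fT.
exists (fun x => sup (A x)); split; last first.
  move=> x Ix; apply/andP; split.
    by apply: ub_le_sup (A0 _ Ix); exists T; exact: AT.
  by apply: ge_sup; [exists 0; exact: A0|exact: AT].
move=> x y Ix Iy; rewrite le_eqVlt => /predU1P[->|xy].
  by rewrite !subrr normr0.
rewrite lerBrDl -lerBrDr; apply: ge_sup; first by exists 0; exact: A0.
move=> _ [a [s [Ia axs ->]]]; rewrite lerBrDr.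
apply: ub_le_sup; first by exists T; exact: AT.
have xyp : itv_partition x y [:: y] by exact: itv_partition1.
exists a, (s ++ [:: y]); split => //; first exact: itv_partition_cat axs xyp.
rewrite (@variation_cat _ x)//; last by rewrite ltW.
- have -> : variation x y f [:: y] = `|f y - f x| by rewrite /variation/= big_nat1.
  by [].
- case: s axs => [/itv_partition_nil ->//|z s].
  by move/itv_partition_size_neq0 => /(_ isT)/ltW.
Qed.

Lemma dominated_variation I f p a b s : is_interval I -> dominated I f p ->
  I a -> I b -> itv_partition a b s -> variation a b f s <= p b - p a.
Proof.
move=> iI fp; elim: s a => [|x s ih] a Ia Ib abs.
  by rewrite variation_nil (itv_partition_nil abs) subrr.
have /itv_partition_cons xbs := abs.
have ax : a < x by case: abs => /= /andP[].
have xb : x <= b.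
  case: s xbs {ih abs} => [/itv_partition_nil ->//|z s].
  by move/itv_partition_size_neq0 => /(_ isT)/ltW.
have Ix : I x by apply: (iI a b) => //; rewrite (ltW ax).
have axp : itv_partition a x [:: x] by exact: itv_partition1.
rewrite -cat1s (@variation_cat _ x)//; last exact: ltW.
have := ih _ Ix Ib xbs; have := fp _ _ Ia Ix (ltW ax).
have -> : variation a x f [:: x] = `|f x - f a| by rewrite /variation/= big_nat1.
lra.
Qed.

Lemma dominated_bvar I f p T : is_interval I -> dominated I f p ->
  (forall x, I x -> 0 <= p x <= T) -> bvar I f T.
Proof.
move=> iI fp pT a b s Ia Ib /(dominated_variation iI fp Ia Ib)/le_trans; apply.
by have /andP[_ +] := pT _ Ib; have /andP[+ _] := pT _ Ia; lra.
Qed.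

Lemma dominated_nondecreasing I f p : dominated I f p ->
  forall x y, I x -> I y -> x <= y -> p x <= p y.
Proof.
by move=> fp x y Ix Iy xy; rewrite -subr_ge0 (le_trans _ (fp _ _ Ix Iy xy)).
Qed.

(** Monotone functions on I are extended to the line because right limits
    and Stieltjes measures of functions on the line are simpler to handle;
    the supremum over the points of I to the left of x does it, L being
    added so that no supremum is over an empty set. *)
Lemma nondecreasing_extension I p L U : L <= U ->
  (forall x y, I x -> I y -> x <= y -> p x <= p y) ->
  (forall x, I x -> L <= p x <= U) ->
  exists P, [/\ nondecreasing_fun P, forall x, I x -> P x = p x &
    forall x, L <= P x <= U].
Proof.
move=> LU pnd pLU.
pose A x := L |` [set p y | y in I `&` [set y | y <= x]].
have AL x : A x L by left.
have AU x : ubound (A x) U by move=> _ [->//|[y [/pLU/andP[]] ? ? ? <-]].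
have supA x r : A x r -> r <= sup (A x) by move=> ?; apply: ub_le_sup => //; exists U.
exists (fun x => sup (A x)); split => [x y xy|x Ix|x].
- apply: ge_sup; first by exists L.
  move=> r [->|[z [Iz zx] <-]]; first exact: supA.
  by apply: supA; right; exists z => //; split => //=; exact: le_trans xy.
- apply/eqP; rewrite eq_le; apply/andP; split.
    apply: ge_sup; first by exists L.
    by move=> r [->|[z [Iz zx] <-]]; [have /andP[] := pLU _ Ix|exact: pnd].
  by apply: supA; right; exists x => //; split => /=.
- by apply/andP; split; [exact: supA|apply: ge_sup; [exists L|exact: AU]].
Qed.

(** Jordan decomposition: p and p - f are nondecreasing. *)
Lemma dominated_split I f p T x0 : I x0 -> dominated I f p ->
  (forall x, I x -> 0 <= p x <= T) ->
  exists P Q L, [/\ nondecreasing_fun P, nondecreasing_fun Q,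
    forall x, I x -> f x = P x - Q x,
    forall x, 0 <= P x <= T & forall x, L <= Q x <= L + 4 * T].
Proof.
move=> Ix0 fp pT.
have T0 : 0 <= T by have /andP[/le_trans] := pT _ Ix0; exact.
have [P [Pnd PI PT]] := nondecreasing_extension T0 (dominated_nondecreasing fp) pT.
pose q x := p x - f x.
have qnd x y : I x -> I y -> x <= y -> q x <= q y.
  by move=> Ix Iy xy; have /ler_normlP[] := fp _ _ Ix Iy xy; rewrite /q; lra.
pose L := q x0 - 2 * T.
(* q = p - f differs from its value at x0 by at most 2 T, as each of p and
   f varies by at most T. *)
have qL x : I x -> L <= q x <= L + 4 * T.
  move=> Ix; rewrite /L /q.
  have := pT _ Ix; have := pT _ Ix0 => /andP[? ?] /andP[? ?].
  have [xx0|/ltW xx0] := leP x x0.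
    by have /ler_normlP[] := fp _ _ Ix Ix0 xx0; lra.
  by have /ler_normlP[] := fp _ _ Ix0 Ix xx0; lra.
have LL : L <= L + 4 * T by lra.
have [Q [Qnd QI QL]] := nondecreasing_extension LL qnd qL.
exists P, Q, L; split => // x Ix; rewrite PI// QI// /q; lra.
Qed.

Definition rlim f x : R := lim (f y @[y --> x^'+]).

Lemma near_at_right_itv I x : open I -> I x -> \forall y \near x^'+, I y.
Proof.
by move=> oI Ix; apply: cvg_within; exact: open_nbhs_nbhs.
Qed.

End dominated.

(** * Right limits *)

Section right_limits.
Context {R : realType}.
Implicit Types (I : set R) (f p P Q : R -> R).

Lemma nondecreasing_rlim P x : nondecreasing_fun P ->
  P y @[y --> x^'+] --> rlim P x.
Proof.
move=> ndP; apply: nondecreasing_at_right_is_cvgr.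
  by apply: nearW => z; move=> ? ? _ _; exact: ndP.
near=> z; exists (P x) => _ [y /= + <-].
by rewrite in_itv/= => /andP[xy _]; exact/ndP/ltW.
Unshelve. all: by end_near. Qed.

Lemma rlim_ge P x r : nondecreasing_fun P ->
  (forall y, x < y -> r <= P y) -> r <= rlim P x.
Proof.
move=> ndP rP; apply: (limr_ge (nondecreasing_rlim ndP)).
by near=> y; apply: rP; near: y; exact: nbhs_right_gt.
Unshelve. all: by end_near. Qed.

Lemma rlim_le P x y : nondecreasing_fun P -> x < y -> rlim P x <= P y.
Proof.
move=> ndP xy; apply: (limr_le (nondecreasing_rlim ndP)).
near=> z; apply: ndP; apply: ltW; near: z; exact: nbhs_right_lt.
Unshelve. all: by end_near. Qed.

Lemma le_rlim P x : nondecreasing_fun P -> P x <= rlim P x.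
Proof. by move=> ndP; apply: rlim_ge => // y xy; exact/ndP/ltW. Qed.

Lemma rlim_nondecreasing P : nondecreasing_fun P -> nondecreasing_fun (rlim P).
Proof.
move=> ndP x y xy; apply: rlim_ge => // z yz.
by apply: rlim_le => //; exact: le_lt_trans yz.
Qed.

(** The right limit at x is approached by values P z, and the right limits
    between x and z lie between the two. *)
Lemma rlim_right_continuous P x : nondecreasing_fun P ->
  rlim P y @[y --> x^'+] --> rlim P x.
Proof.
move=> ndP; apply/cvgrPdist_le => e e0.
have /cvgrPdist_le /(_ e e0) H := @nondecreasing_rlim P x ndP.
have [z xz Hz] : exists2 z, x < z & `|rlim P x - P z| <= e.
  near x^'+ => z; exists z; near: z; [exact: nbhs_right_gt|exact: H].
near=> y.
have xy : x < y by near: y; exact: nbhs_right_gt.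
have yz : y < z by near: y; exact: nbhs_right_lt.
have := rlim_nondecreasing ndP (ltW xy).
have := rlim_le ndP yz.
by move: Hz => /ler_normlP[] ? ? ? ?; apply/ler_normlP; split; lra.
Unshelve. all: by end_near. Qed.

Section bv.
Variables (I : set R) (f p : R -> R) (T : R).
Hypothesis oI : open I.
Hypotheses (fp : dominated I f p) (pT : forall x, I x -> 0 <= p x <= T).

(** Right limits commute with the decomposition of f, so that f inherits
    from monotone functions the existence of right limits. *)
Lemma dominated_rlim_split x0 : I x0 ->
  exists P Q L, [/\ nondecreasing_fun P, nondecreasing_fun Q,
    forall x, I x -> rlim f x = rlim P x - rlim Q x /\
      f y @[y --> x^'+] --> rlim f x,
    forall x, I x -> f x = P x - Q x &
    forall x, 0 <= P x <= T /\ L <= Q x <= L + 4 * T].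
Proof.
move=> Ix0; have [P [Q [L [ndP ndQ fPQ PT QL]]]] := dominated_split Ix0 fp pT.
exists P, Q, L; split => // x Ix.
have fx : f y @[y --> x^'+] --> rlim P x - rlim Q x.
  apply: cvg_trans (cvgB (@nondecreasing_rlim P x ndP)
    (@nondecreasing_rlim Q x ndQ)).
  apply: near_eq_cvg.
  near=> y; rewrite /= fPQ//.
  by near: y; exact: near_at_right_itv.
have -> : rlim f x = rlim P x - rlim Q x by exact/cvg_lim.
by [].
Unshelve. all: by end_near. Qed.

Lemma dominated_cvg_rlim x : I x -> f y @[y --> x^'+] --> rlim f x.
Proof.
by move=> Ix; have [P [Q [L [_ _ /(_ _ Ix)[]]]]] := dominated_rlim_split Ix.
Qed.

(** The right-limit function is its own right limit; it therefore has the
    same charge as f. *)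
Lemma rlim_idem x : I x ->
  rlim f y @[y --> x^'+] --> rlim f x /\ rlim (rlim f) x = rlim f x.
Proof.
move=> Ix; have [P [Q [L [ndP ndQ fPQ _ _]]]] := dominated_rlim_split Ix.
have fx : rlim f y @[y --> x^'+] --> rlim f x.
  rewrite (fPQ _ Ix).1.
  apply: cvg_trans (cvgB (@rlim_right_continuous P x ndP)
    (@rlim_right_continuous Q x ndQ)).
  apply: near_eq_cvg.
  near=> y; rewrite /= (fPQ _ _).1//.
  by near: y; exact: near_at_right_itv.
by split => //; exact/cvg_lim.
Unshelve. all: by end_near. Qed.

End bv.

(** Passing to the limit in the inequality of [dominated]: the right limits
    of p dominate those of f. The last bound controls the jump of f at x by
    any increment of p that starts at x. *)
Lemma dominated_rlim I f p T : open I ->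
  dominated I f p -> (forall x, I x -> 0 <= p x <= T) ->
  [/\ dominated I (rlim f) (rlim p), forall x, I x -> 0 <= rlim p x <= T &
   forall x y, I x -> I y -> x < y -> `|f x - rlim f x| <= p y - p x].
Proof.
move=> oI fp pT.
have pp : dominated I p p.
  move=> x y Ix Iy xy; rewrite ger0_norm// subr_ge0.
  exact: dominated_nondecreasing fp _ _ _ _ _.
have cf x (Ix : I x) := dominated_cvg_rlim oI fp pT Ix.
have cp x (Ix : I x) := dominated_cvg_rlim oI pp pT Ix.
have key x y : I x -> I y -> x < y -> `|f y - rlim f x| <= p y - rlim p x.
  move=> Ix Iy xy.
  have c1 : (`|f y - f z|) @[z --> x^'+] --> `|f y - rlim f x|.
    by apply: cvg_norm; apply: cvgB; [exact: cvg_cst|exact: cf].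
  have c2 : (p y - p z) @[z --> x^'+] --> p y - rlim p x.
    by apply: cvgB; [exact: cvg_cst|exact: cp].
  apply: (ler_cvg_to c1 c2); near=> z; apply: fp => //.
    by near: z; exact: near_at_right_itv.
  by apply/ltW; near: z; exact: nbhs_right_lt.
have dom : dominated I (rlim f) (rlim p).
  move=> x y Ix Iy; rewrite le_eqVlt => /predU1P[->|xy].
    by rewrite !subrr normr0.
  have c1 : (`|f z - rlim f x|) @[z --> y^'+] --> `|rlim f y - rlim f x|.
    by apply: cvg_norm; apply: cvgB; [exact: cf|exact: cvg_cst].
  have c2 : (p z - rlim p x) @[z --> y^'+] --> rlim p y - rlim p x.
    by apply: cvgB; [exact: cp|exact: cvg_cst].
  apply: (ler_cvg_to c1 c2); near=> z; apply: key => //.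
    by near: z; exact: near_at_right_itv.
  by rewrite (lt_trans xy)//; near: z; exact: nbhs_right_gt.
split => // [x Ix|x y Ix Iy xy].
- have pTx : \forall z \near x^'+, 0 <= p z <= T.
    by near=> z; apply: pT; near: z; exact: near_at_right_itv.
  apply/andP; split.
    apply: (limr_ge (cp _ Ix)); apply: filterS pTx.
    by move=> z /andP[].
  apply: (limr_le (cp _ Ix)); apply: filterS pTx.
  by move=> z /andP[].
- have c1 : (`|f x - f z|) @[z --> x^'+] --> `|f x - rlim f x|.
    by apply: cvg_norm; apply: cvgB; [exact: cvg_cst|exact: cf].
  apply: (ler_cvg_to c1 (cvg_cst (p y - p x))); near=> z.
  have xz : x < z by near: z; exact: nbhs_right_gt.
  have zy : z < y by near: z; exact: nbhs_right_lt.
  have Iz : I z by near: z; exact: near_at_right_itv.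
  rewrite distrC (le_trans (fp _ _ Ix Iz (ltW xz)))// lerD2r.
  exact: (dominated_nondecreasing fp _ _ (ltW zy)).
Unshelve. all: by end_near. Qed.

End right_limits.

(** * Open intervals and the charges that they carry *)

Section open_interval.
Context {R : realType}.
Implicit Types (c d : \bar R).

Lemma oitv_open c d : open (oitv c d : set R).
Proof.
rewrite (_ : oitv c d = [set r : R | (c < r%:E)%E] `&` [set r | (r%:E < d)%E]).
  by apply: openI; [exact: open_ereal_gt|exact: open_ereal_lt].
by apply/seteqP; split => x /= => [/andP[]|[] H1 H2]; rewrite /oitv/= ?H1.
Qed.

Lemma oitv_interval c d : is_interval (oitv c d : set R).
Proof.
move=> x y /andP[cx _] /andP[_ yd] z /andP[xz zy]; apply/andP; split.
  by rewrite (lt_le_trans cx)// lee_fin.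
by rewrite (le_lt_trans _ yd)// lee_fin.
Qed.

Lemma oitv_sub c d x : oitv c d x -> (oitv c x%:E `<=` oitv c d)%classic.
Proof.
move=> /andP[_ xd] t /andP[ct tx]; apply/andP; split => //.
exact: lt_trans xd.
Qed.

(** The end points may be infinite; the distinction of cases is made here,
    once for all. *)
Lemma oitv_exhaustion c d : (c < d)%E -> exists a b : nat -> R,
  [/\ forall n, oitv c d (a n) /\ oitv c d (b n), forall n, a n < b n,
   nonincreasing_seq a, nondecreasing_seq b &
   forall x, oitv c d x -> exists n, a n < x < b n].
Proof.
move=> cd.
have [x0 /andP[cx0 x0d]] : exists x : R, (c < x%:E < d)%E.
  move: c d cd => [c| |] [d| |]//=.
  - rewrite lte_fin => cd; exists ((c + d) / 2); rewrite !lte_fin.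
    by rewrite midf_lt//= midf_lt.
  - by exists (c + 1); rewrite lte_fin ltrDl ltr01 ltry.
  - by exists (d - 1); rewrite lte_fin gtrDl oppr_lt0 ltr01 ltNyr.
  - by exists 0; rewrite ltNyr ltry.
have Na : exists a : nat -> R, [/\ forall n, (c < (a n)%:E)%E /\ a n < x0,
    nonincreasing_seq a & forall x, (c < x%:E)%E -> exists n, a n < x].
  move: c cx0 {cd} => [c| |]//=.
    rewrite lte_fin => cx0; exists (fun n => c + (x0 - c) / n.+2%:R).
    have xc : 0 < x0 - c by rewrite subr_gt0.
    split => [n|n m nm|x].
    - rewrite lte_fin ltrDl divr_gt0//; split => //.
      rewrite -ltrBrDl ltr_pdivrMr// ltr_pMr// ltr1n//.
    - by rewrite lerD2l ler_pM2l// lef_pV2 ?posrE// ler_nat ltnS.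
    - rewrite lte_fin -subr_gt0 => cx.
      pose n := Num.bound ((x0 - c) / (x - c)).
      have := archi_boundP (divr_ge0 (ltW xc) (ltW cx)).
      rewrite -/n ltr_pdivrMr// => nx.
      exists n; rewrite -ltrBrDl ltr_pdivrMr// (lt_le_trans nx)//.
      by rewrite mulrC ler_pM2l// ler_nat leqW.
  exists (fun n => x0 - n.+1%:R); split => [n|n m nm|x].
  - by rewrite ltNyr gtrDl oppr_lt0 ltr0n.
  - by rewrite lerD2l lerN2 ler_nat ltnS.
  - move=> _; have [xx0|xx0] := ltP x0 x.
      by exists 0%N; rewrite (le_lt_trans _ xx0)// lerBlDr lerDl.
    exists (Num.bound (x0 - x)); rewrite ltrBlDr -ltrBlDl.
    rewrite (lt_le_trans (archi_boundP _)) ?subr_ge0//.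
    by rewrite ler_nat.
have Nb : exists b : nat -> R, [/\ forall n, ((b n)%:E < d)%E /\ x0 < b n,
    nondecreasing_seq b & forall x, (x%:E < d)%E -> exists n, x < b n].
  move: d x0d {cd Na} => [d| |]//=.
    rewrite lte_fin => x0d; exists (fun n => d - (d - x0) / n.+2%:R).
    have xc : 0 < d - x0 by rewrite subr_gt0.
    split => [n|n m nm|x].
    - rewrite lte_fin gtrDl oppr_lt0 divr_gt0//; split => //.
      rewrite ltrBrDl -ltrBrDr ltr_pdivrMr// ltr_pMr// ltr1n//.
    - by rewrite lerD2l lerN2 ler_pM2l// lef_pV2 ?posrE// ler_nat ltnS.
    - rewrite lte_fin -subr_gt0 => cx.
      pose n := Num.bound ((d - x0) / (d - x)).
      have := archi_boundP (divr_ge0 (ltW xc) (ltW cx)).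
      rewrite -/n ltr_pdivrMr// => nx.
      exists n; rewrite ltrBrDl -ltrBrDr ltr_pdivrMr// (lt_le_trans nx)//.
      by rewrite mulrC ler_pM2l// ler_nat leqW.
  exists (fun n => x0 + n.+1%:R); split => [n|n m nm|x].
  - by rewrite ltry ltrDl ltr0n.
  - by rewrite lerD2l ler_nat ltnS.
  - move=> _; have [xx0|xx0] := ltP x x0.
      by exists 0%N; rewrite (lt_le_trans xx0)// lerDl.
    exists (Num.bound (x - x0)); rewrite -ltrBlDl.
    rewrite (lt_le_trans (archi_boundP _)) ?subr_ge0//.
    by rewrite ler_nat.
have [a [ca and_ ax]] := Na; have [b [cb bnd bx]] := Nb.
exists a, b; split => //.
- move=> n; have [can ax0] := ca n; have [bd x0b] := cb n; split.
    by apply/andP; split => //; rewrite (lt_trans _ x0d)// lte_fin.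
  by apply/andP; split => //; rewrite (lt_trans cx0)// lte_fin.
- by move=> n; rewrite (lt_trans (ca n).2)// (cb n).2.
- move=> x /andP[/ax[n nx] /bx[m xm]]; exists (maxn n m).
  by rewrite (le_lt_trans (and_ _ _ (leq_maxl n m)))//= (lt_le_trans xm)// bnd// leq_maxr.
Qed.

End open_interval.

Section interval_measures.
Context {R : realType}.
Local Notation B := (measurableTypeR R).
Implicit Types (c d : \bar R).

Lemma oitv_measurable c d : measurable (oitv c d : set B).
Proof. exact: open_measurable (@oitv_open _ c d). Qed.

(** The intervals (a, b] generate the Borel sets and are stable under
    intersection. Those with end points outside of I are reached by the
    increasing union of their traces on the exhausting intervals. *)
Lemma finite_measure_itv_unique c d (m1 m2 : {finite_measure set B -> \bar R}) :
  (c < d)%E ->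
  (forall A, measurable A -> m1 A = m1 (A `&` oitv c d)) ->
  (forall A, measurable A -> m2 A = m2 (A `&` oitv c d)) ->
  (forall a b, oitv c d a -> oitv c d b -> a <= b ->
    m1 `]a, b]%classic = m2 `]a, b]%classic) ->
  forall A, measurable A -> m1 A = m2 A.
Proof.
move=> cd m1I m2I m12.
have [a [b [Iab ab and_ bnd abI]]] := oitv_exhaustion cd.
have cov (m : {finite_measure set B -> \bar R}) s t :
    (forall A, measurable A -> m A = m (A `&` oitv c d)) ->
    m `]Num.max s (a n), Num.min t (b n)]%classic @[n --> \oo] --> m `]s, t]%classic.
  move=> mI; rewrite (mI `]s, t]%classic)//.
  have -> : `]s, t]%classic `&` oitv c d =
      \bigcup_n `]Num.max s (a n), Num.min t (b n)]%classic.
    apply/seteqP; split => x /=.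
      rewrite in_itv/= => -[/andP[sx xt]] /abI[n /andP[ax xb]].
      by exists n => //=; rewrite in_itv/= gt_max le_min sx xt ax ltW.
    move=> [n _ /=]; rewrite in_itv/= gt_max le_min => /andP[/andP[sx ax] /andP[xt xb]].
    rewrite in_itv/= sx xt; split => //.
    by apply: (oitv_interval (Iab n).1 (Iab n).2); rewrite (ltW ax).
  apply: nondecreasing_cvg_mu => //.
    exact: bigcup_measurable.
  move=> n m' nm; apply/subsetPset => x /=.
  rewrite !in_itv/= !gt_max !le_min => /andP[/andP[-> ax] /andP[-> xb]] /=.
  by rewrite (le_lt_trans (and_ _ _ nm))//= (le_trans xb)// bnd.
apply: (@measure_unique _ R B (@ocitv R) (fun k => `](- k%:R), k%:R]%classic)) => //.
- exact: ocitvI.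
- by move=> k; exact: is_ocitv.
- rewrite -subTset => x _ /=.
  have := archi_boundP (normr_ge0 x); set n := Num.bound _ => xn; exists n => //=.
  by move: xn; rewrite in_itv/= ltr_norml => /andP[-> /ltW].
- move=> _ [[s t] _ <-] /=.
  have c1 := cov m1 s t m1I; have c2 := cov m2 s t m2I.
  apply: (cvg_unique _ c1); first exact: ereal_hausdorff.
  apply: cvg_trans c2; apply: near_eq_cvg; apply: nearW => n /=.
  have [stn|stn] := ltP (Num.max s (a n)) (Num.min t (b n)); last first.
    by rewrite set_itv_ge ?measure0// bnd_simp -leNgt.
  apply/esym/m12 => //; last exact: ltW.
  - apply: (oitv_interval (Iab n).1 (Iab n).2); rewrite le_max lexx orbT/=.
    by rewrite (le_trans (ltW stn))// ge_min lexx orbT.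
  - apply: (oitv_interval (Iab n).1 (Iab n).2); rewrite ge_min lexx orbT andbT.
    by rewrite (le_trans _ (ltW stn))// le_max lexx orbT.
- by move=> k; rewrite ltey_eq fin_num_measure.
Qed.

(** The positive and negative parts of the difference of the two charges are
    finite measures; they agree on intervals, hence everywhere. *)
Lemma charge_itv_unique c d (l1 l2 : borel_charge) : (c < d)%E ->
  (forall A : set B, measurable A -> l1 A = l1 (A `&` oitv c d)) ->
  (forall A : set B, measurable A -> l2 A = l2 (A `&` oitv c d)) ->
  (forall a b, oitv c d a -> oitv c d b -> a <= b ->
    l1 `]a, b]%classic = l2 `]a, b]%classic) ->
  forall A : set B, measurable A -> l1 A = l2 A.
Proof.
move=> cd l1I l2I l12.
pose nu : borel_charge := cadd l1 (cscale (-1) l2).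
have nuE A : nu A = (l1 A - l2 A)%E by congr (_ + _)%E; exact: mulN1e.
have [P [N nuPN]] := Hahn_decomposition nu.
have mI := oitv_measurable c d.
have [[mP _] [mN _] _ _] := nuPN.
have posE (A : set B) : measurable A -> jordan_pos nuPN A = nu (A `&` P).
  by move=> mA; rewrite jordan_posE cjordan_posE /crestr0 mem_set.
have negE (A : set B) : measurable A -> jordan_neg nuPN A = (- nu (A `&` N))%E.
  by move=> mA; rewrite jordan_negE cjordan_negE /crestr0 mem_set.
have nuI (A : set B) : measurable A -> nu A = nu (A `&` oitv c d).
  by move=> mA; rewrite !nuE l1I// l2I.
have nuPNE (A : set B) : measurable A ->
    nu A = (jordan_pos nuPN A - jordan_neg nuPN A)%E.
  by move=> mA; rewrite (jordan_decomp nuPN mA); congr (_ + _)%E; exact: mulN1e.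
have sub0 (x y : \bar R) : x \is a fin_num -> y \is a fin_num ->
    (x - y = 0 -> x = y)%E.
  by case: x; case: y => //= s r _ _ [] /eqP; rewrite subr_eq0 => /eqP ->.
have pn : forall A, measurable A -> jordan_pos nuPN A = jordan_neg nuPN A.
  apply: (finite_measure_itv_unique cd).
  - move=> A mA; have mAI : measurable (A `&` oitv c d) by exact: measurableI.
    apply: etrans (posE _ mA) _; apply: etrans (esym (posE _ mAI)).
    by rewrite nuI; [rewrite setIAC|exact: measurableI].
  - move=> A mA; have mAI : measurable (A `&` oitv c d) by exact: measurableI.
    apply: etrans (negE _ mA) _; apply: etrans (esym (negE _ mAI)).
    by rewrite nuI; [rewrite setIAC|exact: measurableI].
  - move=> a b Ia Ib ab; apply: sub0; rewrite ?fin_num_measure// -nuPNE//.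
    by rewrite nuE l12// subee// fin_num_measure.
move=> A mA; apply: sub0; rewrite ?fin_num_measure// -nuE nuPNE// pn// subee//.
by rewrite fin_num_measure.
Qed.

End interval_measures.

(** * The charge of a function of bounded variation *)

Section stieltjes_on_interval.
Context {R : realType}.
Local Notation B := (measurableTypeR R).

(** The name [rlim P] with its monotonicity proof as an argument, on which
    the structure of cumulative function can be declared. *)
Definition rcumul (P : R -> R) of nondecreasing_fun P : R -> R := rlim P.

HB.instance Definition _ P (ndP : nondecreasing_fun P) :=
  isCumulative.Build R _ R (rcumul ndP) (rlim_nondecreasing ndP)
    (fun x => @rlim_right_continuous R P x ndP).

Section bounded.
Variables (P : R -> R) (ndP : nondecreasing_fun P) (L U : R).
Hypothesis PLU : forall x, L <= P x <= U.

Local Notation ls := (lebesgue_stieltjes_measure (rcumul ndP)).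

Lemma stieltjes_itv a b : a <= b ->
  ls `]a, b]%classic = (rlim P b - rlim P a)%:E.
Proof.
move=> ab; rewrite /lebesgue_stieltjes_measure/= /measure_extension.
rewrite measurable_mu_extE/=; first exact: wlength_itv_bnd.
by exists (a, b).
Qed.

(** The line is an increasing union of intervals (-n, n], whose measures are
    increments of right limits of P. *)
Lemma stieltjes_le (A : set B) : measurable A -> (ls A <= (U - L)%:E)%E.
Proof.
move=> mA; apply: (@le_trans _ _ (ls setT)); first by apply: le_measure; rewrite ?inE.
have -> : [set: B] = \bigcup_k `](- k%:R), k%:R]%classic.
  apply/esym; rewrite -subTset => x _ /=.
  have := archi_boundP (normr_ge0 x); set n := Num.bound _ => xn; exists n => //=.
  by move: xn; rewrite in_itv/= ltr_norml => /andP[-> /ltW].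
have cv : (ls `](- k%:R), k%:R]%classic) @[k --> \oo] -->
    ls (\bigcup_k `](- k%:R), k%:R]%classic).
  apply: nondecreasing_cvg_mu => //; first exact: bigcup_measurable.
  move=> n m nm; apply/subsetPset => x /=; rewrite !in_itv/= => /andP[nx xn].
  have nm' : n%:R <= m%:R :> R by rewrite ler_nat.
  by rewrite (le_lt_trans _ nx) ?lerN2//= (le_trans xn).
rewrite -(cvg_lim _ cv)//; apply: lime_le; first by apply/cvg_ex; eexists; exact: cv.
apply: nearW => n; rewrite stieltjes_itv ?lee_fin; last first.
  by rewrite (@le_trans _ _ 0)// oppr_le0.
have rU x : rlim P x <= U.
  have xx1 : x < x + 1 by rewrite ltrDl.
  by apply: (le_trans (rlim_le ndP xx1)); case/andP: (PLU (x + 1)).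
have rL x : L <= rlim P x.
  by apply: (le_trans _ (le_rlim x ndP)); case/andP: (PLU x).
by rewrite lerB.
Qed.

(** The bound of P is an argument for the finite measure structure to be
    inferred from it. *)
Definition itv_stieltjes (c d : \bar R) of (forall x, L <= P x <= U) :=
  mrestr ls (oitv_measurable c d).

HB.instance Definition _ c d := Measure.on (itv_stieltjes c d PLU).

Lemma itv_stieltjes_le c d (A : set B) : measurable A ->
  (itv_stieltjes c d PLU A <= (U - L)%:E)%E.
Proof.
move=> mA; apply: stieltjes_le; apply: measurableI => //.
exact: oitv_measurable.
Qed.

Let itv_stieltjes_fin c d : fin_num_fun (itv_stieltjes c d PLU).
Proof.
move=> A mA; rewrite ge0_fin_numE//.
exact: le_lt_trans (itv_stieltjes_le c d mA) (ltry _).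
Qed.

HB.instance Definition _ c d := Measure_isFinite.Build _ _ _
  (itv_stieltjes c d PLU) (itv_stieltjes_fin c d).

Lemma itv_stieltjesE c d (A : set B) : itv_stieltjes c d PLU A =
  itv_stieltjes c d PLU (A `&` oitv c d).
Proof. by rewrite /itv_stieltjes /mrestr -setIA setIid. Qed.

Lemma itv_stieltjes_itv c d a b : oitv c d a -> oitv c d b -> a <= b ->
  itv_stieltjes c d PLU `]a, b]%classic = (rlim P b - rlim P a)%:E.
Proof.
move=> Ia Ib ab; rewrite /itv_stieltjes /mrestr setIidl ?stieltjes_itv//.
move=> x /=; rewrite in_itv/= => /andP[ax xb].
by apply: (oitv_interval Ia Ib); rewrite ltW.
Qed.

End bounded.
End stieltjes_on_interval.

Section lambda.
Context {R : realType}.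
Local Notation B := (measurableTypeR R).
Variables (c d : \bar R) (cd : (c < d)%E).
Local Notation I := (oitv c d : set R).

(** The charge is the difference of the Stieltjes measures of the two
    monotone parts of f, restricted to I. The oscillations of those parts, T
    and 4 T, bound the masses. *)
Lemma lambda_exists (f p : R -> R) T : dominated I f p ->
  (forall x, I x -> 0 <= p x <= T) ->
  exists lam : borel_charge, is_lambda I f lam /\
   exists m1 m2 : {finite_measure set B -> \bar R},
   forall A : set B, measurable A -> [/\ lam A = (m1 A - m2 A)%E,
     (m1 A <= T%:E)%E & (m2 A <= (4 * T)%:E)%E].
Proof.
move=> fp pT.
have [a [b [Iab _ _ _ _]]] := oitv_exhaustion cd.
have [P [Q [L [ndP ndQ fPQ _ PQ]]]] :=
  dominated_rlim_split (@oitv_open _ c d) fp pT (Iab 0%N).1.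
have hP x := (PQ x).1; have hQ x := (PQ x).2.
pose m1 : {finite_measure set B -> \bar R} := itv_stieltjes ndP c d hP.
pose m2 : {finite_measure set B -> \bar R} := itv_stieltjes ndQ c d hQ.
pose lam : borel_charge :=
  cadd (charge_of_finite_measure m1) (cscale (-1) (charge_of_finite_measure m2)).
have lamE A : lam A = (m1 A - m2 A)%E by congr (_ + _)%E; exact: mulN1e.
exists lam; split.
  split=> [x y Ix Iy xy|A mA].
    rewrite lamE [m1 _](itv_stieltjes_itv ndP hP Ix Iy xy).
    rewrite [m2 _](itv_stieltjes_itv ndQ hQ Ix Iy xy) -EFinB; congr (_%:E).
    rewrite -/(rlim f y) -/(rlim f x) (fPQ _ Ix).1 (fPQ _ Iy).1; lra.
  by rewrite !lamE [m1 A]itv_stieltjesE [m2 A]itv_stieltjesE.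
exists m1, m2 => A mA; split; first exact: lamE.
  by rewrite (le_trans (itv_stieltjes_le ndP hP c d mA))// lee_fin subr0.
by rewrite (le_trans (itv_stieltjes_le ndQ hQ c d mA))// lee_fin addrAC subrr add0r.
Qed.

Lemma lambda_is_lambda (f p : R -> R) T : dominated I f p ->
  (forall x, I x -> 0 <= p x <= T) -> is_lambda I f (lambda_ I f).
Proof.
move=> fp pT; have [lam [lamf _]] := lambda_exists fp pT.
by apply: xgetPex; exists lam.
Qed.

(** On the positive set of the Hahn decomposition the charge is at most m1,
    and on the negative set its opposite is at most m2. *)
Lemma charge_variation_le (lam : borel_charge)
    (m1 m2 : {finite_measure set B -> \bar R}) (t1 t2 : R)
    (P N : set B) (PN : hahn_decomposition lam P N) (A : set B) :
  measurable A ->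
  (forall C : set B, measurable C -> [/\ lam C = (m1 C - m2 C)%E,
     (m1 C <= t1%:E)%E & (m2 C <= t2%:E)%E]) ->
  (charge_variation PN A <= (t1 + t2)%:E)%E.
Proof.
move=> mA lamE; have [[mP _] [mN _] _ _] := PN.
have mAP : measurable (A `&` P) by exact: measurableI.
have mAN : measurable (A `&` N) by exact: measurableI.
rewrite /charge_variation/= EFinD leeD//.
  rewrite cjordan_posE /crestr0 mem_set// /crestr.
  have [-> m1t _] := lamE _ mAP.
  by rewrite leeBlDr ?fin_num_measure// (le_trans m1t)// leeDl.
rewrite jordan_negE cjordan_negE /crestr0 mem_set// /crestr.
have [-> _ m2t] := lamE _ mAN.
rewrite fin_num_oppeB ?fin_num_measure// addeC.
by rewrite leeBlDr ?fin_num_measure// (le_trans m2t)// leeDl.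
Qed.

(** The charge of f is also the charge of its right-limit function, so that
    the smaller variation of the latter can be used: 5 S is the sum of the
    masses S and 4 S of the two monotone parts. *)
Lemma total_variation_lambda_le (f p q : R -> R) T S : dominated I f p ->
  (forall x, I x -> 0 <= p x <= T) -> dominated I (rlim f) q ->
  (forall x, I x -> 0 <= q x <= S) ->
  (total_variation_charge (lambda_ I f) I <= (5 * S)%:E)%E.
Proof.
move=> fp pT fq qS.
have [lamI lamC] := lambda_is_lambda fp pT.
have [lam' [[lamI' lamC'] [m1 [m2 lamE]]]] := lambda_exists fq qS.
have lamlam' : forall A : set B, measurable A -> lambda_ I f A = lam' A.
  apply: (charge_itv_unique cd) => // a b Ia Ib ab.
  rewrite lamI// lamI'//; congr (_ - _)%:E.
    by rewrite -/(rlim (rlim f) b) (rlim_idem (@oitv_open _ c d) fp pT Ib).2.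
  by rewrite -/(rlim (rlim f) a) (rlim_idem (@oitv_open _ c d) fp pT Ia).2.
have -> : 5 * S = S + 4 * S by lra.
apply: (charge_variation_le (m1 := m1) (m2 := m2)).
  exact: oitv_measurable.
by move=> C mC; rewrite lamlam'//; exact: lamE.
Qed.

Lemma total_variation_charge_fin (lam : borel_charge) (A : set B) :
  measurable A -> total_variation_charge lam A \is a fin_num.
Proof.
by move=> mA; rewrite /total_variation_charge /charge_variation/= fin_numD !fin_num_measure.
Qed.

(** Each increment of the right-limit function is the value of the charge on
    a half-open interval, and these intervals are disjoint. *)
Lemma is_lambda_bvar (f : R -> R) (lam : borel_charge) : is_lambda I f lam ->
  bvar I (rlim f) (fine (total_variation_charge lam I)).
Proof.
move=> [lamI _] a b s Ia Ib abs.
pose tv : set B -> \bar R := total_variation_charge lam.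
have mI := oitv_measurable c d.
have tvU (C D : set B) : measurable C -> measurable D -> [disjoint C & D] ->
    tv (C `|` D) = (tv C + tv D)%E.
  move=> mC mD CD; rewrite /tv /total_variation_charge.
  by rewrite measureU//; exact/disj_set2P.
have tvab : (tv `]a, b]%classic <= tv I)%E.
  apply: le_measure; rewrite ?inE//=.
  move=> x /=; rewrite in_itv/= => /andP[ax xb].
  by apply: (oitv_interval Ia Ib); rewrite ltW.
rewrite -lee_fin fineK ?total_variation_charge_fin//.
apply: le_trans tvab.
elim: s a Ia abs => [|x s ih] a Ia abs; first by rewrite variation_nil measure_ge0.
have /itv_partition_cons xbs := abs.
have ax : a < x by case: abs => /= /andP[].
have xb : x <= b.
  case: s xbs {ih abs} => [/itv_partition_nil ->//|z s].
  by move/itv_partition_size_neq0 => /(_ isT)/ltW.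
have Ix : I x by apply: (oitv_interval Ia Ib); rewrite (ltW ax).
have axp : itv_partition a x [:: x] by exact: itv_partition1.
rewrite -cat1s (@variation_cat _ x)//; last exact: ltW.
have -> : `]a, b]%classic = `]a, x]%classic `|` `]x, b]%classic :> set B.
  by apply/esym; rewrite -itv_bndbnd_setU// bnd_simp// ltW.
rewrite tvU//; last first.
  apply/disj_set2P/seteqP; split => z //=.
  by rewrite !in_itv/= => -[/andP[_ zx] /andP[]]; rewrite ltNge zx.
rewrite EFinD leeD//; last exact: ih.
have -> : variation a x (rlim f) [:: x] = `|rlim f x - rlim f a|.
  by rewrite /variation/= big_nat1.
have := lamI _ _ Ia Ix (ltW ax); rewrite -/(rlim f x) -/(rlim f a) => lamax.
rewrite (_ : `|_|%:E = `|lam `]a, x]%classic|%E); last by rewrite lamax.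
exact: abse_charge_variation.
Qed.

End lambda.

(** * Partitions, Riemann sums and summation by parts *)

Section lebesgue_completed.
Context {R : realType}.
Local Notation T := (lebesgueR R).
Local Notation mu := (leb R).

Lemma borel_lebesgue_measurable (A : set R) :
  measurable (A : set (measurableTypeR R)) -> measurable (A : set T).
Proof. exact: sub_caratheodory. Qed.

Lemma measurable_itvL (i : interval R) : measurable ([set` i] : set T).
Proof. by apply: borel_lebesgue_measurable; exact: measurable_itv. Qed.

Lemma measurable_oitvL (c d : \bar R) : measurable (oitv c d).
Proof. by apply: borel_lebesgue_measurable; exact: oitv_measurable. Qed.

Lemma leb_itvco (a b : R) : a <= b -> mu `[a, b[%classic = (b - a)%:E.
Proof.
move=> ab; rewrite -[LHS]/(@lebesgue_measure R `[a, b[%classic).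
rewrite lebesgue_measure_itv/= lte_fin; case: ltP => // ba.
by rewrite (@le_anti _ _ a b) ?ab// subrr.
Qed.

Lemma integrable_itv_bounded (a b M : R) (f : T -> R) : a <= b ->
  measurable_fun (`[a, b[%classic : set T) f ->
  (forall x, a <= x < b -> `|f x| <= M) ->
  mu.-integrable (`[a, b[%classic : set T) (EFin \o f).
Proof.
move=> ab mf fM; apply: measurable_bounded_integrable => //.
- exact: measurable_itvL.
- by rewrite [X in (X < _)%E](leb_itvco ab) ltry.
- exists M; split; first exact: num_real.
  move=> r /= Mr x; rewrite in_itv/= => xab.
  by rewrite (le_trans (fM _ xab))// ltW.
Qed.

Lemma nondecreasing_measurableL (P : R -> R) (D : set T) :
  measurable D -> nondecreasing_fun P -> measurable_fun D (P : T -> R).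
Proof.
move=> mD ndP; apply: (@measurable_funS _ _ _ _ setT) => //.
move=> _ A mA; apply: borel_lebesgue_measurable.
by have := @nondecreasing_measurable R setT P measurableT ndP; exact.
Qed.

End lebesgue_completed.

Section real_integrable.
Context d (T : measurableType d) {R : realType} (mu : {measure set T -> \bar R}).
Variables (D : set T) (mD : measurable D).
Implicit Types f g : T -> R.

Lemma integrable_realZ r f : mu.-integrable D (EFin \o f) ->
  mu.-integrable D (EFin \o (fun t => r * f t)).
Proof. by move=> intf; exact: (integrableZl mD r intf). Qed.

Lemma integrable_realD f g : mu.-integrable D (EFin \o f) ->
  mu.-integrable D (EFin \o g) -> mu.-integrable D (EFin \o (fun t => f t + g t)).
Proof. by move=> intf intg; exact: (integrableD mD intf intg). Qed.

Lemma integrable_realB f g : mu.-integrable D (EFin \o f) ->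
  mu.-integrable D (EFin \o g) -> mu.-integrable D (EFin \o (fun t => f t - g t)).
Proof. by move=> intf intg; exact: (integrableB mD intf intg). Qed.

End real_integrable.

Section partitions.
Context {R : realType}.
Local Notation T := (lebesgueR R).
Local Notation mu := (leb R).

(** The points of the partition of [a, b] in n + 1 equal parts. *)
Definition upart (a b : R) (n i : nat) : R := a + (b - a) * (i%:R / n.+1%:R).

Lemma upart0 a b n : upart a b n 0 = a.
Proof. by rewrite /upart mul0r mulr0 addr0. Qed.

Lemma upartn a b n : upart a b n n.+1 = b.
Proof. by rewrite /upart divff ?pnatr_eq0// mulr1 addrC subrK. Qed.

Lemma upartS a b n i : upart a b n i.+1 = upart a b n i + (b - a) / n.+1%:R.
Proof. by rewrite /upart -addrA -mulrDr -(natr1 i) (mulrDl i%:R) mul1r. Qed.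

Lemma upart_nondecreasing a b n : a <= b -> nondecreasing_seq (upart a b n).
Proof.
move=> ab; apply/nondecreasing_seqP => i; rewrite upartS lerDl.
by rewrite divr_ge0// subr_ge0.
Qed.

Lemma upart_itv a b n i : a <= b -> (i <= n.+1)%N -> a <= upart a b n i <= b.
Proof.
move=> ab ni; rewrite -{1}(upart0 a b n) -{4}(upartn a b n).
by rewrite !upart_nondecreasing.
Qed.

(** Absolute continuity of the integral: the mesh goes to 0. *)
Lemma upart_small (a b : R) (f : T -> R) : a <= b ->
  mu.-integrable `[a, b[%classic (EFin \o f) -> forall e, 0 < e ->
  exists N, forall n i, (N <= n)%N -> (i < n.+1)%N ->
    \int[mu]_(t in `[upart a b n i, upart a b n i.+1[) `|f t| <= e.
Proof.
move=> ab intf e e0.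
have mab : measurable (`[a, b[%classic : set T) by exact: measurable_itvL.
pose h : T -> R := f \_ `[a, b[%classic.
have inth : mu.-integrable setT (EFin \o h).
  by rewrite /h -restrict_EFin; apply/(integrable_mkcond _ mab).
have [dl [dl0 H]] := integral_normr_continuous inth e0.
pose N := Num.bound ((b - a) / dl).
exists N => n i Nn ni.
have ab0 : 0 <= b - a by rewrite subr_ge0.
have := archi_boundP (divr_ge0 ab0 (ltW dl0)).
rewrite -/N ltr_pdivrMr// => Nd.
have Hn : (b - a) / n.+1%:R < dl.
  rewrite ltr_pdivrMr// mulrC (lt_le_trans Nd)// ler_wpM2r ?(ltW dl0)//.
  by rewrite ler_nat ltnW.
have ni1 := upart_nondecreasing n ab (leqnSn i).
have mA : measurable (`[upart a b n i, upart a b n i.+1[%classic : set T).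
  exact: measurable_itvL.
have := H _ mA; rewrite [X in (X < _)%E -> _](leb_itvco ni1).
rewrite lte_fin {1}upartS addrAC subrr add0r => /(_ Hn)/ltW.
rewrite [leLHS](_ : _ = \int[mu]_(t in `[upart a b n i, upart a b n i.+1[) `|f t|)//.
apply: eq_Rintegral => x; rewrite inE/= in_itv/= => /andP[ix xi].
rewrite /h patchE mem_set//= in_itv/=.
have /andP[aix _] := upart_itv ab (ltnW ni).
have /andP[_ xib] := upart_itv ab ni.
by rewrite (le_trans aix)//= (lt_le_trans xi).
Qed.

Lemma integrable_sub_itv (a b x y : R) (f : T -> R) : a <= x -> y <= b ->
  mu.-integrable `[a, b[%classic (EFin \o f) ->
  mu.-integrable `[x, y[%classic (EFin \o f).
Proof.
move=> ax yb; apply: integrableS; [exact: measurable_itvL|exact: measurable_itvL|].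
by move=> z /=; rewrite !in_itv/= => /andP[xz zy]; rewrite (le_trans ax)//= (lt_le_trans zy).
Qed.

Lemma Rintegral_itv_split (a x b : R) (f : T -> R) : a <= x -> x <= b ->
  mu.-integrable `[a, b[%classic (EFin \o f) ->
  \int[mu]_(t in `[a, b[) f t =
  \int[mu]_(t in `[a, x[) f t + \int[mu]_(t in `[x, b[) f t.
Proof.
move=> ax xb intf.
have abU : `[a, b[%classic = `[a, x[%classic `|` `[x, b[%classic :> set T.
  by rewrite -itv_bndbnd_setU// bnd_simp.
rewrite abU Rintegral_setU//.
- exact: measurable_itvL.
- exact: measurable_itvL.
- by rewrite -abU.
- apply/disj_set2P/seteqP; split => z //=.
  by rewrite !in_itv/= => -[/andP[_ zx] /andP[]]; rewrite leNgt zx.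
Qed.

Lemma Rintegral_partition (f : T -> R) (s : nat -> R) n : nondecreasing_seq s ->
  mu.-integrable `[s 0%N, s n[%classic (EFin \o f) ->
  \int[mu]_(t in `[s 0%N, s n[) f t =
  \sum_(0 <= i < n) \int[mu]_(t in `[s i, s i.+1[) f t.
Proof.
move=> nds; elim: n => [_|n ih intf].
  by rewrite big_nil set_itvco0 Rintegral_set0.
have s0n := nds _ _ (leq0n n); have snn := nds _ _ (leqnSn n).
rewrite big_nat_recr//= -ih; last exact: integrable_sub_itv intf.
by rewrite (Rintegral_itv_split s0n snn).
Qed.

(** On each block k differs from its value at the right end by at most the
    increment of q, and the integral of |f| there is at most e; the
    increments add up to q b - q a. *)
Lemma riemann_sum_error (a b : R) (f k : T -> R) (q : R -> R) (s : nat -> R) n e :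
  nondecreasing_seq s -> s 0%N = a -> s n = b ->
  mu.-integrable `[a, b[%classic (EFin \o f) ->
  mu.-integrable `[a, b[%classic (EFin \o (fun t => f t * k t)) ->
  dominated [set x | a <= x <= b] k q ->
  (forall i, (i < n)%N -> \int[mu]_(t in `[s i, s i.+1[) `|f t| <= e) ->
  `|\int[mu]_(t in `[a, b[) (f t * k t) -
    \sum_(0 <= i < n) k (s i.+1) * \int[mu]_(t in `[s i, s i.+1[) f t|
  <= e * (q b - q a).
Proof.
move=> nds s0 sn intf intfk kq small.
have sab i : (i <= n)%N -> a <= s i <= b.
  by move=> ni; rewrite -s0 -sn !nds.
rewrite -{1}s0 -{1}sn (Rintegral_partition nds); last by rewrite s0 sn.
rewrite -sumrB.
have -> : q b - q a = \sum_(0 <= i < n) (q (s i.+1) - q (s i)).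
  by rewrite telescope_sumr// s0 sn.
rewrite mulr_sumr (le_trans (ler_norm_sum _ _ _))// big_nat [leRHS]big_nat.
apply: ler_sum => i /andP[_ ni].
have /andP[asi sib] := sab _ (ltnW ni).
have /andP[asi1 sib1] := sab _ ni.
have intfi : mu.-integrable `[s i, s i.+1[%classic (EFin \o f).
  exact: integrable_sub_itv intf.
have intfki : mu.-integrable `[s i, s i.+1[%classic (EFin \o (fun t => f t * k t)).
  exact: integrable_sub_itv intfk.
have mi : measurable (`[s i, s i.+1[%classic : set T) by exact: measurable_itvL.
have intfc : mu.-integrable `[s i, s i.+1[%classic (EFin \o (fun t => k (s i.+1) * f t)).
  exact: integrable_realZ.
rewrite -RintegralZl// -RintegralB//.
have intd : mu.-integrable `[s i, s i.+1[%classic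
    (EFin \o (fun t => f t * k t - k (s i.+1) * f t)).
  exact: integrable_realB.
rewrite (le_trans (le_normr_Rintegral mi intd))//.
have qnd : 0 <= q (s i.+1) - q (s i).
  by apply: (le_trans (normr_ge0 _) (kq (s i) (s i.+1) _ _ _)); rewrite /= ?asi ?asi1// nds.
apply: (@le_trans _ _ (\int[mu]_(t in `[s i, s i.+1[) ((q (s i.+1) - q (s i)) * `|f t|))).
  apply: le_Rintegral => //.
  - exact: (integrable_norm intd).
  - by apply: integrable_realZ => //; exact: (integrable_norm intfi).
  move=> t /=; rewrite in_itv/= => /andP[sit tsi].
  rewrite [k _ * _]mulrC -mulrBr normrM mulrC ler_wpM2r// distrC.
  have atb : [set x | a <= x <= b] t.
    by rewrite /= (le_trans asi)//= (le_trans (ltW tsi)).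
  have := kq t (s i.+1) atb; rewrite /= asi1 sib1 => /(_ isT (ltW tsi))/le_trans; apply.
  rewrite lerD2l lerN2; apply: (dominated_nondecreasing kq) => //=.
  by rewrite asi.
rewrite RintegralZl//; last exact: (integrable_norm intfi).
by rewrite mulrC ler_wpM2r// small.
Qed.

End partitions.

Section abel.
Context {R : realType}.
Implicit Types (F V g p : nat -> R).

(** Summation by parts for sum k_i dF_i with k = g / V, bounding F by N V.
    The jump of k times F splits in two: V k has the jump of g, bounded by
    that of p, and the rest is k times the jump of V. *)
Lemma abel_quotient F V g p (N M : R) n :
  (forall i, (i <= n)%N -> `|F i| <= N * V i) ->
  (forall i, (i <= n)%N -> 0 < V i) ->
  (forall i, (i < n)%N -> V i <= V i.+1) ->
  (forall i, (i <= n)%N -> `|g i| <= M) ->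
  (forall i, (i < n)%N -> `|g i.+1 - g i| <= p i.+1 - p i) ->
  `|\sum_(0 <= i < n) g i.+1 / V i.+1 * (F i.+1 - F i)| <=
  N * (2 * M + (p n - p 0%N) +
       \sum_(0 <= i < n) `|g i.+1 / V i.+1| * (V i.+1 - V i)).
Proof.
move=> FN V0 Vnd gM gp.
have N0 : 0 <= N.
  have := le_trans (normr_ge0 _) (FN 0%N isT).
  by rewrite pmulr_lge0// V0.
have bnd i : (i <= n)%N -> `|g i / V i * F i| <= N * M.
  move=> ni; rewrite mulrAC normrM normfV mulrC.
  rewrite (gtr0_norm (V0 _ ni)) mulrC ler_pdivrMr ?V0// normrM mulrC.
  rewrite (le_trans (ler_pM _ _ (FN _ ni) (gM _ ni)))// mulrAC; lra.
have key m : (m <= n)%N ->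
  `|\sum_(0 <= i < m) g i.+1 / V i.+1 * (F i.+1 - F i)
     - (g m / V m * F m - g 0%N / V 0%N * F 0%N)| <=
  N * (p m - p 0%N + \sum_(0 <= i < m) `|g i.+1 / V i.+1| * (V i.+1 - V i)).
  elim: m => [_|m ih mn]; first by rewrite !big_nil !subrr normr0 addr0 mulr0.
  have {}ih := ih (ltnW mn).
  rewrite !big_nat_recr//=.
  set S := \sum_(0 <= i < m) _ in ih *; set S' := \sum_(0 <= i < m) _ in ih *.
  have E : `|(g m.+1 / V m.+1 - g m / V m) * F m| <=
      N * (p m.+1 - p m + `|g m.+1 / V m.+1| * (V m.+1 - V m)).
    have Vm := V0 _ (ltnW mn); have Vm1 := V0 _ mn.
    rewrite normrM (le_trans (ler_wpM2l _ (FN _ (ltnW mn))))//.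
    rewrite mulrCA ler_wpM2l// -[X in _ * X](gtr0_norm Vm) -normrM mulrBl.
    rewrite divfK ?gt_eqF//.
    have -> : g m.+1 / V m.+1 * V m - g m =
        (g m.+1 - g m) - g m.+1 / V m.+1 * (V m.+1 - V m).
      by rewrite mulrBr divfK ?gt_eqF//; lra.
    rewrite (le_trans (ler_normB _ _))// lerD ?gp// normrM.
    by rewrite (ger0_norm (_ : 0 <= V m.+1 - V m))// subr_ge0 Vnd.
  have -> : S + g m.+1 / V m.+1 * (F m.+1 - F m) -
      (g m.+1 / V m.+1 * F m.+1 - g 0%N / V 0%N * F 0%N) =
     (S - (g m / V m * F m - g 0%N / V 0%N * F 0%N)) -
     (g m.+1 / V m.+1 - g m / V m) * F m by ring.
  rewrite (le_trans (ler_normB _ _))// (le_trans (lerD ih E))//.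
  by rewrite -mulrDr le_eqVlt; apply/orP; left; apply/eqP; congr (_ * _); ring.
(* The two boundary terms of the summation are each at most N M. *)
have := key n (leqnn n); set S := \sum_(0 <= i < n) _; set S' := \sum_(0 <= i < n) _.
have := bnd n (leqnn n); have := bnd 0%N isT.
move: (g n / V n * F n) (g 0%N / V 0%N * F 0%N) => A C hC hA hS.
have -> : S = (S - (A - C)) + A - C by ring.
rewrite (le_trans (ler_normB _ _))//.
have -> : N * (2 * M + (p n - p 0%N) + S') = N * (p n - p 0%N + S') + N * M + N * M by ring.
rewrite lerD// (le_trans (ler_normD _ _))// lerD//.
Qed.

(** Summation by parts for sum H_i dV_i, where e bounds the terms V_(i+1)
    (H_i - H_(i+1)). *)
Lemma abel_majorant (H V e : nat -> R) n : 0 <= H 0%N * V 0%N ->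
  (forall i, (i < n)%N -> V i.+1 * (H i - H i.+1) <= e i) ->
  \sum_(0 <= i < n) H i * (V i.+1 - V i) <= H n * V n + \sum_(0 <= i < n) e i.
Proof.
move=> H0 He.
suff : \sum_(0 <= i < n) H i * (V i.+1 - V i) <=
    H n * V n - H 0%N * V 0%N + \sum_(0 <= i < n) e i by lra.
elim: n He => [_|n ih He]; first by rewrite !big_nil subrr addr0.
have {}ih := ih (fun i ni => He i (ltnW ni)).
rewrite !big_nat_recr//=.
have := He n (ltnSn n).
move: ih; set S := \sum_(0 <= i < n) _; set S' := \sum_(0 <= i < n) _; lra.
Qed.

End abel.

(** * Primitives and quotients by a primitive *)

Section primitive.
Context {R : realType}.
Local Notation T := (lebesgueR R).
Local Notation mu := (leb R).

(** Measurability comes from the monotone parts. *)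
Lemma dominated_measurable (D : set T) (f p : R -> R) L U : measurable D ->
  dominated D f p -> (forall x, D x -> L <= p x <= U) ->
  measurable_fun D (f : T -> R).
Proof.
move=> mD fp pLU; have [->|/set0P[x0 Dx0]] := eqVneq D set0.
  exact: measurable_fun_set0.
pose p' x := p x - L.
have fp' : dominated D f p' by move=> x y Dx Dy /(fp _ _ Dx Dy); rewrite /p'; lra.
have p'U x : D x -> 0 <= p' x <= U - L by move=> /pLU; rewrite /p'; lra.
have [P [Q [_ [ndP ndQ fPQ _ _]]]] := dominated_split Dx0 fp' p'U.
apply: (@eq_measurable_fun _ _ _ _ D (fun x : T => P x - Q x)).
  by move=> x /set_mem Dx; rewrite fPQ.
by apply: measurable_funB; exact: nondecreasing_measurableL.
Qed.

Lemma integrable_real_mul_bounded (D : set T) (f k : T -> R) K : measurable D ->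
  measurable_fun D k -> (forall x, D x -> `|k x| <= K) ->
  mu.-integrable D (EFin \o f) -> mu.-integrable D (EFin \o (fun t => f t * k t)).
Proof.
move=> mD mk kK intf.
have intg : mu.-integrable D (fun x => (K%:E * (abse \o (EFin \o f)) x)%E).
  by apply: integrableZl => //; exact: integrable_abse.
apply: (le_integrable mD _ _ intg).
  apply/measurable_EFinP; apply: measurable_funM => //.
  by apply/measurable_EFinP; exact: measurable_int intf.
move=> x Dx; rewrite -[leLHS]/(`|f x * k x|%:E) -[leRHS]/(`|K * Num.norm (f x)|%:E).
rewrite lee_fin normrM.
have K0 : 0 <= K by exact: le_trans (kK _ Dx).
by rewrite [leRHS]ger0_norm ?mulr_ge0// mulrC ler_wpM2r// kK.
Qed.

Section c.
Variables (c d : \bar R).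
Local Notation I := (oitv c d : set R).

Definition loc_int (f : T -> R) :=
  forall x, I x -> mu.-integrable (oitv c x%:E) (EFin \o f).

Definition prim (f : T -> R) (x : R) : R := \int[mu]_(t in oitv c x%:E) f t.

Lemma oitv_cat x y : I x -> x <= y ->
  oitv c y%:E = oitv c x%:E `|` `[x, y[%classic :> set T.
Proof.
move=> /andP[cx _] xy; apply/seteqP; split => z /=.
  rewrite /oitv/= in_itv/= !lte_fin => /andP[-> ->]/=.
  by have [] := ltP z x; [left|right].
rewrite /oitv/= in_itv/= !lte_fin => -[/andP[-> zx]|/andP[xz ->]]/=.
  exact: lt_le_trans xy.
by rewrite (lt_le_trans cx)// lee_fin.
Qed.

Lemma loc_int_itv f x y : loc_int f -> I x -> I y ->
  mu.-integrable `[x, y[%classic (EFin \o f).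
Proof.
move=> lf Ix Iy; apply: integrableS (lf _ Iy).
- exact: measurable_oitvL.
- exact: measurable_itvL.
move=> z /=; rewrite /oitv/= in_itv/= lte_fin => /andP[xz ->].
by rewrite (lt_le_trans (andP Ix).1)// lee_fin.
Qed.

Lemma primB f x y : loc_int f -> I x -> I y -> x <= y ->
  prim f y - prim f x = \int[mu]_(t in `[x, y[) f t.
Proof.
move=> lf Ix Iy xy; rewrite /prim (oitv_cat Ix xy) Rintegral_setU.
- by rewrite addrAC subrr add0r.
- exact: measurable_oitvL.
- exact: measurable_itvL.
- by rewrite -(oitv_cat Ix xy); exact: lf.
- apply/disj_set2P/seteqP; split => z //=.
  by rewrite /oitv/= in_itv/= lte_fin => -[/andP[_ zx] /andP[]]; rewrite leNgt zx.
Qed.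

Lemma prim_ge0 f x : (forall t, 0 <= f t) -> 0 <= prim f x.
Proof. by move=> f0; apply: Rintegral_ge0. Qed.

Lemma prim_nondecreasing f x y : (forall t, 0 <= f t) -> loc_int f ->
  I x -> I y -> x <= y -> prim f x <= prim f y.
Proof.
by move=> f0 lf Ix Iy xy; rewrite -subr_ge0 primB//; exact: Rintegral_ge0.
Qed.

Section weight.
Variable v : T -> R.
Hypotheses (v0 : forall t, 0 <= v t) (lv : loc_int v).
Local Notation V := (prim v).
Hypothesis V0 : forall x, I x -> 0 < V x.

Section bv.
Variables (g p : R -> R) (M : R).
Hypotheses (gp : dominated I g p) (gM : forall x, I x -> `|g x| <= M).

Local Notation k := (fun x => g x / V x).

Let I_in a b x : I a -> I b -> a <= x <= b -> I x.
Proof. by move=> Ia Ib; exact: (oitv_interval Ia Ib). Qed.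

Let Vnd x y : I x -> I y -> x <= y -> V x <= V y.
Proof. exact: prim_nondecreasing. Qed.

Let q a x := p x / V a - M / V x.

(** The quotient k = g / V varies because g does and because V does. On [a,
    b] the first part is at most the increment of p / V a, and the second M
    times the decrease of 1 / V. *)
Lemma quotient_dominated a b : I a -> I b -> a <= b ->
  dominated [set x | a <= x <= b] k (q a).
Proof.
move=> Ia Ib ab x y axb ayb xy.
have Ix := I_in Ia Ib axb; have Iy := I_in Ia Ib ayb.
have Vx := V0 Ix; have Vy := V0 Iy; have Va := V0 Ia.
have Vxy : (V y)^-1 <= (V x)^-1 by rewrite lef_pV2 ?posrE// Vnd.
have Vax : (V x)^-1 <= (V a)^-1 by rewrite lef_pV2 ?posrE// Vnd//; case/andP: axb.
have -> : g y / V y - g x / V x =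
    (g y - g x) / V x - g y * ((V x)^-1 - (V y)^-1) by ring.
rewrite (le_trans (ler_normB _ _))//.
have -> : q a y - q a x = (p y - p x) / V a + M * ((V x)^-1 - (V y)^-1).
  by rewrite /q; ring.
apply: lerD; rewrite normrM.
  rewrite (@ger0_norm _ (V x)^-1) ?invr_ge0 ?(ltW Vx)//.
  by apply: ler_pM; rewrite ?invr_ge0 ?(ltW Va) ?(ltW Vx)// gp.
by rewrite (@ger0_norm _ (_ - _)) ?subr_ge0// ler_wpM2r ?subr_ge0 ?gM.
Qed.

Lemma quotient_bounded a x : I a -> I x -> a <= x -> `|k x| <= M / V a.
Proof.
move=> Ia Ix ax; rewrite normrM normfV (gtr0_norm (V0 Ix)).
apply: ler_pM; rewrite ?invr_ge0 ?(ltW (V0 Ix)) ?gM//.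
by rewrite lef_pV2 ?posrE ?V0// Vnd.
Qed.

Lemma quotient_measurable a b : I a -> I b -> a <= b ->
  measurable_fun (`[a, b[%classic : set T) (k : T -> R).
Proof.
move=> Ia Ib ab; apply: (@measurable_funS _ _ _ _ (`[a, b]%classic : set T)).
- exact: measurable_itvL.
- by move=> x /=; rewrite !in_itv/= => /andP[-> /ltW].
have kq : dominated `[a, b]%classic k (q a).
  by move=> x y /= xab yab; apply: (quotient_dominated Ia Ib ab).
apply: (dominated_measurable (measurable_itvL _) kq (L := q a a) (U := q a b)).
move=> x /=; rewrite in_itv/= => /andP[ax xb].
by rewrite !(dominated_nondecreasing kq)//= in_itv/= ?lexx ?ab ?ax ?xb.
Qed.

Lemma quotient_integrable f a b : loc_int f -> I a -> I b -> a <= b ->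
  mu.-integrable (`[a, b[%classic : set T) (EFin \o (fun t => f t * k t)).
Proof.
move=> lf Ia Ib ab; apply: (@integrable_real_mul_bounded _ f k (M / V a)).
- exact: measurable_itvL.
- exact: quotient_measurable.
- move=> x /=; rewrite in_itv/= => /andP[ax xb].
  by apply: quotient_bounded => //; apply: (I_in Ia Ib); rewrite ax ltW.
- exact: loc_int_itv.
Qed.

Lemma quotient_abs_integrable f a b : loc_int f -> I a -> I b -> a <= b ->
  mu.-integrable (`[a, b[%classic : set T) (EFin \o (fun t => f t * `|k t|)).
Proof.
move=> lf Ia Ib ab; apply: (@integrable_real_mul_bounded _ f (Num.norm \o k) (M / V a)).
- exact: measurable_itvL.
- by apply: measurableT_comp => //; exact: quotient_measurable.
- move=> x /=; rewrite in_itv/= => /andP[ax xb].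
  rewrite normr_id.
  by apply: quotient_bounded => //; apply: (I_in Ia Ib); rewrite ax ltW.
- exact: loc_int_itv.
Qed.

(** The Riemann sum of |k| against v, which appears in the summation by
    parts, is close to the integral. *)
Lemma riemann_weight a b e n : I a -> I b -> a <= b ->
  (forall i, (i < n.+1)%N ->
    \int[mu]_(t in `[upart a b n i, upart a b n i.+1[) `|v t| <= e) ->
  \sum_(0 <= i < n.+1) `|k (upart a b n i.+1)| *
     (V (upart a b n i.+1) - V (upart a b n i)) <=
  \int[mu]_(t in `[a, b[) (v t * `|k t|) + e * (q a b - q a a).
Proof.
move=> Ia Ib ab small; set s := upart a b n.
have Is i : (i <= n.+1)%N -> I (s i).
  by move=> ni; apply: (I_in Ia Ib); exact: upart_itv.
have nds : nondecreasing_seq s := upart_nondecreasing n ab.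
have dk : dominated [set x | a <= x <= b] (fun x => `|k x|) (q a).
  move=> x y ax ay xy; rewrite (le_trans (ler_dist_dist _ _))//.
  exact: (quotient_dominated Ia Ib ab).
have := riemann_sum_error nds (upart0 a b n) (upartn a b n)
  (loc_int_itv lv Ia Ib) (quotient_abs_integrable lv Ia Ib ab) dk small.
rewrite distrC ler_distl => /andP[_]; apply: le_trans.
rewrite big_nat [leRHS]big_nat; apply: ler_sum => i /andP[_ ni].
by rewrite primB//; [exact/Is/ltnW|exact: Is|exact: nds].
Qed.

(** Integration by parts: the inequality of [abel_quotient] on fine
    partitions, where the sums on both sides are close to integrals. *)
Lemma quotient_integral_le f N a b : loc_int f ->
  (forall x, I x -> `|prim f x| <= N * V x) -> I a -> I b -> a <= b ->
  `|\int[mu]_(t in `[a, b[) (f t * k t)| <=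
  N * (2 * M + (p b - p a) + \int[mu]_(t in `[a, b[) (v t * `|k t|)).
Proof.
move=> lf fN Ia Ib ab.
have N0 : 0 <= N.
  by have := le_trans (normr_ge0 _) (fN a Ia); rewrite pmulr_lge0// V0.
set Q := q a b - q a a.
have Q0 : 0 <= Q.
  have /(_ a b)/= := quotient_dominated Ia Ib ab.
  by rewrite !lexx ab => /(_ isT isT isT); exact: le_trans.
apply/ler_addgt0Pr => e e0.
(* The errors on f and on v add up to (N + 1) e' Q; the summand 1 is there
   for the denominator to be positive. *)
pose e' := e / (N * Q + Q + 1).
have D0 : 0 < N * Q + Q + 1 by rewrite ltr_wpDl// addr_ge0// mulr_ge0.
have e'0 : 0 < e' by rewrite divr_gt0.
have e'e : N * (e' * Q) + e' * Q <= e.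
  have -> : e = e' * (N * Q + Q + 1) by rewrite /e' divfK// gt_eqF.
  have -> : N * (e' * Q) + e' * Q = e' * (N * Q + Q) by ring.
  by rewrite ler_pM2l// lerDl.
have [n1 H1] := upart_small ab (loc_int_itv lf Ia Ib) e'0.
have [n2 H2] := upart_small ab (loc_int_itv lv Ia Ib) e'0.
pose n := maxn n1 n2.
pose s := upart a b n.
have nds : nondecreasing_seq s := upart_nondecreasing n ab.
have Is i : (i <= n.+1)%N -> I (s i).
  by move=> ni; apply: (I_in Ia Ib); exact: upart_itv.
have Hf i : (i < n.+1)%N -> \int[mu]_(t in `[s i, s i.+1[) `|f t| <= e'.
  by move=> ni; apply: H1 => //; exact: leq_maxl.
have Hv i : (i < n.+1)%N -> \int[mu]_(t in `[s i, s i.+1[) `|v t| <= e'.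
  by move=> ni; apply: H2 => //; exact: leq_maxr.
have Rf := riemann_sum_error nds (upart0 a b n) (upartn a b n)
  (loc_int_itv lf Ia Ib) (quotient_integrable lf Ia Ib ab)
  (quotient_dominated Ia Ib ab) Hf.
have Rv := riemann_weight Ia Ib ab Hv.
have := @abel_quotient R (prim f \o s) (V \o s) (g \o s) (p \o s) N M n.+1.
rewrite /= => /(_ _ _ _ _ _)-/(_ (fun i ni => fN _ (Is i ni)))
  -/(_ (fun i ni => V0 (Is i ni)))
  -/(_ (fun i ni => Vnd (Is i (ltnW ni)) (Is i.+1 ni) (nds _ _ (leqnSn i))))
  -/(_ (fun i ni => gM (Is i ni)))
  -/(_ (fun i ni => gp (Is i (ltnW ni)) (Is i.+1 ni) (nds _ _ (leqnSn i)))).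
rewrite /s upart0 upartn -/s => Ab.
move: Rf; have -> : \sum_(0 <= i < n.+1) g (s i.+1) / V (s i.+1) *
    \int[mu]_(t in `[s i, s i.+1[) f t =
  \sum_(0 <= i < n.+1) g (s i.+1) / V (s i.+1) * (prim f (s i.+1) - prim f (s i)).
  rewrite big_nat [RHS]big_nat; apply: eq_bigr => i /andP[_ ni].
  by rewrite primB//; [exact/Is/ltnW|exact: Is|exact: nds].
set S := \sum_(0 <= i < n.+1) _ in Ab *; set J := Rintegral _ _ _ => Rf.
have -> : J = (J - S) + S by rewrite subrK.
rewrite (le_trans (ler_normD _ _))// (le_trans (lerD Rf Ab))//.
set S' := \sum_(0 <= i < n.+1) _ in Rv *; set J' := Rintegral _ _ _ in Rv *.
have : N * S' <= N * (J' + e' * Q) by rewrite ler_wpM2l.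
move: e'e; rewrite -/Q; lra.
Qed.

End bv.
End weight.
End c.
End primitive.

(** * Tail suprema of the quotient, and boundedness of its numerator *)

Section majorant.
Context {R : realType}.
Local Notation T := (lebesgueR R).
Local Notation mu := (leb R).
Variables (c d : \bar R).
Local Notation I := (oitv c d : set R).
Variable v : T -> R.
Hypotheses (v0 : forall t, 0 <= v t) (lv : loc_int c d v).
Local Notation V := (prim c v).
Hypothesis V0 : forall x, I x -> 0 < V x.

Let I_in a b x : I a -> I b -> a <= x <= b -> I x.
Proof. by move=> Ia Ib; exact: (oitv_interval Ia Ib). Qed.

Let Vnd x y : I x -> I y -> x <= y -> V x <= V y.
Proof. exact: prim_nondecreasing. Qed.

(** The least nonincreasing majorant of |k|; for k = g almost everywhere it
    bounds the essential supremum of |g| over [x, d). *)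
Definition tail_sup (k : R -> R) (x : R) : R :=
  sup [set `|k y| | y in I `&` [set y | x <= y]].

Section bv.
Variables (g p : R -> R) (M : R).
Hypotheses (gp : dominated I g p) (gM : forall x, I x -> `|g x| <= M).

Local Notation k := (fun x => g x / V x).
Local Notation H := (tail_sup k).

Lemma tail_sup_ge x y : I x -> I y -> x <= y -> `|k y| <= H x.
Proof.
move=> Ix Iy xy; apply: ub_le_sup; last by exists y.
exists (M / V x) => _ [z [Iz /= xz] <-].
exact: (quotient_bounded v0 lv V0 gM).
Qed.

Lemma tail_sup_le x r : I x ->
  (forall y, I y -> x <= y -> `|k y| <= r) -> H x <= r.
Proof.
move=> Ix kr; apply: ge_sup; first by exists `|k x|, x; split => //=.
by move=> _ [y [Iy /= xy] <-]; exact: kr.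
Qed.

Lemma tail_sup_ge0 x : I x -> 0 <= H x.
Proof. by move=> Ix; apply: le_trans (tail_sup_ge Ix Ix (lexx x)). Qed.

Lemma tail_sup_nonincreasing x y : I x -> I y -> x <= y -> H y <= H x.
Proof.
move=> Ix Iy xy; apply: tail_sup_le => // z Iz yz.
by apply: tail_sup_ge => //; exact: le_trans yz.
Qed.

Lemma tail_sup_bounded x : I x -> H x <= M / V x.
Proof.
by move=> Ix; apply: tail_sup_le => // y Iy xy; exact: (quotient_bounded v0 lv V0 gM).
Qed.

Lemma tail_sup_measurable a b : I a -> I b -> a <= b ->
  measurable_fun (`[a, b[%classic : set T) (H : T -> R).
Proof.
move=> Ia Ib ab.
have hI x : `[a, b[%classic x -> I x.
  by rewrite /= in_itv/= => /andP[ax xb]; apply: (I_in Ia Ib); rewrite ax ltW.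
apply: (@dominated_measurable _ _ H (fun x => - H x) (- H a) 0).
- exact: measurable_itvL.
- move=> x y /hI Ix /hI Iy xy.
  rewrite ler0_norm ?subr_le0; last exact: tail_sup_nonincreasing.
  by rewrite opprB opprK addrC.
- move=> x xab; rewrite lerN2 oppr_le0 tail_sup_ge0 ?andbT; last exact: hI.
  apply: tail_sup_nonincreasing => //; first exact: hI.
  by move: xab; rewrite /= in_itv/= => /andP[].
Qed.

Lemma tail_sup_integrable a b : I a -> I b -> a <= b ->
  mu.-integrable (`[a, b[%classic : set T) (EFin \o (fun t => v t * H t)).
Proof.
move=> Ia Ib ab; apply: (@integrable_real_mul_bounded _ _ v H (H a)).
- exact: measurable_itvL.
- exact: tail_sup_measurable.
- move=> x /=; rewrite in_itv/= => /andP[ax xb].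
  have Ix : I x by apply: (I_in Ia Ib); rewrite ax ltW.
  by rewrite ger0_norm ?tail_sup_ge0// tail_sup_nonincreasing.
- exact: loc_int_itv lv Ia Ib.
Qed.

(** Let H be the tail supremum. On a block [s, s'] of a partition, V s' (H s
    - H s') is positive only if |k| exceeds its later suprema somewhere in
    the block; as V k = g, this excess is at most the increment of p there,
    up to |k s'| times the increment of V and to an error due to the
    oscillation of k. [abel_majorant] then gives the bound. *)
Lemma tail_sup_integral_le a b : I a -> I b -> a <= b ->
  \int[mu]_(t in `[a, b[) (v t * H t) <=
  M + (p b - p a) + \int[mu]_(t in `[a, b[) (v t * `|k t|).
Proof.
move=> Ia Ib ab.
pose q x := p x / V a - M / V x.
have qdom : dominated [set x | a <= x <= b] k q := quotient_dominated v0 lv V0 gp gM Ia Ib ab.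
set Q := q b - q a.
have Q0 : 0 <= Q.
  have /(_ a b)/= := qdom.
  by rewrite !lexx ab => /(_ isT isT isT); exact: le_trans.
apply/ler_addgt0Pr => e e0.
pose e' := e / (2 * Q + 1).
have D0 : 0 < 2 * Q + 1 by rewrite ltr_wpDl// mulr_ge0.
have e'0 : 0 < e' by rewrite divr_gt0.
have e'e : 2 * (e' * Q) <= e.
  have -> : e = e' * (2 * Q + 1) by rewrite /e' divfK// gt_eqF.
  have -> : 2 * (e' * Q) = e' * (2 * Q) by ring.
  by rewrite ler_pM2l// lerDl.
have [n Hn] := upart_small ab (loc_int_itv lv Ia Ib) e'0.
pose s := upart a b n.
have nds : nondecreasing_seq s := upart_nondecreasing n ab.
have sab i : (i <= n.+1)%N -> a <= s i <= b by move=> ni; exact: upart_itv.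
have Is i : (i <= n.+1)%N -> I (s i) by move=> /sab; exact: (I_in Ia Ib).
have Hv i : (i < n.+1)%N -> \int[mu]_(t in `[s i, s i.+1[) `|v t| <= e'.
  by move=> ni; apply: Hn.
have dV i : (i < n.+1)%N -> V (s i.+1) - V (s i) = \int[mu]_(t in `[s i, s i.+1[) v t.
  by move=> ni; rewrite (primB lv)//; [exact/Is/ltnW|exact: Is|exact: nds].
have dVe i : (i < n.+1)%N -> V (s i.+1) - V (s i) <= e'.
  move=> ni; rewrite dV// (le_trans _ (Hv i ni))//.
  by rewrite [leRHS](@eq_Rintegral _ _ _ _ _ v)// => t _; rewrite ger0_norm.
have dV0 i : (i < n.+1)%N -> 0 <= V (s i.+1) - V (s i).
  by move=> ni; rewrite subr_ge0 Vnd//; [exact/Is/ltnW|exact: Is|exact: nds].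
have Rv := riemann_weight v0 lv V0 gp gM Ia Ib ab Hv.
(* The last summand accounts for the oscillation of k within the block. *)
pose E i := (p (s i.+1) - p (s i)) + `|k (s i.+1)| * (V (s i.+1) - V (s i))
  + e' * (q (s i.+1) - q (s i)).
have HE i : (i < n.+1)%N -> V (s i.+1) * (H (s i) - H (s i.+1)) <= E i.
  move=> ni; have Isi := Is _ (ltnW ni); have Isi1 := Is _ ni.
  have Vi1 := V0 Isi1.
  rewrite mulrC -ler_pdivlMr// lerBlDr; apply: tail_sup_le => // y Iy siy.
  have E0 : 0 <= E i / V (s i.+1).
    apply: divr_ge0; last exact: ltW.
    apply: addr_ge0; first apply: addr_ge0.
    - by rewrite subr_ge0 (dominated_nondecreasing gp)// nds.
    - by rewrite mulr_ge0// dV0.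
    - apply: mulr_ge0; first exact: ltW.
      by rewrite subr_ge0 (dominated_nondecreasing qdom)//= ?sab//; [exact: ltnW|exact: nds].
  have [yi|/ltW yi] := leP (s i.+1) y.
    by rewrite (le_trans (tail_sup_ge Isi1 Iy yi))// lerDr.
  have yab : [set x | a <= x <= b] y.
    have /andP[h1 _] := sab _ (ltnW ni); have /andP[_ h2] := sab _ ni.
    by rewrite /= (le_trans h1)//= (le_trans yi).
  have Vy := V0 Iy.
  have dkq : `|k (s i.+1) - k y| <= q (s i.+1) - q (s i).
    rewrite (le_trans (qdom _ _ yab (sab _ ni) yi))// lerD2l lerN2.
    by apply: (dominated_nondecreasing qdom) => //=; rewrite sab// ltnW.
  have h1 : `|k y - k (s i.+1)| <= E i / V (s i.+1).
    rewrite ler_pdivlMr// -[X in _ * X](gtr0_norm Vi1) -normrM mulrBl divfK ?gt_eqF//.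
    have -> : g y / V y * V (s i.+1) - g (s i.+1) =
        g y / V y * (V (s i.+1) - V y) - (g (s i.+1) - g y).
      by rewrite mulrBr divfK ?gt_eqF//; ring.
    rewrite (le_trans (ler_normB _ _))//.
    have gpi : `|g (s i.+1) - g y| <= p (s i.+1) - p (s i).
      rewrite (le_trans (gp Iy Isi1 yi))// lerD2l lerN2.
      exact: (dominated_nondecreasing gp).
    have VV : 0 <= V (s i.+1) - V y <= V (s i.+1) - V (s i).
      by rewrite subr_ge0 Vnd//= lerD2l lerN2 Vnd.
    have ky : `|g y / V y| <= `|k (s i.+1)| + (q (s i.+1) - q (s i)).
      have -> : g y / V y = k (s i.+1) - (k (s i.+1) - k y) by ring.
      by rewrite (le_trans (ler_normB _ _))// lerD2l.
    have : `|g y / V y * (V (s i.+1) - V y)| <=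
        (`|k (s i.+1)| + (q (s i.+1) - q (s i))) * (V (s i.+1) - V (s i)).
      move: VV => /andP[VV1 VV2].
      by rewrite normrM (ger0_norm VV1); apply: ler_pM.
    have : (q (s i.+1) - q (s i)) * (V (s i.+1) - V (s i)) <= (q (s i.+1) - q (s i)) * e'.
      by rewrite ler_wpM2l ?dVe// (le_trans _ dkq).
    by rewrite /E; lra.
  have -> : g y / V y = (k y - k (s i.+1)) + k (s i.+1) by ring.
  rewrite (le_trans (ler_normD _ _))// lerD//.
  by apply: tail_sup_ge.
have H0 : 0 <= H (s 0%N) * V (s 0%N).
  by rewrite mulr_ge0 ?tail_sup_ge0 ?(ltW (V0 _))//; exact: Is.
have := @abel_majorant R (H \o s) (V \o s) E n.+1 H0 HE.
have -> : \sum_(0 <= i < n.+1) E i = (p b - p a) +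
    \sum_(0 <= i < n.+1) `|k (s i.+1)| * (V (s i.+1) - V (s i)) + e' * Q.
  rewrite /E 2!big_split/= -mulr_sumr; congr (_ + _ + _ * _).
    by rewrite (@telescope_sumr _ 0 n.+1 (p \o s))//= /s upart0 upartn.
  by rewrite (@telescope_sumr _ 0 n.+1 (q \o s))//= /s upart0 upartn.
move=> Ab.
have Hint : \int[mu]_(t in `[a, b[) (v t * H t) <=
    \sum_(0 <= i < n.+1) H (s i) * (V (s i.+1) - V (s i)).
  have intH := tail_sup_integrable Ia Ib ab.
  have := @Rintegral_partition _ (fun t => v t * H t) s n.+1 nds.
  rewrite {1 2 3 4}/s upart0 upartn -/s => /(_ intH) ->.
  rewrite big_nat [leRHS]big_nat; apply: ler_sum => i /andP[_ ni].
  have Isi := Is _ (ltnW ni); have Isi1 := Is _ ni.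
  rewrite dV// -RintegralZl; last 2 first.
  - exact: measurable_itvL.
  - exact: loc_int_itv lv Isi Isi1.
  apply: le_Rintegral.
  - exact: measurable_itvL.
  - exact: (tail_sup_integrable Isi Isi1 (nds _ _ (leqnSn i))).
  - by apply: integrable_realZ; [exact: measurable_itvL|exact: loc_int_itv lv Isi Isi1].
  - move=> x /=; rewrite in_itv/= => /andP[six xsi].
    have Ix : I x by apply: (I_in Isi Isi1); rewrite six ltW.
    by rewrite mulrC ler_wpM2r// tail_sup_nonincreasing.
have HM : H (s n.+1) * V (s n.+1) <= M.
  by rewrite -ler_pdivlMr ?V0//; [apply: tail_sup_bounded|]; exact: Is.
move: Ab Rv; rewrite /= -/s -/q -/Q.
set S1 := \sum_(0 <= i < n.+1) _ in Hint *; set S2 := \sum_(0 <= i < n.+1) _.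
set J := \int[mu]_(t in _) (v t * `| _ |); lra.
Qed.

End bv.

(** If |g| >= e everywhere then, from b to a point where V has doubled, the
    integral of v |g| / V increases by at least e / 2. As V is unbounded
    this can be repeated for ever. *)
Lemma weighted_integral_inf (g p : R -> R) M B : (exists x, I x) ->
  dominated I g p -> (forall x, I x -> `|g x| <= M) ->
  (forall r, exists2 b, I b & r <= V b) ->
  (forall a b, I a -> I b -> a <= b ->
    \int[mu]_(t in `[a, b[) (v t * `|g t / V t|) <= B) ->
  forall e, 0 < e -> exists2 x, I x & `|g x| < e.
Proof.
move=> [a Ia] gp gM Vy gB e e0; apply: contrapT => nge.
have ge x : I x -> e <= `|g x|.
  by move=> Ix; rewrite leNgt; apply/negP => gx; apply: nge; exists x.
have step n : exists2 b, I b /\ a <= b & n%:R * (e / 2) <=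
    \int[mu]_(t in `[a, b[) (v t * `|g t / V t|).
  elim: n => [|n [b [Ib ab] bn]].
    by exists a => //; rewrite mul0r Rintegral_ge0// => t _; rewrite mulr_ge0.
  have [b' Ib' Vb'] := Vy (2 * V b).
  have Vb := V0 Ib; have Vb'0 := V0 Ib'.
  have bb' : b <= b'.
    rewrite leNgt; apply/negP => /ltW b'b.
    by have := Vnd Ib' Ib b'b; lra.
  exists b'; first by split => //; exact: le_trans bb'.
  have intg x y := quotient_abs_integrable v0 lv V0 gp gM lv (a := x) (b := y).
  rewrite (Rintegral_itv_split ab bb'); last first.
    by apply: intg => //; exact: le_trans bb'.
  have -> : n.+1%:R * (e / 2) = n%:R * (e / 2) + e / 2 by rewrite -natr1; ring.
  rewrite lerD//.
  apply: (@le_trans _ _ (\int[mu]_(t in `[b, b'[) (e / V b' * v t))).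
    rewrite RintegralZl; last 2 first.
    - exact: measurable_itvL.
    - exact: loc_int_itv lv Ib Ib'.
    rewrite -(primB lv)// mulrAC -mulrA ler_wpM2l ?(ltW e0)//.
    by rewrite ler_pdivlMr//; lra.
  apply: le_Rintegral.
  - exact: measurable_itvL.
  - by apply: integrable_realZ; [exact: measurable_itvL|exact: loc_int_itv lv Ib Ib'].
  - exact: intg.
  - move=> x /=; rewrite in_itv/= => /andP[bx xb].
    have Ix : I x by apply: (I_in Ib Ib'); rewrite bx ltW.
    rewrite mulrC ler_wpM2l// normrM normfV (gtr0_norm (V0 Ix)).
    apply: ler_pM; rewrite ?invr_ge0 ?(ltW e0) ?(ltW Vb'0)//; first exact: ge.
    by rewrite lef_pV2 ?posrE ?V0// Vnd// ltW.
have B0 : 0 <= B.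
  by have := gB a a Ia Ia (lexx a); rewrite set_itvco0 Rintegral_set0.
have e20 : 0 < e / 2 by rewrite divr_gt0.
have [b [Ib ab]] := step (Num.bound (B / (e / 2))).
have := archi_boundP (divr_ge0 B0 (ltW e20)); rewrite ltr_pdivrMr// => h1 h2.
by have := gB a b Ia Ib ab; lra.
Qed.

(** A point where g is almost 0 and the bound S of the oscillation of g. *)
Lemma weighted_integral_sup (g p : R -> R) M B S : (exists x, I x) ->
  dominated I g p -> (forall x, I x -> 0 <= p x <= S) ->
  (forall x, I x -> `|g x| <= M) ->
  (forall r, exists2 b, I b & r <= V b) ->
  (forall a b, I a -> I b -> a <= b ->
    \int[mu]_(t in `[a, b[) (v t * `|g t / V t|) <= B) ->
  forall x, I x -> `|g x| <= S.
Proof.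
move=> I0 gp pS gM Vy gB x Ix; apply/ler_addgt0Pr => e e0.
have [y Iy gy] := weighted_integral_inf I0 gp gM Vy gB e0.
have /andP[px1 px2] := pS _ Ix; have /andP[py1 py2] := pS _ Iy.
have : `|g x - g y| <= S.
  have [xy|/ltW yx] := leP x y; last by rewrite (le_trans (gp _ _ Iy Ix yx))//; lra.
  by rewrite distrC (le_trans (gp _ _ Ix Iy xy))//; lra.
move=> gxy; rewrite -(subrK (g y) (g x)) (le_trans (ler_normD _ _))// lerD//.
exact: ltW.
Qed.

End majorant.

(** * Test functions *)

Section test_functions.
Context {R : realType}.
Local Notation T := (lebesgueR R).
Local Notation mu := (leb R).
Variables (c d : \bar R).
Local Notation I := (oitv c d : set R).
Variable v : T -> R.
Hypotheses (v0 : forall t, 0 <= v t) (lv : loc_int c d v).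
Hypothesis mv : measurable_fun [set: T] v.
Local Notation V := (prim c v).
Hypothesis V0 : forall x, I x -> 0 < V x.

Let I_in a b x : I a -> I b -> a <= x <= b -> I x.
Proof. by move=> Ia Ib; exact: (oitv_interval Ia Ib). Qed.

Let Vnd x y : I x -> I y -> x <= y -> V x <= V y.
Proof. exact: prim_nondecreasing. Qed.

(** Membership of f in the space Cs with the weight 1 / V, for functions
    with real values. *)
Definition cesaro_bounded (f : T -> R) := [/\ measurable_fun [set: T] f,
  loc_int c d f & exists N, forall x, I x -> prim c (fun t => `|f t|) x <= N * V x].

Lemma loc_int_lin r f h : loc_int c d f -> loc_int c d h ->
  loc_int c d (fun t => r * f t + h t).
Proof.
move=> lf lh x Ix; apply: integrable_realD; first exact: measurable_oitvL.
  by apply: integrable_realZ; [exact: measurable_oitvL|exact: lf].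
exact: lh.
Qed.

Lemma prim_lin r f h x : loc_int c d f -> loc_int c d h -> I x ->
  prim c (fun t => r * f t + h t) x = r * prim c f x + prim c h x.
Proof.
move=> lf lh Ix; rewrite /prim RintegralD.
- by rewrite RintegralZl//; [exact: measurable_oitvL|exact: lf].
- exact: measurable_oitvL.
- by apply: integrable_realZ; [exact: measurable_oitvL|exact: lf].
- exact: lh.
Qed.

Lemma loc_int_abs f : loc_int c d f -> loc_int c d (fun t => `|f t|).
Proof. by move=> lf x Ix; exact: integrable_norm (lf _ Ix). Qed.

Lemma cesaro_bounded_lin r f h : cesaro_bounded f -> cesaro_bounded h ->
  cesaro_bounded (fun t => r * f t + h t).
Proof.
move=> [mf lf [N fN]] [mh lh [N' hN']]; split.
- by apply: measurable_funD => //; exact: measurable_funM.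
- exact: loc_int_lin.
exists (`|r| * N + N') => x Ix; rewrite mulrDl -mulrA.
apply: (@le_trans _ _ (`|r| * prim c (fun t => `|f t|) x + prim c (fun t => `|h t|) x)).
  rewrite -prim_lin//; [|exact: loc_int_abs|exact: loc_int_abs].
  apply: le_Rintegral.
  - exact: measurable_oitvL.
  - exact: (loc_int_abs (loc_int_lin r lf lh)).
  - exact: (loc_int_lin `|r| (loc_int_abs lf) (loc_int_abs lh)).
  - by move=> t _; rewrite -normrM ler_normD.
by rewrite lerD ?hN'// ler_wpM2l ?fN.
Qed.

Lemma cesaro_bounded_le (f : T -> R) N : measurable_fun [set: T] f ->
  (forall t, I t -> `|f t| <= N * v t) -> cesaro_bounded f.
Proof.
move=> mf fN.
have lf : loc_int c d f.
  move=> x Ix; have mx := measurable_oitvL c x%:E.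
  apply: (le_integrable mx _ _ (integrable_realZ mx N (lv Ix))).
    by apply/measurable_EFinP; exact: measurable_funS mf.
  move=> t /(oitv_sub Ix) It /=.
  by rewrite lee_fin (le_trans (fN _ It))// ler_norm.
split => //; exists N => x Ix; have mx := measurable_oitvL c x%:E.
rewrite /prim -RintegralZl//; last exact: lv.
apply: le_Rintegral => //.
- exact: loc_int_abs.
- by apply: integrable_realZ => //; exact: lv.
- by move=> t /(oitv_sub Ix); exact: fN.
Qed.

Definition clamp (r : R) : R := Num.max 0 (Num.min 1 r).

Lemma clamp_nondecreasing : nondecreasing_fun clamp.
Proof.
move=> r s rs; rewrite /clamp.
by rewrite ge_max le_max lexx/= le_max; apply/orP; right; rewrite le_min !ge_min lexx rs orbT.
Qed.

(** A nondecreasing function of x equal to 0 up to y and to 1 from y + dl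
    on, affine between. *)
Definition ramp (dl y x : R) : R := clamp ((x - y) / dl).

Section ramp.
Variables (dl : R) (dl0 : 0 < dl).

Lemma ramp_itv y x : 0 <= ramp dl y x <= 1.
Proof. by rewrite /ramp le_max lexx/= ge_max ler01/= ge_min lexx. Qed.

Lemma ramp_nonincreasing x y z : y <= z -> ramp dl z x <= ramp dl y x.
Proof.
move=> yz; apply: clamp_nondecreasing.
by rewrite ler_wpM2r ?invr_ge0 ?(ltW dl0)// lerD2l lerN2.
Qed.

Lemma ramp_nondecreasing y : nondecreasing_fun (ramp dl y).
Proof.
move=> x z xz; apply: clamp_nondecreasing.
by rewrite ler_wpM2r ?invr_ge0 ?(ltW dl0)// lerD2r.
Qed.

Lemma ramp_left y x : x <= y -> ramp dl y x = 0.
Proof.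
move=> xy; rewrite /ramp /clamp.
have : (x - y) / dl <= 0 by rewrite ler_pdivrMr// mul0r subr_le0.
by move: (_ / dl) => r r0; rewrite min_r ?max_l//; lra.
Qed.

Lemma ramp_right y x : y + dl <= x -> ramp dl y x = 1.
Proof.
move=> xy; rewrite /ramp /clamp.
have : 1 <= (x - y) / dl by rewrite ler_pdivlMr// mul1r; lra.
by move: (_ / dl) => r r0; rewrite min_l ?max_r//; lra.
Qed.

Lemma ramp_mid y x : y <= x <= y + dl -> ramp dl y x = (x - y) / dl.
Proof.
move=> /andP[yx xy]; rewrite /ramp /clamp.
have : 0 <= (x - y) / dl by rewrite divr_ge0 ?(ltW dl0)// subr_ge0.
have : (x - y) / dl <= 1 by rewrite ler_pdivrMr// mul1r; lra.
by move: (_ / dl) => r r0 r1; rewrite min_r ?max_r//; lra.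
Qed.

Lemma measurable_ramp y : measurable_fun [set: T] (ramp dl y : T -> R).
Proof. by apply: nondecreasing_measurableL => //; exact: ramp_nondecreasing. Qed.

(** The product rule for V x * (x - y). On each block of a partition the
    integral and the increment of the product differ by at most the mesh
    times the increment of V, and the sum of these errors goes to 0. *)
Lemma prim_by_parts y x : I y -> I x -> y <= x ->
  mu.-integrable (`[y, x[%classic : set T) (EFin \o (fun t => v t * (t - y))) /\
  mu.-integrable (`[y, x[%classic : set T) (EFin \o (V : T -> R)) /\
  \int[mu]_(t in `[y, x[) (v t * (t - y) + V t) = V x * (x - y).
Proof.
move=> Iy Ix yx.
have sub a b t : y <= a -> b <= x -> `[a, b[%classic t -> y <= t <= x /\ I t.
  move=> ya bx; rewrite /= in_itv/= => /andP[at_ tb].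
  have h : y <= t <= x by rewrite (le_trans ya)//= (le_trans (ltW tb)).
  by split => //; exact: (I_in Iy Ix).
have int1 : mu.-integrable (`[y, x[%classic : set T) (EFin \o (fun t => v t * (t - y))).
  apply: (@integrable_real_mul_bounded _ _ v (fun t => t - y) (x - y)).
  - exact: measurable_itvL.
  - apply: nondecreasing_measurableL; first exact: measurable_itvL.
    by move=> r s rs; rewrite lerD2r.
  - move=> t /(sub _ _ _ (lexx y) (lexx x))[/andP[yt tx] _].
    by rewrite ger0_norm ?subr_ge0// lerD2r.
  - exact: loc_int_itv lv Iy Ix.
have int2 : mu.-integrable (`[y, x[%classic : set T) (EFin \o (V : T -> R)).
  apply: (@integrable_itv_bounded _ _ _ (V x)) => //.
    apply: (@dominated_measurable _ _ V V (V y) (V x)).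
    + exact: measurable_itvL.
    + move=> r s /(sub _ _ _ (lexx y) (lexx x))[_ Ir] /(sub _ _ _ (lexx y) (lexx x))[_ Is] rs.
      by rewrite ger0_norm// subr_ge0 Vnd.
    + by move=> r /(sub _ _ _ (lexx y) (lexx x))[/andP[yr rx] Ir]; rewrite !Vnd.
  move=> t tyx; have [/andP[yt tx] It] : y <= t <= x /\ I t.
    by apply: (sub _ _ _ (lexx y) (lexx x)); rewrite /= in_itv.
  by rewrite ger0_norm ?Vnd// ltW// V0.
split => //; split => //.
have int12 : mu.-integrable (`[y, x[%classic : set T)
   (EFin \o (fun t => v t * (t - y) + V t)).
  by apply: integrable_realD => //; exact: measurable_itvL.
apply/eqP; rewrite -subr_eq0 -normr_le0.
suff key n : `|\int[mu]_(t in `[y, x[) (v t * (t - y) + V t) - V x * (x - y)| <=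
    (x - y) / n.+1%:R * (V x - V y).
  have C0 : 0 <= (x - y) * (V x - V y).
    by rewrite mulr_ge0// subr_ge0// Vnd.
  apply/ler_addgt0Pr => e e0; rewrite add0r.
  have := archi_boundP (divr_ge0 C0 (ltW e0)); set N := Num.bound _ => hN.
  apply: (le_trans (key N)); rewrite mulrAC ler_pdivrMr// [leRHS]mulrC.
  move: hN; rewrite ltr_pdivrMr// => /ltW/le_trans; apply.
  by rewrite ler_wpM2r ?(ltW e0)// ler_nat.
pose s := upart y x n.
have nds : nondecreasing_seq s := upart_nondecreasing n yx.
have sab i : (i <= n.+1)%N -> y <= s i <= x by move=> ni; exact: upart_itv.
have Is i : (i <= n.+1)%N -> I (s i) by move=> /sab; exact: (I_in Iy Ix).
have := @Rintegral_partition _ (fun t => v t * (t - y) + V t) s n.+1 nds.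
rewrite {1 2 3 4}/s upart0 upartn => /(_ int12) ->.
have -> : V x * (x - y) = \sum_(0 <= i < n.+1)
    (V (s i.+1) * (s i.+1 - y) - V (s i) * (s i - y)).
  rewrite (@telescope_sumr _ 0 n.+1 (fun i => V (s i) * (s i - y)))//.
  by rewrite /s upart0 upartn subrr mulr0 subr0.
have -> : V x - V y = \sum_(0 <= i < n.+1) (V (s i.+1) - V (s i)).
  by rewrite (@telescope_sumr _ 0 n.+1 (V \o s))//= /s upart0 upartn.
rewrite -sumrB mulr_sumr (le_trans (ler_norm_sum _ _ _))// big_nat [leRHS]big_nat.
apply: ler_sum => i /andP[_ ni].
have Isi := Is _ (ltnW ni); have Isi1 := Is _ ni.
have /andP[ysi six] := sab _ (ltnW ni); have /andP[ysi1 si1x] := sab _ ni.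
have ss := nds _ _ (leqnSn i).
have ds : s i.+1 - s i = (x - y) / n.+1%:R by rewrite /s upartS addrAC subrr add0r.
have mi : measurable (`[s i, s i.+1[%classic : set T) by exact: measurable_itvL.
have intv : mu.-integrable (`[s i, s i.+1[%classic : set T) (EFin \o v).
  exact: loc_int_itv lv Isi Isi1.
have int12i := integrable_sub_itv ysi si1x int12.
have intc r : mu.-integrable (`[s i, s i.+1[%classic : set T) (EFin \o cst r).
  by apply: (@integrable_itv_bounded _ _ _ `|r|) => //; exact: measurable_cst.
have intvr r r' : mu.-integrable (`[s i, s i.+1[%classic : set T)
    (EFin \o (fun t => r * v t + r')).
  by apply: integrable_realD => //; [exact: integrable_realZ|exact: intc].
have valr r r' : \int[mu]_(t in `[s i, s i.+1[) (r * v t + r') =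
    r * (V (s i.+1) - V (s i)) + r' * (s i.+1 - s i).
  rewrite RintegralD//; [|exact: integrable_realZ|exact: intc].
  rewrite RintegralZl// -(primB lv)// Rintegral_cst//.
  by have /(congr1 fine) /= -> := leb_itvco ss.
have lo : (s i - y) * (V (s i.+1) - V (s i)) + V (s i) * (s i.+1 - s i) <=
    \int[mu]_(t in `[s i, s i.+1[) (v t * (t - y) + V t).
  rewrite -valr; apply: le_Rintegral => // t st.
  have [_ It] := sub _ _ _ ysi si1x st.
  move: st; rewrite /= in_itv/= => /andP[st ts].
  by rewrite lerD ?Vnd// mulrC ler_wpM2l// lerD2r.
have hi : \int[mu]_(t in `[s i, s i.+1[) (v t * (t - y) + V t) <=
    (s i.+1 - y) * (V (s i.+1) - V (s i)) + V (s i.+1) * (s i.+1 - s i).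
  rewrite -valr; apply: le_Rintegral => // t st.
  have [_ It] := sub _ _ _ ysi si1x st.
  move: st; rewrite /= in_itv/= => /andP[st ts].
  by rewrite lerD ?Vnd ?(ltW ts)// mulrC ler_wpM2r// lerD2r ltW.
rewrite -ds; apply/ler_normlP; split.
  rewrite opprB lerBlDr; apply: le_trans (lerD (lexx _) lo).
  by rewrite le_eqVlt; apply/orP; left; apply/eqP; ring.
rewrite lerBlDr (le_trans hi)//.
by rewrite le_eqVlt; apply/orP; left; apply/eqP; ring.
Qed.

End ramp.
End test_functions.

(** * Variation of the averages of a bounded functional *)

Section averages.
Context {R : realType}.
Local Notation T := (lebesgueR R).
Local Notation mu := (leb R).
Variables (c d : \bar R).
Local Notation I := (oitv c d : set R).
Variable v : T -> R.
Hypotheses (v0 : forall t, 0 <= v t) (lv : loc_int c d v).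
Hypothesis mv : measurable_fun [set: T] v.
Local Notation V := (prim c v).
Hypothesis V0 : forall x, I x -> 0 < V x.

Let I_in a b x : I a -> I b -> a <= x <= b -> I x.
Proof. by move=> Ia Ib; exact: (oitv_interval Ia Ib). Qed.

Variables (dl : R) (dl0 : 0 < dl).

Definition ramp_weight (y : R) (t : T) : R := v t * ramp dl y t.

Definition bump (y : R) : T -> R :=
  (fun t : T => dl^-1 * V t) \_ (`[y, y + dl[%classic : set T).

(** The derivative of V times the ramp at y. *)
Definition ramp_test (y : R) (t : T) : R := 1 * ramp_weight y t + bump y t.

Lemma ramp_weight_bounded y : cesaro_bounded c d v (ramp_weight y).
Proof.
apply: (@cesaro_bounded_le _ _ _ _ lv _ 1).
  by apply: measurable_funM => //; exact: measurable_ramp.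
move=> t _; have /andP[r0 r1] := ramp_itv dl y t.
by rewrite mul1r /ramp_weight ger0_norm ?mulr_ge0// ler_piMr.
Qed.

Section y.
Variables (y : R) (Iy : I y) (Iyd : I (y + dl)).

Let yyd : y <= y + dl. Proof. by rewrite lerDl ltW. Qed.

Let my : measurable (`[y, y + dl[%classic : set T).
Proof. exact: measurable_itvL. Qed.

Lemma bump_integrable : mu.-integrable setT (EFin \o bump y).
Proof.
have [_ [intV _]] := prim_by_parts v0 lv V0 Iy Iyd yyd.
have := integrable_realZ my dl^-1 intV.
by move/(integrable_mkcond _ my); rewrite restrict_EFin.
Qed.

Lemma bump_measurable : measurable_fun [set: T] (bump y).
Proof. by apply/measurable_EFinP; exact: measurable_int bump_integrable. Qed.

Lemma bump_loc_int : loc_int c d (bump y).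
Proof.
move=> x Ix; apply: integrableS bump_integrable => //.
exact: measurable_oitvL.
Qed.

Lemma ramp_test_loc_int : loc_int c d (ramp_test y).
Proof. by apply: loc_int_lin; [case: (ramp_weight_bounded y)|exact: bump_loc_int]. Qed.

Lemma bump_ge0 t : 0 <= bump y t.
Proof.
rewrite /bump patchE; case: ifPn => // /set_mem /=.
rewrite in_itv/= => /andP[yt ty].
rewrite mulr_ge0 ?invr_ge0 ?(ltW dl0)//.
by rewrite ltW// V0//; apply: (I_in Iy Iyd); rewrite yt ltW.
Qed.

Lemma ramp_test_ge0 t : 0 <= ramp_test y t.
Proof.
rewrite /ramp_test mul1r addr_ge0 ?bump_ge0// mulr_ge0//.
by case/andP: (ramp_itv dl y t).
Qed.

(** The primitive is V times the ramp: trivially before y, by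
    [prim_by_parts] on [y, y + dl], and with increments those of V after y +
    dl. *)
Lemma prim_ramp_test x : I x -> prim c (ramp_test y) x = V x * ramp dl y x.
Proof.
have left_ z : I z -> z <= y -> prim c (ramp_test y) z = V z * ramp dl y z.
  move=> Iz zy; rewrite ramp_left// mulr0 /prim.
  rewrite (@eq_Rintegral _ _ _ _ _ (fun=> 0)) ?Rintegral_cst ?mul0r//.
    exact: measurable_oitvL.
  move=> t; rewrite inE /oitv/= lte_fin => /andP[_ tz].
  rewrite /ramp_test /ramp_weight ramp_left//; last by rewrite (le_trans (ltW tz)).
  rewrite /bump patchE memNset ?mulr0 ?addr0//= in_itv/=.
  by move=> /andP[yt _]; move: (lt_le_trans tz zy); rewrite ltNge yt.
have mid z : I z -> y <= z <= y + dl -> prim c (ramp_test y) z = V z * ramp dl y z.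
  move=> Iz /[dup] yzd /andP[yz zyd].
  have [int1 [int2 E]] := prim_by_parts v0 lv V0 Iy Iz yz.
  have mz : measurable (`[y, z[%classic : set T) by exact: measurable_itvL.
  rewrite -[LHS](subrK (prim c (ramp_test y) y)) (primB ramp_test_loc_int)//.
  rewrite left_// ramp_left// mulr0 addr0 (ramp_mid dl0 yzd) mulrA -E.
  rewrite mulrC -RintegralZl//; last exact: integrable_realD.
  apply: eq_Rintegral => t; rewrite inE/= in_itv/= => /andP[yt tz].
  have tyd : t < y + dl by exact: lt_le_trans zyd.
  rewrite /ramp_test /ramp_weight ramp_mid ?yt ?(ltW tyd)//.
  rewrite /bump patchE mem_set/= ?in_itv/= ?yt//; ring.
move=> Ix; have [xy|/ltW yx] := leP x y; first exact: left_.
have [xyd|/ltW ydx] := leP x (y + dl); first by apply: mid; rewrite ?yx.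
rewrite -[LHS](subrK (prim c (ramp_test y) (y + dl))) (primB ramp_test_loc_int)//.
rewrite mid ?lexx ?yyd// !ramp_right// !mulr1.
rewrite (@eq_Rintegral _ _ _ _ _ v) -?(primB lv) ?subrK//.
move=> t; rewrite inE/= in_itv/= => /andP[ydt tx].
rewrite /ramp_test /ramp_weight ramp_right// /bump patchE memNset ?mulr1 ?mul1r ?addr0//=.
by rewrite in_itv/= ltNge ydt andbF.
Qed.

Lemma ramp_test_bounded : cesaro_bounded c d v (ramp_test y).
Proof.
have [mr _ _] := ramp_weight_bounded y; split.
- apply: measurable_funD; last exact: bump_measurable.
  by apply: measurable_funM => //; exact: measurable_cst.
- exact: ramp_test_loc_int.
- exists 1 => x Ix; rewrite mul1r.
  rewrite /prim (@eq_Rintegral _ _ _ _ _ (ramp_test y)); last first.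
    by move=> t _; rewrite ger0_norm// ramp_test_ge0.
  rewrite -/(prim c (ramp_test y) x) prim_ramp_test//.
  rewrite -[leRHS]mulr1 ler_wpM2l// ?(ltW (V0 Ix))//.
  by case/andP: (ramp_itv dl y x).
Qed.

(** The bump is the difference of [ramp_test] and of [ramp_weight], which
    are both in the space. *)
Lemma bump_bounded : cesaro_bounded c d v (bump y).
Proof.
have := cesaro_bounded_lin (-1) (ramp_weight_bounded y) ramp_test_bounded.
by congr cesaro_bounded; apply/funext => t; rewrite /ramp_test; ring.
Qed.

End y.

Variables (g : T -> R) (A : R).
Hypothesis mg : measurable_fun [set: T] g.
Hypothesis intg : forall f, cesaro_bounded c d v f ->
  mu.-integrable I (EFin \o (fun t => f t * g t)).
Hypothesis leg : forall f (n : R), cesaro_bounded c d v f -> 0 <= n ->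
  (forall x, I x -> `|prim c f x| <= n * V x) ->
  `|\int[mu]_(t in I) (f t * g t)| <= A * n.

Let mI : measurable (I : set T). Proof. exact: measurable_oitvL. Qed.

Lemma dual_lin r f h : cesaro_bounded c d v f -> cesaro_bounded c d v h ->
  \int[mu]_(t in I) ((r * f t + h t) * g t) =
  r * \int[mu]_(t in I) (f t * g t) + \int[mu]_(t in I) (h t * g t).
Proof.
move=> bf bh; rewrite -RintegralZl//; last exact: intg.
rewrite -RintegralD//; [|exact/integrable_realZ/intg|exact: intg].
by apply: eq_Rintegral => t _; ring.
Qed.

Lemma weight_bounded : cesaro_bounded c d v v.
Proof.
apply: (@cesaro_bounded_le _ _ _ _ lv _ 1) => // t _.
by rewrite mul1r ger0_norm.
Qed.

(** Test with v times the sign of g. *)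
Lemma weighted_dual_le :
  mu.-integrable I (EFin \o (fun t => v t * `|g t|)) /\
  \int[mu]_(t in I) (v t * `|g t|) <= A.
Proof.
pose f (t : T) := v t * Num.sg (g t).
have msg : measurable_fun [set: T] (fun t => Num.sg (g t)).
  apply: (@measurable_comp _ _ _ _ _ _ setT (Num.sg : R -> R)) => //.
  apply: nondecreasing_measurable => // r s rs.
  by case: (sgrP r) => hr; case: (sgrP s) => hs; lra.
have vf t : `|f t| <= v t.
  rewrite normrM ger0_norm// ler_piMr// normr_sg.
  by case: (_ != _).
have bf : cesaro_bounded c d v f.
  apply: (@cesaro_bounded_le _ _ _ _ lv _ 1) => //.
    exact: measurable_funM.
  by move=> t _; rewrite mul1r.
have fg t : f t * g t = v t * `|g t| by rewrite /f -mulrA -normrEsg.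
split.
  by apply: eq_integrable (intg bf) => // t _ /=; rewrite fg.
have H x : I x -> `|prim c f x| <= 1 * V x.
  move=> Ix; have [_ lf _] := bf.
  rewrite mul1r (le_trans (le_normr_Rintegral _ (lf _ Ix)))//.
    exact: measurable_oitvL.
  apply: le_Rintegral => //; [exact: measurable_oitvL|exact: (loc_int_abs lf)|exact: lv].
have := @leg f 1 bf ler01 H; rewrite mulr1; apply: le_trans.
rewrite (@eq_Rintegral _ _ _ _ _ (fun t => f t * g t)) ?ler_norm//.
Qed.

(** Where the averages over [y, y + dl) only depend on values on I. *)
Definition shrunk : set R := [set y | I y /\ I (y + dl)].

Lemma shrunk_interval : is_interval shrunk.
Proof.
move=> x y [Ix Ixd] [Iy Iyd] z /[dup] xzy /andP[xz zy]; split.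
  exact: (I_in Ix Iy).
by apply: (I_in Ixd Iyd); rewrite !lerD2r xz.
Qed.

(** Combinations of differences of test functions at successive points.
    Their primitives and their pairings with g are sums of differences, to
    which signs are then given. *)
Lemma test_comb (e x : nat -> R) n : nondecreasing_seq x ->
  (forall i, (i <= n)%N -> shrunk (x i)) ->
  exists f, [/\ cesaro_bounded c d v f,
    (forall z, I z -> prim c f z =
      V z * \sum_(0 <= i < n) e i * (ramp dl (x i.+1) z - ramp dl (x i) z)) &
    \int[mu]_(t in I) (f t * g t) = \sum_(0 <= i < n)
      e i * (\int[mu]_(t in I) (ramp_test (x i.+1) t * g t) -
             \int[mu]_(t in I) (ramp_test (x i) t * g t))].
Proof.
move=> ndx; elim: n => [_|n ih xn].
  have b0 : cesaro_bounded c d v (fun=> 0).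
    apply: (@cesaro_bounded_le _ _ _ _ lv _ 1); first exact: measurable_cst.
    by move=> t _; rewrite normr0 mul1r.
  exists (fun=> 0); split => //.
    move=> z Iz; rewrite big_nil mulr0 /prim Rintegral_cst ?mul0r//.
    exact: measurable_oitvL.
  rewrite big_nil (@eq_Rintegral _ _ _ _ _ (fun=> 0)) ?Rintegral_cst ?mul0r//.
  by move=> t _; rewrite mul0r.
have [f [bf pf gf]] := ih (fun i ni => xn i (leqW ni)).
have [Ixn Ixnd] := xn n (leqnSn n); have [Ixn1 Ixn1d] := xn n.+1 (leqnn n.+1).
have b1 := ramp_test_bounded Ixn Ixnd; have b2 := ramp_test_bounded Ixn1 Ixn1d.
have b12 := cesaro_bounded_lin (-1) b1 b2.
exists (fun t => e n * (-1 * ramp_test (x n) t + ramp_test (x n.+1) t) + f t).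
have [_ l1 _] := b1; have [_ l2 _] := b2; have [_ l12 _] := b12; have [_ lf _] := bf.
split.
- exact: (cesaro_bounded_lin _ b12 bf).
- move=> z Iz; rewrite big_nat_recr//= (prim_lin _ l12 lf Iz) (prim_lin _ l1 l2 Iz).
  rewrite pf// !prim_ramp_test//; ring.
- rewrite big_nat_recr//= (dual_lin _ b12 bf) (dual_lin _ b1 b2) gf; ring.
Qed.

(** Partitions given as infinite nondecreasing sequences, constant from the
    last point on, so that sums over them telescope. *)
Lemma partition_nth (a b : R) (s : seq R) : itv_partition a b s ->
  exists x : nat -> R, [/\ nondecreasing_seq x, forall i, a <= x i <= b &
   forall f, variation a b f s = \sum_(0 <= i < size s) `|f (x i.+1) - f (x i)|].
Proof.
move=> [pas /eqP lb].
have st : sorted <=%R (a :: s) by apply: sub_path pas => ? ? /ltW.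
have xs : nth b (a :: s) (size s) = b by rewrite -last_nth.
have key i j : (i <= j)%N -> nth b (a :: s) i <= nth b (a :: s) j.
  have key' k l : (k <= l)%N -> (l < (size s).+1)%N ->
      nth b (a :: s) k <= nth b (a :: s) l.
    move=> kl ls; apply: (sorted_leq_nth le_trans le_refl _ st) => //.
    by rewrite inE (leq_ltn_trans kl).
  move=> ij; have [js|js] := ltnP j (size s).+1; first exact: key'.
  rewrite [leRHS]nth_default//.
  have [is_|is_] := ltnP i (size s).+1; last by rewrite nth_default.
  by rewrite -[leRHS]xs; exact: key'.
exists (nth b (a :: s)); split => // i.
rewrite -{1}[a]/(nth b (a :: s) 0) key//=.
have [is_|is_] := ltnP i (size s).+1; last by rewrite nth_default.
by rewrite -[leRHS]xs; exact: key.
Qed.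

(** With e_i the signs of the differences, the variation is the value of the
    functional at one test function. The primitive of the latter is at most
    V in absolute value: the ramps decrease with y and stay in [0, 1], so
    that the sum of the absolute values of their differences telescopes. *)
Lemma ramp_test_bvar :
  bvar shrunk (fun y => \int[mu]_(t in I) (ramp_test y t * g t)) A.
Proof.
move=> a b s sa sb /partition_nth[x [ndx xab ->]].
have sx i : shrunk (x i) by exact: (shrunk_interval sa sb (xab i)).
pose L y := \int[mu]_(t in I) (ramp_test y t * g t).
pose e i := Num.sg (L (x i.+1) - L (x i)).
have [f [bf pf gf]] := @test_comb e x (size s) ndx (fun i _ => sx i).
have H z : I z -> `|prim c f z| <= 1 * V z.
  move=> Iz; rewrite pf// mul1r normrM (gtr0_norm (V0 Iz)).
  rewrite -[leRHS]mulr1 ler_wpM2l ?(ltW (V0 Iz))//.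
  rewrite (le_trans (ler_norm_sum _ _ _))//.
  apply: (@le_trans _ _ (\sum_(0 <= i < size s) (- ramp dl (x i.+1) z - - ramp dl (x i) z))).
    apply: ler_sum => i _; rewrite normrM.
    have D : 0 <= ramp dl (x i) z - ramp dl (x i.+1) z.
      by rewrite subr_ge0; apply: ramp_nonincreasing => //; exact: ndx.
    rewrite distrC (ger0_norm D) opprK [leRHS]addrC ler_piMl//.
    by rewrite normr_sg; case: (_ != _).
  rewrite (@telescope_sumr _ 0 (size s) (fun i => - ramp dl (x i) z))//.
  have := ramp_itv dl (x 0%N) z; have := ramp_itv dl (x (size s)) z.
  by move=> /andP[? ?] /andP[? ?]; lra.
have := @leg f 1 bf ler01 H; rewrite gf mulr1; apply: le_trans.
apply: le_trans (ler_norm _); apply: ler_sum => i _.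
by rewrite -/(L (x i.+1)) -/(L (x i)) /e -normrEsg.
Qed.

(** The function is dominated by A minus the integral of v |g| times the
    ramp, which is nondecreasing in y with values in [0, A]. *)
Lemma ramp_weight_bvar :
  bvar shrunk (fun y => \int[mu]_(t in I) (ramp_weight y t * g t)) A.
Proof.
have [intvg vgA] := weighted_dual_le.
have intr y : mu.-integrable I (EFin \o (fun t => v t * `|g t| * ramp dl y t)).
  apply: (@integrable_real_mul_bounded _ _ (fun t => v t * `|g t|) (ramp dl y) 1) => //.
    by apply: measurable_funS (measurable_ramp dl0 y).
  by move=> x _; have /andP[r0 r1] := ramp_itv dl y x; rewrite ger0_norm.
pose q y := A - \int[mu]_(t in I) (v t * `|g t| * ramp dl y t).
apply: (dominated_bvar shrunk_interval (p := q)).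
  move=> x y [Ix _] [Iy _] xy.
  have -> : q y - q x = \int[mu]_(t in I) (v t * `|g t| * (ramp dl x t - ramp dl y t)).
    rewrite (_ : q y - q x = \int[mu]_(t in I) (v t * `|g t| * ramp dl x t) -
      \int[mu]_(t in I) (v t * `|g t| * ramp dl y t)).
      by rewrite -RintegralB//; apply: eq_Rintegral => t _; rewrite mulrBr.
    by rewrite /q opprB addrC subrKA.
  rewrite -RintegralB//; [|exact/intg/ramp_weight_bounded|exact/intg/ramp_weight_bounded].
  have intB : mu.-integrable I (EFin \o (fun t => ramp_weight y t * g t - ramp_weight x t * g t)).
    by apply: integrable_realB => //; exact/intg/ramp_weight_bounded.
  rewrite (le_trans (le_normr_Rintegral _ intB))//.
  apply: le_Rintegral => //; first exact: integrable_norm intB.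
    rewrite (_ : EFin \o _ = EFin \o
      (fun t => v t * `|g t| * ramp dl x t - v t * `|g t| * ramp dl y t)).
      by apply: integrable_realB.
    by apply/funext => t /=; rewrite mulrBr.
  move=> t _; rewrite /ramp_weight -mulrBl -mulrBr !normrM (ger0_norm (v0 t)).
  rewrite distrC (@ger0_norm _ (_ - _)) ?subr_ge0 ?ramp_nonincreasing//.
  by rewrite mulrAC.
move=> y _; rewrite /q.
have h1 : 0 <= \int[mu]_(t in I) (v t * `|g t| * ramp dl y t).
  apply: Rintegral_ge0 => t _; rewrite !mulr_ge0//.
  by case/andP: (ramp_itv dl y t).
have h2 : \int[mu]_(t in I) (v t * `|g t| * ramp dl y t) <= \int[mu]_(t in I) (v t * `|g t|).
  apply: le_Rintegral => // t _.
  by rewrite ler_piMr ?mulr_ge0//; case/andP: (ramp_itv dl y t).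
by rewrite subr_ge0 (le_trans h2 vgA)/= lerBlDr lerDl.
Qed.

Section at_point.
Variables (y : R) (sy : shrunk y).
Local Notation J := (`[y, y + dl[%classic : set T).

Let mJ : measurable J. Proof. exact: measurable_itvL. Qed.

Let JI : (J `<=` I)%classic.
Proof.
case: sy => Iy Iyd t /=; rewrite in_itv/= => /andP[yt ty].
by apply: (I_in Iy Iyd); rewrite yt ltW.
Qed.

Let bumpE t : J t -> bump y t * g t = dl^-1 * (V t * g t).
Proof. by move=> yt; rewrite /bump patchE mem_set// mulrA. Qed.

Lemma dual_locally_integrable : mu.-integrable J (EFin \o (fun t => V t * g t)).
Proof.
have bb := bump_bounded sy.1 sy.2.
have : mu.-integrable J (EFin \o (fun t => dl * (bump y t * g t))).
  by apply: integrable_realZ => //; exact: integrableS mI mJ JI (intg bb).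
apply: eq_integrable => // t /set_mem yt /=.
by rewrite bumpE// mulVKf// gt_eqF.
Qed.

Lemma average_ramp : dl^-1 * \int[mu]_(t in J) (V t * g t) =
  \int[mu]_(t in I) (ramp_test y t * g t) - \int[mu]_(t in I) (ramp_weight y t * g t).
Proof.
have bb := bump_bounded sy.1 sy.2.
have := dual_lin 1 (ramp_weight_bounded y) bb; rewrite mul1r => ->.
rewrite addrAC subrr add0r -RintegralZl//; last exact: dual_locally_integrable.
rewrite -[in LHS](setIidr JI) Rintegral_mkcondr.
apply: eq_Rintegral => t _; rewrite patchE.
case: ifPn => [/set_mem/bumpE ->//|nt].
by rewrite /bump patchE (negbTE nt) mul0r.
Qed.

End at_point.

(** The average is the difference of the two functions of [ramp_test_bvar]
    and [ramp_weight_bvar]; each has variation at most A. *)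
Lemma average_bvar : bvar shrunk
  (fun y => dl^-1 * \int[mu]_(t in `[y, y + dl[) (V t * g t)) (2 * A).
Proof.
move=> a b s sa sb abs.
have vB : variation a b (fun y => dl^-1 * \int[mu]_(t in `[y, y + dl[) (V t * g t)) s =
    variation a b ((fun y => \int[mu]_(t in I) (ramp_test y t * g t)) \+
      (\- (fun y => \int[mu]_(t in I) (ramp_weight y t * g t)))) s.
  have [x [ndx xab xE]] := partition_nth abs; rewrite !xE.
  have sx i : shrunk (x i) by exact: (shrunk_interval sa sb (xab i)).
  by apply: eq_bigr => i _; rewrite !average_ramp.
rewrite vB (le_trans (variation_le _ _ _ _ _))// variationN mulr_natl mulr2n.
by rewrite lerD// ?(ramp_test_bvar sa sb abs)// (ramp_weight_bvar sa sb abs).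
Qed.

End averages.

(** * Lebesgue points of completed Lebesgue measure *)

Section borel_version.
Context {R : realType}.
Local Notation T := (lebesgueR R).
Local Notation B := (measurableTypeR R).
Local Notation mu := (leb R).

(** The Lebesgue measurable sets are the completion of the Borel sets. *)
Lemma measurable_borel_negligible (A : set T) : measurable A ->
  exists2 C : set B, measurable C &
    mu.-negligible [set x | (A x /\ ~ C x) \/ (C x /\ ~ A x)].
Proof.
rewrite -[measurable A]/((@wlength R idfun)^*%mu.-cara.-measurable A).
rewrite -completed_caratheodory_measurable g_sigma_completed_algebra_genE.
move=> [C mC [N [M [mM M0 NM]] <-]]; exists C => //.
exists M; split => //.
- exact: borel_lebesgue_measurable.
- by move=> x /= [[[//|Nx] _]|[Cx]]; [exact: NM|move=> h; exfalso; apply: h; left].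
Qed.

(** This gives access to Lebesgue's differentiation theorem for Borel
    functions. The version is built from Borel versions of the sets where f
    exceeds a rational q, as the supremum of the q whose set contains x;
    countably many negligible sets are discarded. *)
Lemma borel_version (f : T -> R) : measurable_fun [set: T] f ->
  exists2 h : R -> R, measurable_fun [set: B] h & {ae mu, forall x : T, h x = f x}.
Proof.
move=> mf.
have mA (q : rat) : measurable ([set x | ratr q < f x] : set T).
  rewrite (_ : [set x | _] = setT `&` f @^-1` `]ratr q, +oo[%classic).
    by apply: mf => //; exact: measurable_itv.
  by rewrite setTI; apply/seteqP; split => x /=; rewrite in_itv/= andbT.
have /all_sig2[C mC CN] q := cid2 (measurable_borel_negligible (mA q)).
pose h0 (x : R) : \bar R := ereal_sup [set (ratr q)%:E | q in [set q : rat | C q x]].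
have mh0 : measurable_fun [set: B] h0.
  apply: (measurability _ (ErealGenOInfty.measurableE R)) => //.
  move=> /= _ [_ [r ->] <-]; rewrite setTI.
  rewrite [X in measurable X](_ : _ =
      \bigcup_(q : rat) (if r < ratr q then C q else set0)).
    by apply: bigcupT_measurable_rat => q; case: ifPn.
  apply/seteqP; split => x /=.
    rewrite in_itv/= andbT => /ereal_sup_gt[_ /= [q Cq <-]].
    by rewrite lte_fin => rq; exists q => //; rewrite rq.
  move=> [q _]; case: ifPn => // rq Cq; rewrite in_itv/= andbT.
  rewrite (@lt_le_trans _ _ (ratr q)%:E) ?lte_fin//.
  by apply: ereal_sup_ubound; exists q.
exists (fine \o h0).
  by apply: (measurableT_comp _ mh0); exact: fine_measurable.
pose qn n : rat := odflt 0 (unpickle n).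
have : \forall x \ae mu, forall n, C (qn n) (x : T) <-> ratr (qn n) < f x.
  apply/ae_foralln => n.
  apply: negligibleS (CN (qn n)) => x /= nCf.
  have [fx|fx] := pselect (ratr (qn n) < f x);
    have [Cq|Cq] := pselect (C (qn n) x); [|by left|by right|].
    by exfalso; apply: nCf.
  by exfalso; apply: nCf; split.
apply: filterS => x Cx.
have {}Cx q : C q x <-> ratr q < f x.
  by have := Cx (pickle q); rewrite /qn pickleK.
suff E : h0 x = (f x)%:E by rewrite /= E.
apply/eqP; rewrite eq_le; apply/andP; split.
  by apply: ge_ereal_sup => _ [q /Cx qf <-]; rewrite lee_fin ltW.
apply/lee_addgt0Pr => e e0.
have /rat_in_itvoo[q] : f x - e < f x by rewrite gtrBl.
rewrite in_itv/= => /andP[fq qf].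
rewrite -leeBlDr//; apply: (@le_trans _ _ (ratr q)%:E).
  by rewrite -EFinB lee_fin ltW.
by apply: ereal_sup_ubound; exists q => //=; exact/Cx.
Qed.

Let mid : measurable_fun [set: T] (idfun : T -> B).
Proof. by move=> _ A mA; rewrite setTI; exact: borel_lebesgue_measurable. Qed.

Lemma ge0_integral_lebesgue_completed (h : R -> \bar R) (D : set R) :
  measurable (D : set B) -> measurable_fun (D : set B) h ->
  (forall x, D x -> 0 <= h x)%E ->
  (\int[lebesgue_measure]_(x in D) h x = \int[mu]_(x in (D : set T)) h x)%E.
Proof.
move=> mD mh h0.
rewrite -[RHS](ge0_integral_pushforward mid mu mD mh).
  exact: eq_measure_integral.
by move=> x /set_mem; exact: h0.
Qed.

Lemma integral_lebesgue_completed (h : R -> \bar R) (D : set R) :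
  measurable (D : set B) -> measurable_fun (D : set B) h ->
  (\int[lebesgue_measure]_(x in D) h x = \int[mu]_(x in (D : set T)) h x)%E.
Proof.
move=> mD mh; rewrite integralE [RHS]integralE; congr (_ - _)%E.
  by apply: ge0_integral_lebesgue_completed => //; exact: measurable_funepos.
by apply: ge0_integral_lebesgue_completed => //; exact: measurable_funeneg.
Qed.

(** Lebesgue's differentiation theorem for the right blocks, which shrink
    nicely to their left end. *)
Lemma averages_cvg_ae (a b : R) (u : T -> R) : a <= b ->
  mu.-integrable (`[a, b[%classic : set T) (EFin \o u) ->
  {ae mu, forall x : T, a <= x < b ->
    n.+1%:R * \int[mu]_(t in `[x, x + n.+1%:R^-1[) u t @[n --> \oo] --> u x}.
Proof.
move=> ab intu; have mab : measurable (`[a, b[%classic : set T) by exact: measurable_itvL.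
pose u1 : T -> R := u \_ `[a, b[%classic.
have intu1 : mu.-integrable setT (EFin \o u1).
  by rewrite /u1 -restrict_EFin; apply/(integrable_mkcond _ mab).
have mu1 : measurable_fun [set: T] u1.
  by apply/measurable_EFinP; exact: measurable_int intu1.
have [h mh hu] := borel_version mu1.
have mhT : measurable_fun [set: T] (h : T -> R).
  move=> _ A mA; rewrite setTI; apply: borel_lebesgue_measurable.
  by have := mh measurableT A mA; rewrite setTI.
have inth : (@lebesgue_measure R).-integrable setT (EFin \o h).
  apply/integrableP; split; first exact/measurable_EFinP.
  rewrite ge0_integral_lebesgue_completed//; last first.
    apply: (measurableT_comp (@abse_measurable R setT)).
    by apply/measurable_EFinP; exact: mh.
  rewrite (_ : integral _ _ _ = \int[mu]_x `|(EFin \o u1) x|)%E.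
    by case/integrableP : intu1.
  have m1 : measurable_fun [set: T] (fun x : T => `|(EFin \o h) x|%E).
    apply: (measurableT_comp (@abse_measurable R setT)).
    by apply/measurable_EFinP; exact: mhT.
  have m2 : measurable_fun [set: T] (fun x : T => `|(EFin \o u1) x|%E).
    apply: (measurableT_comp (@abse_measurable R setT)).
    by apply/measurable_EFinP; exact: mu1.
  apply: ae_eq_integral; [exact: measurableT|exact: m1|exact: m2|].
  by apply: filterS hu => x /= -> _.
have loch : locally_integrable setT h by apply: open_integrable_locally => //; exact: openT.
pose E (x : R) n : set R := `[x, x + n.+1%:R^-1[%classic.
have muE x n : lebesgue_measure (E x n) = (n.+1%:R^-1)%:E.
  by rewrite -[LHS]/(mu (E x n)) leb_itvco ?lerDl// addrAC subrr add0r.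
have nsE x : nicely_shrinking x (E x).
  split; first by move=> n; exact: measurable_itv.
  have np n : 0 < n.+1%:R^-1 :> R by rewrite invr_gt0.
  exists (2, fun n => PosNum (np n)); split => //=.
  - exact: cvg_harmonic.
  - move=> n y; rewrite /E/= in_itv/= => /andP[xy yx].
    by rewrite /ball/= distrC ger0_norm ?subr_ge0// ltrBlDr addrC.
  - move=> n; rewrite lebesgue_measure_ball//= muE -EFinM lee_fin.
    by rewrite mulr_natl.
have hlp : {ae mu, forall x : T, lebesgue_pt h x}.
  have [N [mN N0 hN]] := lebesgue_differentiation loch.
  by exists N; split => //; exact: borel_lebesgue_measurable.
have hu' := hu; near=> x => /andP[ax xb].
have hx : h x = u x.
  rewrite (near hu x)// /u1 patchE mem_set//= in_itv/= ax xb//.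
have hpx : lebesgue_pt h x by near: x.
have bx : 0 < b - x by rewrite subr_gt0.
have := nice_lebesgue_differentiation nsE loch hpx; rewrite hx => /fine_cvgP[_].
apply: cvg_trans; apply: near_eq_cvg; near=> n.
have xn : x + n.+1%:R^-1 <= b.
  have : n.+1%:R^-1 < b - x by near: n; exact: near_infty_natSinv_lt (PosNum bx).
  by move/ltW; rewrite lerBrDl.
rewrite /= muE inver invr_eq0 pnatr_eq0/= invrK.
have -> : (\int[lebesgue_measure]_(y in E x n) (h y)%:E =
    \int[mu]_(y in (E x n : set T)) (u y)%:E)%E.
  rewrite integral_lebesgue_completed; last 2 first.
  - exact: measurable_itv.
  - by apply/measurable_EFinP; exact: measurable_funS mh.
  apply: ae_eq_integral.
  - exact: measurable_itvL.
  - by apply/measurable_EFinP; exact: measurable_funS mhT.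
  - apply: measurable_funS (measurable_int _ intu) => //.
    by move=> y; rewrite /E/= !in_itv/= => /andP[xy yx]; rewrite (le_trans ax)//= (lt_le_trans yx).
  - apply: filterS hu' => y /= -> ; rewrite /E/= in_itv/= => /andP[xy yx].
    by rewrite /u1 patchE mem_set//= in_itv/= (le_trans ax)//= (lt_le_trans yx).
rewrite fineM//.
apply: integrable_fin_num; first exact: measurable_itvL.
by apply: integrable_sub_itv intu.
Unshelve. all: by end_near. Qed.

End borel_version.

(** * Representatives of bounded variation *)

Section variation_limits.
Context {R : realType}.

(** The variation along a given partition is a continuous function of the
    values at its points. *)
Lemma bvar_limit (X : Type) (F : set_system X) (FF : ProperFilter F) (I : set R)
    (f_ : X -> R -> R) (f : R -> R) A : is_interval I ->
  (forall x, I x -> f_ n x @[n --> F] --> f x) ->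
  (forall a b s, I a -> I b -> itv_partition a b s ->
    \forall n \near F, variation a b (f_ n) s <= A) ->
  bvar I f A.
Proof.
move=> iI ff fA a b s Ia Ib abs; have [x [ndx xab xE]] := partition_nth abs.
have Ix i : I (x i) by exact: (iI _ _ Ia Ib _ (xab i)).
have cv : variation a b (f_ n) s @[n --> F] --> variation a b f s.
  rewrite xE (_ : (fun n => _) = fun n =>
      \sum_(0 <= i < size s) `|f_ n (x i.+1) - f_ n (x i)|); last first.
    by apply/funext => n; rewrite xE.
  elim: (size s) => [|m ih].
    by rewrite big_nil; under eq_fun do rewrite big_nil; exact: cvg_cst.
  rewrite big_nat_recr//=; under eq_fun do rewrite big_nat_recr//=.
  by apply: cvgD => //; apply: cvg_norm; apply: cvgB; exact: ff.
apply: (@closed_cvg _ _ F _ _ (fun r => r <= A) _ _ _ cv).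
  exact: closed_le.
exact: fA.
Qed.

Lemma ultrafilter_image (X Y : Type) (h : X -> Y) (U : set_system X) :
  UltraFilter U -> UltraFilter (h @ U).
Proof.
move=> UU; split; first exact: fmap_proper_filter.
move=> G GP UG; apply/seteqP; split => // A GA.
have [//|UA] := in_ultra_setVsetC (h @^-1` A) UU.
have GnA : G (~` A) by apply: UG.
by have /filter_ex[y []] : G (A `&` ~` A) by exact: filterI.
Qed.

(** A form of Helly's theorem. The values at each point are eventually
    bounded, hence converge along an ultrafilter on the natural numbers that
    refines the usual limit; it replaces the extraction of a subsequence
    that converges at every point. *)
Lemma bvar_pointwise_limit (I : set R) (f_ : nat -> R -> R) (D : nat -> set R)
    (A z l : R) : is_interval I -> I z ->
  (forall n, bvar (D n) (f_ n) A) ->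
  (forall n, is_interval (D n)) ->
  (forall x, I x -> \forall n \near \oo, D n x) ->
  f_ n z @[n --> \oo] --> l ->
  exists f, bvar I f A /\
    forall x r, I x -> f_ n x @[n --> \oo] --> r -> f x = r.
Proof.
move=> iI Iz fA iD ID fz.
(* The value at z converges; together with the bound A of the variation it
   bounds the values at all points. *)
have [U [UU oU]] := ultraFilterLemma (F := \oo%classic : set_system nat) _.
have UP : ProperFilter U by exact: ultra_proper.
have U_oo (P : set nat) : (\forall n \near \oo, P n) -> U P by move=> h; exact: oU.
have bnd x : I x -> \forall n \near \oo, `|f_ n x| <= A + (`|l| + 1).
  move=> Ix; have h1 := ID _ Ix; have h2 := ID _ Iz.
  have h3 : \forall n \near \oo, `|l - f_ n z| < 1 by move/cvgrPdist_lt : fz; exact.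
  near=> n.
  have Dx : D n x by near: n.
  have Dz : D n z by near: n.
  have lz : `|l - f_ n z| < 1 by near: n.
  have [p [fp pA]] := bvar_dominated (fA n).
  have /andP[px0 pxA] := pA _ Dx; have /andP[pz0 pzA] := pA _ Dz.
  have xz : `|f_ n x - f_ n z| <= A.
    have [xz|/ltW zx] := leP x z.
      by rewrite distrC (le_trans (fp _ _ Dx Dz xz))//; lra.
    by rewrite (le_trans (fp _ _ Dz Dx zx))//; lra.
  have -> : f_ n x = (f_ n x - f_ n z) + (l - (l - f_ n z)) by ring.
  rewrite (le_trans (ler_normD _ _))// lerD// (le_trans (ler_normB _ _))//.
  by rewrite lerD2l ltW.
have cvU x : I x -> exists r : R, f_ n x @[n --> U] --> r.
  move=> Ix; pose M := A + (`|l| + 1).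
  have cM : compact (`[- M, M]%classic : set R) by exact: segment_compact.
  move: cM; rewrite compact_ultra => cM.
  have UfU : UltraFilter (f_ n x @[n --> U]) by exact: ultrafilter_image.
  have [|r [_ r_]] := cM (f_ n x @[n --> U]) UfU.
    apply: U_oo; apply: filterS (bnd _ Ix) => n; rewrite /= in_itv/=.
    by rewrite ler_norml.
  by exists r.
exists (fun x => lim (f_ n x @[n --> U])).
have cvl x : I x -> f_ n x @[n --> U] --> lim (f_ n x @[n --> U]).
  by move=> Ix; have [r fr] := cvU _ Ix; apply/cvg_ex; exists r.
split.
  apply: (@bvar_limit _ U UP I f_ _ A iI cvl) => a b s Ia Ib abs; apply: U_oo.
  have h1 := ID _ Ia; have h2 := ID _ Ib.
  near=> n; apply: (fA n) => //; near: n => //.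
move=> x r Ix fr; apply/cvg_lim => //.
by apply: cvg_trans fr; exact: cvg_app oU.
Unshelve. all: by end_near. Qed.

End variation_limits.

Section bv_representative.
Context {R : realType}.
Local Notation T := (lebesgueR R).
Local Notation mu := (leb R).
Variables (c d : \bar R) (cd : (c < d)%E).
Local Notation I := (oitv c d : set R).

(** An interval of positive length is not negligible. *)
Lemma ae_oitv_exists (P : R -> Prop) :
  {ae mu, forall x : T, I x -> P x} -> exists2 x, I x & P x.
Proof.
move=> [N [mN N0 PN]]; apply: contrapT => nP.
have [a [b [Iab ab _ _ _]]] := oitv_exhaustion cd.
have sub : (`[a 0%N, b 0%N[%classic `<=` N)%classic.
  move=> x /=; rewrite in_itv/= => /andP[ax xb]; apply: PN => /= Px.
  have Ix : I x by apply: (oitv_interval (Iab 0%N).1 (Iab 0%N).2); rewrite ax ltW.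
  by apply: nP; exists x => //; exact: Px.
have : (mu `[a 0%N, b 0%N[%classic <= mu N)%E.
  by apply: le_measure; rewrite ?inE//; exact: measurable_itvL.
rewrite [X in (X <= _)%E](leb_itvco (ltW (ab 0%N))) N0 lee_fin.
by rewrite leNgt subr_gt0 ab.
Qed.

Lemma ae_exhaustion (P : R -> Prop) :
  (forall a b, I a -> I b -> a <= b -> {ae mu, forall x : T, a <= x < b -> P x}) ->
  {ae mu, forall x : T, I x -> P x}.
Proof.
move=> abP; have [a [b [Iab ab _ _ abI]]] := oitv_exhaustion cd.
have : {ae mu, forall x : T, forall n, a n <= x < b n -> P x}.
  by apply/ae_foralln => n; apply: abP (ltW (ab n)); case: (Iab n).
apply: filterS => x Px /abI[n /andP[ax xb]].
by apply: (Px n); rewrite ltW.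
Qed.

Lemma shrunk_eventually x : I x -> \forall n \near \oo, shrunk c d n.+1%:R^-1 x.
Proof.
move=> Ix; have /nbhs_ballP[e /= e0 xe] : nbhs x I.
  by apply: open_nbhs_nbhs; split => //; exact: oitv_open.
near=> n; split => //; apply: xe; rewrite /ball/= opprD addrA subrr sub0r normrN.
rewrite gtr0_norm//.
by near: n; exact: near_infty_natSinv_lt (PosNum e0).
Unshelve. all: by end_near. Qed.

(** The limit of the averages of u exists and equals u almost everywhere;
    their limit along an ultrafilter is a function of bounded variation that
    agrees with it wherever it exists. *)
Lemma bv_representative (u : T -> R) A :
  (forall a b, I a -> I b -> a <= b ->
    mu.-integrable (`[a, b[%classic : set T) (EFin \o u)) ->
  (forall dl, 0 < dl -> bvar (shrunk c d dl)
    (fun y => dl^-1 * \int[mu]_(t in `[y, y + dl[) u t) A) ->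
  exists f : R -> R, bvar I f A /\ {ae mu, forall x : T, I x -> f x = u x}.
Proof.
move=> intu uA.
pose f_ (n : nat) (x : R) := n.+1%:R * \int[mu]_(t in `[x, x + n.+1%:R^-1[) u t.
have cvu : {ae mu, forall x : T, I x -> f_ n x @[n --> \oo] --> u x}.
  apply: ae_exhaustion => a b Ia Ib ab.
  exact: (averages_cvg_ae ab (intu _ _ Ia Ib ab)).
have [z Iz cz] := ae_oitv_exists cvu.
have dl0 n : 0 < n.+1%:R^-1 :> R by rewrite invr_gt0.
have h1 n : bvar (shrunk c d n.+1%:R^-1) (f_ n) A.
  have := uA _ (dl0 n); congr bvar; apply/funext => y.
  by rewrite invrK.
have h2 n : is_interval (shrunk c d (n.+1%:R^-1 : R)) by exact: shrunk_interval.
have h3 x : I x -> \forall n \near \oo, shrunk c d n.+1%:R^-1 x.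
  exact: shrunk_eventually.
have [f [fA fl]] := bvar_pointwise_limit (@oitv_interval _ c d) Iz h1 h2 h3 cz.
exists f; split => //.
by apply: filterS cvu => x cx Ix; exact: fl (cx Ix).
Unshelve. all: by end_near. Qed.

Section bv.
Variables (f p : R -> R) (S : R).
Hypotheses (fp : dominated I f p) (pS : forall x, I x -> 0 <= p x <= S).

Let I_in a b x : I a -> I b -> a <= x <= b -> I x.
Proof. by move=> Ia Ib; exact: (oitv_interval Ia Ib). Qed.

Lemma bv_measurable (D : set T) : measurable D -> (D `<=` I)%classic ->
  measurable_fun D (f : T -> R).
Proof.
move=> mD DI; apply: (@dominated_measurable _ D f p 0 S) => //.
  by move=> x y /DI Ix /DI; exact: fp.
by move=> x /DI; exact: pS.
Qed.

Lemma bv_bounded : exists M, forall x, I x -> `|f x| <= M.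
Proof.
have [a [b [Iab _ _ _ _]]] := oitv_exhaustion cd.
have Iz := (Iab 0%N).1; set z := a 0%N in Iz.
exists (`|f z| + S) => x Ix.
have /andP[px0 pxS] := pS Ix; have /andP[pz0 pzS] := pS Iz.
have xz : `|f x - f z| <= S.
  have [xz|/ltW zx] := leP x z.
    by rewrite distrC (le_trans (fp Ix Iz xz))//; lra.
  by rewrite (le_trans (fp Iz Ix zx))//; lra.
rewrite -(subrK (f z) (f x)) (le_trans (ler_normD _ _))// addrC lerD2l//.
Qed.

(** On a block of length h, the integral of |f - rlim f| is at most h times
    the increment of p over the block. Summed over the blocks of a partition
    of [a, b], this is at most the mesh times the bound of p. *)
Lemma rlim_ae : {ae mu, forall x : T, I x -> f x = rlim f x}.
Proof.
have [rfp rpS pp] := dominated_rlim (@oitv_open _ c d) fp pS.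
apply: ae_exhaustion => a b Ia Ib ab.
have sub x : `[a, b[%classic x -> I x.
  by rewrite /= in_itv/= => /andP[ax xb]; apply: (I_in Ia Ib); rewrite ax ltW.
have mab : measurable (`[a, b[%classic : set T) by exact: measurable_itvL.
have mf : measurable_fun (`[a, b[%classic : set T) (f : T -> R) by exact: bv_measurable.
have mrf : measurable_fun (`[a, b[%classic : set T) (rlim f : T -> R).
  apply: (@dominated_measurable _ _ _ (rlim p) 0 S) => //.
    by move=> x y /sub Ix /sub; exact: rfp.
  by move=> x /sub; exact: rpS.
pose h (x : T) := f x - rlim f x.
have mh : measurable_fun (`[a, b[%classic : set T) h by exact: measurable_funB.
have hS x : I x -> `|h x| <= S.
  move=> Ix; have /nbhs_ballP[e /= e0 xe] : nbhs x I.
    by apply: open_nbhs_nbhs; split => //; exact: oitv_open.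
  have Iy : I (x + e / 2).
    apply: xe; rewrite /ball/= opprD addrA subrr sub0r normrN gtr0_norm ?divr_gt0//.
    by rewrite ltr_pdivrMr// ltr_pMr// ltr1n.
  have xy : x < x + e / 2 by rewrite ltrDl divr_gt0.
  rewrite (le_trans (pp _ _ Ix Iy xy))//.
  by have /andP[? ?] := pS Ix; have /andP[? ?] := pS Iy; lra.
have inth : mu.-integrable (`[a, b[%classic : set T) (EFin \o (fun t => `|h t|)).
  apply: (@integrable_itv_bounded _ _ _ S _ ab).
    exact: (measurableT_comp (@normr_measurable R setT) mh).
  move=> x axb; rewrite normr_id; apply: hS.
  by case/andP: axb => ax xb; apply: (I_in Ia Ib); rewrite ax ltW.
have Sge0 : 0 <= S by have /andP[/le_trans] := pS Ia; exact.
have key n : \int[mu]_(t in `[a, b[) `|h t| <= (b - a) / n.+1%:R * S.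
  pose s := upart a b n.
  have nds : nondecreasing_seq s := upart_nondecreasing n ab.
  have sab i : (i <= n.+1)%N -> a <= s i <= b by move=> ni; exact: upart_itv.
  have Is i : (i <= n.+1)%N -> I (s i) by move=> /sab; exact: (I_in Ia Ib).
  have := @Rintegral_partition _ (fun t => `|h t|) s n.+1 nds.
  rewrite {1 2 3 4}/s upart0 upartn => /(_ inth) ->.
  apply: (@le_trans _ _ (\sum_(0 <= i < n.+1) (b - a) / n.+1%:R * (p (s i.+1) - p (s i)))).
    rewrite big_nat [leRHS]big_nat; apply: ler_sum => i /andP[_ ni].
    have Isi := Is _ (ltnW ni); have Isi1 := Is _ ni.
    have /andP[asi _] := sab _ (ltnW ni); have /andP[_ sib] := sab _ ni.
    have ss := nds _ _ (leqnSn i).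
    have mi : measurable (`[s i, s i.+1[%classic : set T) by exact: measurable_itvL.
    apply: (@le_trans _ _ (\int[mu]_(t in `[s i, s i.+1[) (p (s i.+1) - p (s i)))).
      apply: le_Rintegral => //.
      - exact: integrable_sub_itv inth.
      - apply: (@integrable_itv_bounded _ _ _ `|p (s i.+1) - p (s i)|) => //;
        exact: measurable_cst.
      - move=> t /=; rewrite in_itv/= => /andP[st ts].
        have It : I t by apply: (I_in Isi Isi1); rewrite st ltW.
        rewrite (le_trans (pp _ _ It Isi1 ts))// lerD2l lerN2.
        exact: (dominated_nondecreasing fp).
    rewrite Rintegral_cst//.
    have /(congr1 fine) /= -> := leb_itvco ss.
    by rewrite mulrC /s upartS addrAC subrr add0r.
  rewrite -mulr_sumr (@telescope_sumr _ 0 n.+1 (p \o s))//= /s upart0 upartn.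
  have ba : 0 <= (b - a) / n.+1%:R by rewrite divr_ge0// subr_ge0.
  rewrite ler_wpM2l//.
  by have /andP[? ?] := pS Ia; have /andP[? ?] := pS Ib; lra.
have h0 : \int[mu]_(t in `[a, b[) `|h t| = 0.
  apply/eqP; rewrite eq_le Rintegral_ge0// andbT.
  have C0 : 0 <= (b - a) * S by rewrite mulr_ge0// subr_ge0.
  apply/ler_addgt0Pr => e e0; rewrite add0r.
  have := archi_boundP (divr_ge0 C0 (ltW e0)); set N := Num.bound _ => hN.
  apply: (le_trans (key N)); rewrite mulrAC ler_pdivrMr// [leRHS]mulrC.
  move: hN; rewrite ltr_pdivrMr// => /ltW/le_trans; apply.
  by rewrite ler_wpM2r ?(ltW e0)// ler_nat.
have : ae_eq mu (`[a, b[%classic : set T) (EFin \o h) (cst 0).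
  apply/ae_eq_integral_abs => //; first exact/measurable_EFinP.
  have := congr1 EFin h0; rewrite /Rintegral fineK//.
  by apply: integrable_fin_num.
apply: filterS => x hx xab.
by apply/eqP; rewrite -subr_eq0; have [/eqP] := hx xab.
Qed.

(** As n grows, the block [y, y + 1/n) only sees values of f close to its
    right limit at y. *)
Lemma averages_cvg_rlim (u : T -> R) : measurable_fun (I : set T) u ->
  {ae mu, forall x : T, I x -> u x = f x} ->
  forall y, I y ->
  n.+1%:R * \int[mu]_(t in `[y, y + n.+1%:R^-1[) u t @[n --> \oo] --> rlim f y.
Proof.
move=> mu_ uf y Iy.
have [rfp rpS pp] := dominated_rlim (@oitv_open _ c d) fp pS.
have cr := (rlim_idem (@oitv_open _ c d) fp pS Iy).1.
apply/cvgrPdist_le => e e0.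
move/cvgrPdist_le : cr => /(_ e e0) cr.
have [z yz Hz] : exists2 z, y < z & forall t, y < t < z -> `|rlim f y - rlim f t| <= e /\ I t.
  have : \forall t \near y^'+, `|rlim f y - rlim f t| <= e /\ I t.
    near=> t; split; near: t => //.
    by apply: near_at_right_itv => //; exact: oitv_open.
  move=> [r /= r0 Hr]; exists (y + r); first by rewrite ltrDl.
  move=> t /andP[yt tr]; apply: Hr => //=.
  by rewrite /ball/= distrC gtr0_norm ?subr_gt0// ltrBlDr addrC.
have zy : 0 < z - y by rewrite subr_gt0.
near=> n.
have yn : y + n.+1%:R^-1 < z.
  by rewrite -ltrBrDl; near: n; exact: near_infty_natSinv_lt (PosNum zy).
have n0 : 0 < n.+1%:R^-1 :> R by rewrite invr_gt0.
have n1 : 0 < n.+1%:R :> R by rewrite ltr0n.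
have yyn : y <= y + n.+1%:R^-1 by rewrite lerDl ltW.
pose J : set T := `[y, y + n.+1%:R^-1[%classic.
have mJ : measurable J by exact: measurable_itvL.
have sJ t : J t -> I t.
  rewrite /J/= in_itv/= le_eqVlt => /andP[/predU1P[<-//|yt] tn].
  by apply: (Hz t _).2; rewrite yt (lt_trans tn).
have rint : mu.-integrable J (EFin \o (rlim f : T -> R)).
  apply: (@integrable_itv_bounded _ _ _ (`|rlim f y| + e)) => //.
    apply: (@dominated_measurable _ _ _ (rlim p) 0 S) => //.
      by move=> r s /sJ Ir /sJ; exact: rfp.
    by move=> r /sJ; exact: rpS.
  move=> t; rewrite le_eqVlt => /andP[/predU1P[<-|yt] tn].
    by rewrite lerDl ltW.
  have [h _] := Hz t (introT andP (conj yt (lt_trans tn yn))).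
  have -> : rlim f t = rlim f y - (rlim f y - rlim f t) by ring.
  by rewrite (le_trans (ler_normB _ _))// lerD2l.
have -> : \int[mu]_(t in `[y, y + n.+1%:R^-1[) u t = \int[mu]_(t in J) rlim f t.
  congr fine; apply: ae_eq_integral.
  - exact: mJ.
  - apply/measurable_EFinP; exact: (measurable_funS (measurable_oitvL c d) sJ mu_).
  - exact: measurable_int rint.
  - have ur := rlim_ae; apply: filterS2 uf ur => x h1 h2 /sJ Ix.
    by rewrite /= h1// h2.
have -> : rlim f y = n.+1%:R * \int[mu]_(t in J) rlim f y.
  rewrite Rintegral_cst//.
  have /(congr1 fine) /= -> := leb_itvco yyn.
  by rewrite [_ + _ - _]addrAC subrr add0r mulrCA divff ?mulr1// gt_eqF.
have cint : mu.-integrable J (EFin \o (fun=> rlim f y)).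
  by apply: (@integrable_itv_bounded _ _ _ `|rlim f y|) => //; exact: measurable_cst.
rewrite -mulrBr -RintegralB// normrM gtr0_norm// mulrC -ler_pdivlMr//.
have dint := integrable_realB mJ cint rint.
rewrite (le_trans (le_normr_Rintegral mJ dint))//.
apply: (@le_trans _ _ (\int[mu]_(t in J) e)).
  apply: le_Rintegral => //.
  - exact: integrable_norm dint.
  - by apply: (@integrable_itv_bounded _ _ _ `|e|) => //; exact: measurable_cst.
  - move=> t; rewrite /J/= in_itv/= le_eqVlt => /andP[/predU1P[<-|yt] tn].
      by rewrite subrr normr0 ltW.
    by apply: (Hz t _).1; rewrite yt (lt_trans tn).
rewrite Rintegral_cst//.
have /(congr1 fine) /= -> := leb_itvco yyn.
by rewrite [_ + _ - _]addrAC subrr add0r.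
Unshelve. all: by end_near. Qed.

(** The averages converge to the right limits at every point, so that the
    bound of the variation of the averages passes to the right-limit
    function itself. *)
Lemma rlim_bvar (u : T -> R) A : measurable_fun (I : set T) u ->
  {ae mu, forall x : T, I x -> u x = f x} ->
  (forall dl, 0 < dl -> bvar (shrunk c d dl)
    (fun y => dl^-1 * \int[mu]_(t in `[y, y + dl[) u t) A) ->
  bvar I (rlim f) A.
Proof.
move=> mu_ uf uA.
apply: (@bvar_limit _ nat \oo _ I
  (fun n y => n.+1%:R * \int[mu]_(t in `[y, y + n.+1%:R^-1[) u t) _ A
  (@oitv_interval _ c d) (averages_cvg_rlim mu_ uf)).
move=> a b s Ia Ib abs.
have dl0 n : 0 < n.+1%:R^-1 :> R by rewrite invr_gt0.
near=> n.
have Sa : shrunk c d n.+1%:R^-1 a by near: n; exact: shrunk_eventually.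
have Sb : shrunk c d n.+1%:R^-1 b by near: n; exact: shrunk_eventually.
have := uA _ (dl0 n) a b s Sa Sb abs.
by under eq_fun do rewrite invrK.
Unshelve. all: by end_near. Qed.

End bv.
End bv_representative.

(** * The dual estimate on the whole interval *)

Section exhaustion.
Context {R : realType}.
Local Notation T := (lebesgueR R).
Local Notation mu := (leb R).
Variables (c d : \bar R) (cd : (c < d)%E).
Local Notation I := (oitv c d : set R).

Let I_in a b x : I a -> I b -> a <= x <= b -> I x.
Proof. by move=> Ia Ib; exact: (oitv_interval Ia Ib). Qed.

Let mI : measurable (I : set T). Proof. exact: measurable_oitvL. Qed.

Lemma exhaustion_co : exists a b : nat -> R,
  [/\ forall n, [/\ I (a n), I (b n) & a n <= b n],
   (forall n, `[a n, b n[%classic `<=` I)%classic,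
   nondecreasing_seq (fun n => `[a n, b n[%classic : set T) &
   \bigcup_n (`[a n, b n[%classic : set T) = I].
Proof.
have [a [b [Iab ab and_ bnd abI]]] := oitv_exhaustion cd.
have sub n : (`[a n, b n[%classic `<=` I)%classic.
  move=> x /=; rewrite in_itv/= => /andP[ax xb].
  by apply: (I_in (Iab n).1 (Iab n).2); rewrite ax ltW.
exists a, b; split => //.
- by move=> n; split; [case: (Iab n)|case: (Iab n)|exact: ltW].
- move=> n m nm; apply/subsetPset => x /=; rewrite !in_itv/= => /andP[ax xb].
  by rewrite (le_trans (and_ _ _ nm))//= (lt_le_trans xb)// bnd.
- apply/seteqP; split => [x [n _]|x /abI[n /andP[ax xb]]]; first exact: sub.
  by exists n => //=; rewrite in_itv/= ltW.
Qed.

Lemma ge0_integral_exhaustion (h : T -> \bar R) (C : \bar R) :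
  measurable_fun (I : set T) h -> (forall x, I x -> 0 <= h x)%E ->
  (forall a b, I a -> I b -> a <= b ->
    (\int[mu]_(t in (`[a, b[%classic : set T)) h t <= C)%E) ->
  (\int[mu]_(t in (I : set T)) h t <= C)%E.
Proof.
move=> mh h0 hC; have [a [b [Iab sub nd UI]]] := exhaustion_co.
have cv := @ge0_nondecreasing_set_cvg_integral _ _ _
  (fun n => `[a n, b n[%classic : set T) h mu nd
  (fun n => measurable_itvL _)
  (fun n => measurable_funS mI (sub n) mh)
  (fun n x abx => h0 _ (sub n x abx)).
rewrite -UI -(cvg_lim _ cv)//; apply: lime_le; first by apply/cvg_ex; eexists; exact: cv.
apply: nearW => n; case: (Iab n) => Ia Ib ab; exact: hC.
Qed.

(** The integral of |h| outside of the n-th block of the exhaustion goes to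
    0. *)
Lemma Rintegral_exhaustion (h : T -> R) C :
  mu.-integrable (I : set T) (EFin \o h) ->
  (forall a b, I a -> I b -> a <= b ->
    `|\int[mu]_(t in `[a, b[) h t| <= C) ->
  `|\int[mu]_(t in (I : set T)) h t| <= C.
Proof.
move=> inth hC; have [a [b [Iab sub nd UI]]] := exhaustion_co.
pose J n : set T := `[a n, b n[%classic.
have mJ n : measurable (J n) by exact: measurable_itvL.
have intn : mu.-integrable (I : set T) (EFin \o (fun t => `|h t|)) := integrable_norm inth.
have mn := measurable_int _ intn.
have cv : \int[mu]_(t in J n) `|h t| @[n --> \oo] --> \int[mu]_(t in (I : set T)) `|h t|.
  have := @ge0_nondecreasing_set_cvg_integral _ _ _ J (EFin \o (fun t => `|h t|)) mu nd mJ
    (fun n => measurable_funS mI (sub n) mn) (fun n x _ => normr_ge0 (h x)).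
  rewrite UI => cv; apply: fine_cvg; move: cv.
  by rewrite /Rintegral fineK//; exact: integrable_fin_num intn.
apply/ler_addgt0Pr => e e0.
have [n _ Hn] : \forall n \near \oo,
    `|\int[mu]_(t in (I : set T)) `|h t| - \int[mu]_(t in J n) `|h t| | <= e.
  by move/cvgrPdist_le : cv; exact.
have {}Hn := Hn n (leqnn n).
pose K : set T := (I `\` J n)%classic.
have mK : measurable K by exact: measurableD.
have IJK : (I : set T) = J n `|` K.
  by apply/esym; apply: setDUK; exact: sub.
have dJK : [disjoint J n & K] by apply/disj_set2P; exact: setDIK.
have E1 f : mu.-integrable (I : set T) (EFin \o f) ->
    \int[mu]_(t in (I : set T)) f t = \int[mu]_(t in J n) f t + \int[mu]_(t in K) f t.
  by move=> intf; rewrite {1}IJK Rintegral_setU// -IJK.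
rewrite (E1 _ inth) (le_trans (ler_normD _ _))// lerD//.
  by case: (Iab n) => Ia Ib ab; exact: hC.
have KI : (K `<=` I)%classic by move=> x [].
have intK : mu.-integrable K (EFin \o h) by exact: integrableS mI mK KI inth.
rewrite (le_trans (le_normr_Rintegral mK intK))//.
move: Hn; rewrite (E1 _ intn) addrAC subrr add0r.
by rewrite ger0_norm// Rintegral_ge0.
Qed.

End exhaustion.

Section dual_estimate.
Context {R : realType}.
Local Notation T := (lebesgueR R).
Local Notation mu := (leb R).
Variables (c d : \bar R) (cd : (c < d)%E).
Local Notation I := (oitv c d : set R).
Variable v : T -> R.
Hypotheses (v0 : forall t, 0 <= v t) (lv : loc_int c d v).
Local Notation V := (prim c v).
Hypothesis V0 : forall x, I x -> 0 < V x.
Hypothesis Vy : forall r, exists2 b, I b & r <= V b.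

Let I_in a b x : I a -> I b -> a <= x <= b -> I x.
Proof. by move=> Ia Ib; exact: (oitv_interval Ia Ib). Qed.

Let mI : measurable (I : set T). Proof. exact: measurable_oitvL. Qed.

(** Both sides are continuous in x, so that an inequality almost everywhere
    holds everywhere; continuity is used in the form that a short integral
    is small. *)
Lemma prim_ae_le f N : loc_int c d f -> 0 <= N ->
  {ae mu, forall x : T, I x -> `|prim c f x| <= N * V x} ->
  forall x, I x -> `|prim c f x| <= N * V x.
Proof.
move=> lf N0 fN x Ix.
have /nbhs_ballP[r /= r0 xr] : nbhs x I.
  by apply: open_nbhs_nbhs; split => //; exact: oitv_open.
pose b := x + r / 2.
have xb : x < b by rewrite ltrDl divr_gt0.
have Ib : I b.
  apply: xr; rewrite /ball/= opprD addrA subrr sub0r normrN gtr0_norm ?divr_gt0//.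
  by rewrite ltr_pdivrMr// ltr_pMr// ltr1n.
apply/ler_addgt0Pr => e e0.
(* An error e' on the primitive of f and N e' on that of v. *)
pose e' := e / (N + 1).
have N1 : 0 < N + 1 by rewrite ltr_wpDl.
have e'0 : 0 < e' by rewrite divr_gt0.
have [n1 H1] := upart_small (ltW xb) (loc_int_itv lf Ix Ib) e'0.
have [n2 H2] := upart_small (ltW xb) (loc_int_itv lv Ix Ib) e'0.
pose n := maxn n1 n2; pose z := upart x b n 1.
have := H1 n 0%N (leq_maxl _ _) (ltn0Sn n); rewrite upart0 -/z => {}H1.
have := H2 n 0%N (leq_maxr _ _) (ltn0Sn n); rewrite upart0 -/z => {}H2.
have xz : x < z.
  by rewrite /z upartS upart0 ltrDl divr_gt0// subr_gt0.
have zb : z <= b by case/andP: (upart_itv (n := n) (i := 1) (ltW xb) isT).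
have Iz : I z by apply: (I_in Ix Ib); rewrite (ltW xz).
have xzI t : oitv x%:E z%:E t -> I t.
  by rewrite /oitv/= !lte_fin => /andP[xt tz]; apply: (I_in Ix Iz); rewrite !ltW.
have xze : (x%:E < z%:E)%E by rewrite lte_fin.
have [y xyz Hy] : exists2 y, oitv x%:E z%:E y & `|prim c f y| <= N * V y.
  apply: (ae_oitv_exists xze (P := fun y => `|prim c f y| <= N * V y)).
  by apply: filterS fN => y fy /xzI; exact: fy.
have Iy := xzI _ xyz.
move: xyz; rewrite /oitv/= !lte_fin => /andP[xy yz].
have small h : loc_int c d h -> \int[mu]_(t in `[x, z[) `|h t| <= e' ->
    `|prim c h y - prim c h x| <= e'.
  move=> lh hz; have mxy : measurable (`[x, y[%classic : set T) by exact: measurable_itvL.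
  rewrite (primB lh Ix Iy (ltW xy)).
  rewrite (le_trans (le_normr_Rintegral mxy (loc_int_itv lh Ix Iy)))//.
  apply: le_trans hz.
  rewrite (Rintegral_itv_split (ltW xy) (ltW yz)) ?lerDl ?Rintegral_ge0//.
  by exact: (integrable_norm (loc_int_itv lh Ix Iz)).
have h1 := small _ lf H1; have h2 := small _ lv H2.
have -> : prim c f x = prim c f y - (prim c f y - prim c f x) by rewrite opprB addrC subrK.
rewrite (le_trans (ler_normB _ _))//.
have -> : e = N * e' + e'.
  by rewrite -[X in _ + X]mul1r -mulrDl mulrC /e' divfK// gt_eqF.
rewrite addrA lerD// (le_trans Hy)// -mulrDr ler_wpM2l//.
by rewrite -lerBlDl (le_trans (ler_norm _)).
Qed.

Section estimate.
Variables (g : T -> R) (k p : R -> R) (S B : R).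
Hypotheses (kp : dominated I k p) (pS : forall x, I x -> 0 <= p x <= S).
Hypothesis gk : {ae mu, forall x : T, I x -> g x = k x / V x}.
Hypothesis mg : measurable_fun [set: T] g.
Hypothesis intvg : mu.-integrable (I : set T) (EFin \o (fun t => v t * `|g t|)).
Hypothesis vgB : \int[mu]_(t in (I : set T)) (v t * `|g t|) <= B.

Let sub_itv a b : I a -> I b -> (`[a, b[%classic `<=` I)%classic.
Proof.
by move=> Ia Ib t /=; rewrite in_itv/= => /andP[at_ tb]; apply: (I_in Ia Ib); rewrite at_ ltW.
Qed.

Let itv_ae_eq (f1 f2 : T -> R) a b : I a -> I b ->
  mu.-integrable (`[a, b[%classic : set T) (EFin \o f1) ->
  mu.-integrable (`[a, b[%classic : set T) (EFin \o f2) ->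
  {ae mu, forall x : T, I x -> f1 x = f2 x} ->
  \int[mu]_(t in `[a, b[) f1 t = \int[mu]_(t in `[a, b[) f2 t.
Proof.
move=> Ia Ib i1 i2 f12; congr fine; apply: ae_eq_integral.
- exact: measurable_itvL.
- exact: measurable_int i1.
- exact: measurable_int i2.
- by apply: filterS f12 => x fx /(sub_itv Ia Ib)/fx /= ->.
Qed.

Lemma weighted_quotient_le a b : I a -> I b -> a <= b ->
  \int[mu]_(t in `[a, b[) (v t * `|k t / V t|) <= B.
Proof.
move=> Ia Ib ab.
have [M kM] := bv_bounded cd kp pS.
have mab : measurable (`[a, b[%classic : set T) by exact: measurable_itvL.
have ig := integrableS mI mab (sub_itv Ia Ib) intvg.
have ik := quotient_abs_integrable v0 lv V0 kp kM lv Ia Ib ab.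
apply: le_trans vgB; rewrite -(itv_ae_eq Ia Ib ig ik).
  have := @ge0_subset_integral _ _ _ mu _ _ mab mI (EFin \o (fun t => v t * `|g t|)).
  move=> /(_ (measurable_int _ intvg)) H.
  rewrite /Rintegral fine_le//.
  - exact: integrable_fin_num ig.
  - exact: integrable_fin_num intvg.
  - apply: H; last exact: sub_itv.
    by move=> x _; rewrite lee_fin mulr_ge0.
by apply: filterS gk => x gx Ix; rewrite gx.
Qed.

(** This removes the bound of k from the constants: the oscillation S of k
    is enough, because inf |k| = 0. *)
Lemma rep_bounded x : I x -> `|k x| <= S.
Proof.
have [M kM] := bv_bounded cd kp pS.
have [a [b [Iab _ _ _ _]]] := oitv_exhaustion cd.
apply: (weighted_integral_sup v0 lv V0 _ kp pS kM Vy weighted_quotient_le).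
by exists (a 0%N); case: (Iab 0%N).
Qed.

(** The constant 3 S comes from 2 sup |k| <= 2 S and var k <= S in
    [quotient_integral_le]. *)
Lemma itv_dual_le f N a b : loc_int c d f ->
  (forall x, I x -> `|prim c f x| <= N * V x) -> I a -> I b -> a <= b ->
  `|\int[mu]_(t in `[a, b[) (f t * (k t / V t))| <= N * (3 * S + B).
Proof.
move=> lf fN Ia Ib ab.
rewrite (le_trans (quotient_integral_le v0 lv V0 kp rep_bounded lf fN Ia Ib ab))//.
have N0 : 0 <= N.
  by have := le_trans (normr_ge0 _) (fN a Ia); rewrite pmulr_lge0// V0.
have vk := weighted_quotient_le Ia Ib ab.
rewrite ler_wpM2l// lerD// (_ : 3 * S = 2 * S + S); last by ring.
rewrite lerD2l.
by have /andP[? ?] := pS Ia; have /andP[? ?] := pS Ib; lra.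
Qed.

(** [quotient_integral_le] applied to |f| and |k|. *)
Lemma dual_integrable f N : measurable_fun [set: T] f -> loc_int c d f ->
  (forall x, I x -> prim c (fun t => `|f t|) x <= N * V x) ->
  mu.-integrable (I : set T) (EFin \o (fun t => f t * g t)).
Proof.
move=> mf lf fN.
have [M kM] := bv_bounded cd kp pS.
have kpa : dominated I (fun x => `|k x|) p.
  by move=> x y Ix Iy xy; rewrite (le_trans (ler_dist_dist _ _))// kp.
have mfg : measurable_fun [set: T] (fun t => f t * g t) by exact: measurable_funM.
have mI_fg : measurable_fun (I : set T) (fun t => f t * g t).
  exact: measurable_funS mfg.
apply/integrableP; split; first exact/measurable_EFinP.
apply: (@le_lt_trans _ _ (N * (3 * S + B))%:E); last exact: ltry.
apply: (ge0_integral_exhaustion cd).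
- apply: (measurableT_comp (@abse_measurable R setT)).
  exact/measurable_EFinP.
- by move=> x _.
move=> a b Ia Ib ab.
have lfa := loc_int_abs lf.
have mab : measurable (`[a, b[%classic : set T) by exact: measurable_itvL.
have kMa x : I x -> `| `|k x| | <= M by move=> Ix; rewrite normr_id kM.
have Sa x : I x -> `| `|k x| | <= S by move=> Ix; rewrite normr_id rep_bounded.
have ik := quotient_integrable v0 lv V0 kpa kMa lfa Ia Ib ab.
have fNa x : I x -> `|prim c (fun t => `|f t|) x| <= N * V x.
  by move=> Ix; rewrite ger0_norm ?fN// prim_ge0.
have := quotient_integral_le v0 lv V0 kpa Sa lfa fNa Ia Ib ab.
have N0 : 0 <= N.
  by have := le_trans (normr_ge0 _) (fNa a Ia); rewrite pmulr_lge0// V0.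
have vk := weighted_quotient_le Ia Ib ab.
have -> : \int[mu]_(t in `[a, b[) (v t * `| `|k t| / V t |) =
    \int[mu]_(t in `[a, b[) (v t * `|k t / V t|).
  by apply: eq_Rintegral => t _; rewrite !normrM normr_id.
move=> H.
have {}H : \int[mu]_(t in `[a, b[) (`|f t| * (`|k t| / V t)) <= N * (3 * S + B).
  apply: (le_trans (ler_norm _)); apply: (le_trans H).
  rewrite ler_wpM2l// lerD// (_ : 3 * S = 2 * S + S); last by ring.
  rewrite lerD2l.
  by have /andP[? ?] := pS Ia; have /andP[? ?] := pS Ib; lra.
rewrite (_ : integral _ _ _ = (\int[mu]_(t in `[a, b[) (`|f t| * (`|k t| / V t)))%:E) ?lee_fin//.
rewrite /Rintegral fineK; last exact: integrable_fin_num ik.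
apply: ae_eq_integral.
- exact: measurable_itvL.
- apply: (measurableT_comp (@abse_measurable R setT)).
  by apply/measurable_EFinP; exact: measurable_funS mfg.
- exact: measurable_int ik.
- apply: filterS gk => x gx /(sub_itv Ia Ib) Ix /=.
  by rewrite gx// !normrM normfV (gtr0_norm (V0 Ix)).
Qed.

Lemma dual_le f N N' : measurable_fun [set: T] f -> loc_int c d f ->
  (forall x, I x -> prim c (fun t => `|f t|) x <= N' * V x) ->
  (forall x, I x -> `|prim c f x| <= N * V x) ->
  `|\int[mu]_(t in (I : set T)) (f t * g t)| <= N * (3 * S + B).
Proof.
move=> mf lf fN' fN.
have intfg := dual_integrable mf lf fN'.
apply: (Rintegral_exhaustion cd intfg) => a b Ia Ib ab.
have mab : measurable (`[a, b[%classic : set T) by exact: measurable_itvL.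
have [M kM] := bv_bounded cd kp pS.
rewrite (itv_ae_eq Ia Ib (integrableS mI mab (sub_itv Ia Ib) intfg)
  (quotient_integrable v0 lv V0 kp kM lf Ia Ib ab)).
  exact: itv_dual_le.
by apply: filterS gk => x gx Ix; rewrite gx.
Qed.

End estimate.
End dual_estimate.

(** * Real-valued versions of extended functions, and the two norms *)

Section real_versions.
Context {R : realType}.
Local Notation T := (lebesgueR R).
Local Notation mu := (leb R).
Variables (c d : \bar R) (cd : (c < d)%E).
Local Notation I := (oitv c d).
Local Open Scope ereal_scope.

Let mI : measurable (I : set T). Proof. exact: measurable_oitvL. Qed.

Lemma real_version (f : T -> \bar R) : measurable_fun I f ->
  {ae mu, forall x : T, I x -> f x \is a fin_num} ->
  exists2 f0 : T -> R, measurable_fun [set: T] f0 &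
    {ae mu, forall x : T, I x -> f x = (f0 x)%:E}.
Proof.
move=> mf ff; exists (fine \o (f \_ I)).
  apply: (measurableT_comp (@fine_measurable R setT measurableT)).
  exact/(measurable_restrictT _ mI).
by apply: filterS ff => x fx Ix; rewrite /= patchE mem_set// fineK// fx.
Qed.

Lemma L1loc_fin (f : T -> \bar R) : L1loc c d f ->
  {ae mu, forall x : T, I x -> f x \is a fin_num}.
Proof.
move=> [mf lf]; apply: (ae_exhaustion cd (P := fun x => f x \is a fin_num)) => a b Ia Ib ab.
have mb : measurable (oitv c b%:E) by exact: measurable_oitvL.
have intf : mu.-integrable (oitv c b%:E) f.
  apply/integrableP; split; last exact: lf.
  exact: measurable_funS mI (oitv_sub Ib) mf.
apply: filterS (integrable_ae mb intf) => x fx /andP[ax xb]; apply: fx.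
apply/andP; split; last by rewrite lte_fin.
by rewrite (lt_le_trans (andP Ia).1)// lee_fin.
Qed.

Section version.
Variables (f : T -> \bar R) (f0 : T -> R).
Hypotheses (mf : measurable_fun I f) (mf0 : measurable_fun [set: T] f0).
Hypothesis ff0 : {ae mu, forall x : T, I x -> f x = (f0 x)%:E}.

Lemma version_abs : {ae mu, forall x : T, I x -> `|f x| = (Num.norm (f0 x))%:E}.
Proof. by apply: filterS ff0 => x fx Ix; rewrite fx. Qed.

Lemma version_integral (D : set T) : measurable D -> D `<=` I ->
  \int[mu]_(t in D) f t = \int[mu]_(t in D) (f0 t)%:E.
Proof.
move=> mD DI; apply: ae_eq_integral.
- exact: mD.
- exact: measurable_funS mI DI mf.
- by apply/measurable_EFinP; exact: measurable_funTS mf0.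
- by apply: filterS ff0 => x fx /DI.
Qed.

End version.

Lemma L1loc_version (f : T -> \bar R) : L1loc c d f ->
  exists f0 : T -> R, [/\ measurable_fun [set: T] f0, loc_int c d f0 &
    {ae mu, forall x : T, I x -> f x = (f0 x)%:E}].
Proof.
move=> lf; have [f0 mf0 ff0] := real_version lf.1 (L1loc_fin lf).
exists f0; split => // x Ix; apply/integrableP; split.
  by apply/measurable_EFinP; exact: measurable_funTS mf0.
have mfa : measurable_fun I (fun x => `|f x|).
  exact: (measurableT_comp (@abse_measurable R setT) lf.1).
have mf0a : measurable_fun [set: T] (fun x => Num.norm (f0 x)).
  exact: (measurableT_comp (@normr_measurable R setT) mf0).
have := lf.2 _ Ix.
by rewrite (version_integral mfa mf0a (version_abs ff0) (measurable_oitvL c x%:E) (oitv_sub Ix)).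
Qed.

Lemma version_prim (f : T -> \bar R) (f0 : T -> R) : measurable_fun I f ->
  measurable_fun [set: T] f0 -> loc_int c d f0 ->
  {ae mu, forall x : T, I x -> f x = (f0 x)%:E} ->
  forall x, I x -> \int[mu]_(t in oitv c x%:E) f t = (prim c f0 x)%:E /\
    \int[mu]_(t in oitv c x%:E) `|f t| = (prim c (fun t => Num.norm (f0 t)) x)%:E.
Proof.
move=> mf mf0 lf0 ff0 x Ix.
have mx : measurable (oitv c x%:E) by exact: measurable_oitvL.
have mfa : measurable_fun I (fun x => `|f x|).
  exact: (measurableT_comp (@abse_measurable R setT) mf).
have mf0a : measurable_fun [set: T] (fun x => Num.norm (f0 x)).
  exact: (measurableT_comp (@normr_measurable R setT) mf0).
rewrite (version_integral mf mf0 ff0 mx (oitv_sub Ix)).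
rewrite (version_integral mfa mf0a (version_abs ff0) mx (oitv_sub Ix)).
split; rewrite /prim /Rintegral fineK//; first exact: integrable_fin_num (lf0 _ Ix).
exact: integrable_fin_num (loc_int_abs lf0 Ix).
Qed.

Lemma leb_setT_gt0 : 0 < mu [set: T].
Proof.
apply: (@lt_le_trans _ _ (mu `[0%R, 1%R[%classic)).
  by rewrite (leb_itvco (@ler01 R)) lte_fin subr0 ltr01.
by apply: le_measure; rewrite ?inE//; exact: measurable_itvL.
Qed.

(** When Y is 0 its inverse is infinite, which forces X to be 0. As X is
    nonnegative A is too, so that Y can be replaced by n. *)
Lemma divide_norm_le (X : R) (Y : \bar R) (A n : R) : (0 <= X)%R -> (0 <= n)%R ->
  0 <= Y <= n%:E -> X%:E / Y <= A%:E -> (X <= A * n)%R.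
Proof.
move=> X0 n0 /andP[Y0 Yn]; have [y Yy] : exists y, Y = y%:E.
  by move: Y0 Yn; case: Y => [y| |]//; exists y.
move: Y0 Yn; rewrite {}Yy !lee_fin => y0 yn.
move: y0; rewrite le_eqVlt => /predU1P[<-|y0].
  rewrite inver eqxx; move: X0; rewrite le_eqVlt => /predU1P[<- XA|X0].
    move: XA; rewrite mul0e lee_fin => A0; exact: mulr_ge0.
  by rewrite gt0_muley ?lte_fin.
rewrite inver gt_eqF// -EFinM lee_fin ler_pdivrMr// => XA.
rewrite (le_trans XA)// ler_wpM2l//.
rewrite leNgt; apply/negP => A0; have : (A * y < 0)%R by rewrite nmulr_rlt0.
by move: (le_trans X0 XA); rewrite leNgt => /negP.
Qed.

Lemma le_divide_norm (X n C : R) : (0 <= X)%R -> (0 <= n)%R -> (0 <= C)%R ->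
  (X <= n * C)%R -> X%:E / n%:E <= C%:E.
Proof.
move=> X0 n0 C0; move: n0; rewrite le_eqVlt => /predU1P[<-|n0].
  rewrite mul0r => X0'; have -> : X = 0%R by apply/eqP; rewrite eq_le X0'.
  by rewrite mul0e lee_fin.
by move=> XnC; rewrite inver gt_eqF// -EFinM lee_fin ler_pdivrMr// mulrC.
Qed.

Section weight.
Variables (v : T -> \bar R) (w : R -> R) (v0 : T -> R).
Hypotheses (v00 : forall t, (0 <= v0 t)%R) (mv0 : measurable_fun [set: T] v0).
Hypothesis lv0 : loc_int c d v0.
Local Notation V := (prim c v0).
Hypothesis V0 : forall x, I x -> (0 < V x)%R.
Hypothesis wV : forall x, I x -> w x = (V x)^-1%R.

Section function.
Variables (f : T -> \bar R) (f0 : T -> R).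
Hypotheses (mf : measurable_fun I f) (mf0 : measurable_fun [set: T] f0).
Hypothesis lf0 : loc_int c d f0.
Hypothesis ff0 : {ae mu, forall x : T, I x -> f x = (f0 x)%:E}.

Let wle x r N : I x -> ((w x)%:E * r%:E <= N%:E) = (r <= N * V x)%R.
Proof.
by move=> Ix; rewrite wV// -EFinM lee_fin mulrC ler_pdivrMr// V0.
Qed.

(** An essential bound of w int |f| is a bound at every point, by continuity
    of the primitives. *)
Lemma Cs_normP (N : R) : (0 <= N)%R -> Cs_norm c d w f <= N%:E <->
  forall x, I x -> (prim c (fun t => Num.norm (f0 t)) x <= N * V x)%R.
Proof.
move=> N0; have lf0a := loc_int_abs lf0.
have p0 x : (0 <= prim c (fun t => Num.norm (f0 t)) x)%R by exact: prim_ge0.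
split=> [/ess_supP fN x Ix|fN].
  rewrite -[leLHS]ger0_norm//; move: x Ix; apply: (prim_ae_le lv0 lf0a N0).
  apply: filterS fN => y /= fy Iy; rewrite ger0_norm//.
  move: fy; rewrite patchE mem_set// (version_prim mf mf0 lf0 ff0 Iy).2.
  by rewrite wle.
apply/ess_supP; apply: aeW => x /=; rewrite patchE.
case: ifPn => [/set_mem Ix|_]; last by rewrite lee_fin.
by rewrite (version_prim mf mf0 lf0 ff0 Ix).2 wle// fN.
Qed.

Lemma Ch_normP (N : R) : (0 <= N)%R -> Ch_norm c d w f <= N%:E <->
  forall x, I x -> (Num.norm (prim c f0 x) <= N * V x)%R.
Proof.
move=> N0; have wabs x : I x -> `|(w x)%:E * (prim c f0 x)%:E| =
    (w x)%:E * (Num.norm (prim c f0 x))%:E.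
  move=> Ix; rewrite abseM; congr (_ * _); rewrite /= ger0_norm// wV//.
  by rewrite invr_ge0 ltW// V0.
split=> [/ess_supP fN|fN].
  apply: (prim_ae_le lv0 lf0 N0).
  apply: filterS fN => y /= fy Iy; move: fy.
  by rewrite patchE mem_set// (version_prim mf mf0 lf0 ff0 Iy).1 wabs// wle.
apply/ess_supP; apply: aeW => x /=; rewrite patchE.
case: ifPn => [/set_mem Ix|_]; last by rewrite lee_fin.
by rewrite (version_prim mf mf0 lf0 ff0 Ix).1 wabs// wle// fN.
Qed.

Lemma Ch_norm_ge0 : 0 <= Ch_norm c d w f.
Proof.
apply: ess_sup_gee; first exact: leb_setT_gt0.
by apply: aeW => x; rewrite patchE; case: ifPn.
Qed.

Lemma Cs_norm_ge0 : 0 <= Cs_norm c d w f.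
Proof.
apply: ess_sup_gee; first exact: leb_setT_gt0.
apply: aeW => x; rewrite patchE; case: ifPn => // /set_mem Ix.
by rewrite mule_ge0 ?integral_ge0// lee_fin wV// invr_ge0 ltW// V0.
Qed.

Lemma cesaro_bounded_Cs : cesaro_bounded c d v0 f0 -> Cs c d w f.
Proof.
move=> [_ _ [N fN]]; split.
  split => // x Ix.
  by rewrite (version_prim mf mf0 lf0 ff0 Ix).2 ltry.
apply: (@le_lt_trans _ _ (Num.norm N)%:E); last exact: ltry.
apply/Cs_normP => // x Ix; rewrite (le_trans (fN x Ix))// ler_wpM2r ?ler_norm//.
by rewrite ltW// V0.
Qed.

Lemma Cs_cesaro_bounded : Cs c d w f -> exists2 N, (0 <= N)%R &
  forall x, I x -> (prim c (fun t => Num.norm (f0 t)) x <= N * V x)%R.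
Proof.
move=> [_ fN]; exists (fine (Cs_norm c d w f)); first by rewrite fine_ge0// Cs_norm_ge0.
apply/Cs_normP; first by rewrite fine_ge0// Cs_norm_ge0.
by rewrite fineK// ge0_fin_numE// Cs_norm_ge0.
Qed.

End function.
End weight.
End real_versions.

(** * The weak associated space *)

Section weight_version.
Context {R : realType}.
Local Notation T := (lebesgueR R).
Local Notation mu := (leb R).
Local Open Scope ereal_scope.

(** The limit at d is taken in the extended line and may be a limit at
    infinity; in all cases it provides real points of the interval. *)
Lemma near_endpoint (c d : \bar R) (U : set (\bar R)) : c < d ->
  within [set b | b < d] (nbhs d) U -> exists2 b : R, oitv c d b & U b%:E.
Proof.
move=> cd; have [x ca] : exists2 x : R, c < x%:E & x%:E < d.
  have [a [b [Iab _ _ _ _]]] := oitv_exhaustion cd.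
  by have /andP[] := (Iab 0%N).1; exists (a 0%N).
case: d cd => [d'| |] _ xd.
- move: xd; rewrite lte_fin => xd dU.
  have /nbhs_ballP[e /= e0 eU] : nbhs d' (fun r : R => (r < d')%R -> U r%:E).
    exact: dU.
  pose b := Num.max x (d' - e / 2)%R.
  have e20 : (0 < e / 2)%R by rewrite divr_gt0.
  have bd : (b < d')%R by rewrite /b gt_max xd ltrBlDr ltrDl.
  have bl : (d' - e / 2 <= b)%R by rewrite /b le_max lexx orbT.
  exists b.
    by rewrite /oitv/= lte_fin bd andbT (lt_le_trans ca)// lee_fin /b le_max lexx.
  have db : ball d' e b.
    rewrite /ball/= gtr0_norm ?subr_gt0//.
    have : (e / 2 < e)%R by rewrite ltr_pdivrMr// ltr_pMr// ltr1n.
    lra.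
  exact: eU db bd.
- move=> [M [Mr MU]]; pose b := (Num.max M x + 1)%R.
  have Mb : (M < b)%R by rewrite /b ltr_pwDr// le_max lexx.
  have xb : (x < b)%R by rewrite /b ltr_pwDr// le_max lexx orbT.
  exists b; first by rewrite /oitv/= ltry andbT (lt_trans ca)// lte_fin.
  by apply: MU; rewrite /= ?lte_fin ?ltry.
- by move: xd; rewrite ltNge leNye.
Qed.

Variables (c d : \bar R) (cd : c < d).
Local Notation I := (oitv c d).
Variables (v : T -> \bar R) (w : R -> R).

(** The absolute value of a real version of v is nonnegative everywhere, and
    not just almost everywhere, which spares conditions on points in the
    rest of the proof. *)
Lemma weight_version : (\forall x \ae mu, I x -> 0 < v x) -> L1loc c d v ->
  \int[mu]_(t in oitv c b) v t @[b --> within [set b | b < d] (nbhs d)] --> +oo ->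
  (forall x, I x -> (w x)%:E = (\int[mu]_(t in oitv c x%:E) v t)^-1) ->
  exists v0 : T -> R, [/\ (forall t, (0 <= v0 t)%R) /\ measurable_fun [set: T] v0,
    loc_int c d v0, {ae mu, forall x : T, I x -> v x = (v0 x)%:E},
    (forall x, I x -> (0 < prim c v0 x)%R /\ w x = (prim c v0 x)^-1%R) &
    forall r, exists2 b, I b & (r <= prim c v0 b)%R].
Proof.
move=> vpos lv vy wv; have [v1 [mv1 lv1 vv1]] := L1loc_version cd lv.
pose v0 (t : T) := Num.norm (v1 t).
have v00 t : (0 <= v0 t)%R by exact: normr_ge0.
have mv0 : measurable_fun [set: T] v0.
  exact: (measurableT_comp (@normr_measurable R setT) mv1).
have lv0 : loc_int c d v0 by exact: loc_int_abs.
have vv0 : {ae mu, forall x : T, I x -> v x = (v0 x)%:E}.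
  apply: filterS2 vpos vv1 => x vx v1x Ix; move: (vx Ix); rewrite v1x// lte_fin => h.
  by rewrite /v0 gtr0_norm.
have pv x (Ix : I x) := (version_prim lv.1 mv0 lv0 vv0 Ix).1.
exists v0; split => //.
  move=> x Ix; have := wv x Ix; rewrite pv//.
  have : (0 <= prim c v0 x)%R by exact: prim_ge0.
  rewrite le_eqVlt => /predU1P[<-|V0]; first by rewrite inver eqxx.
  by rewrite inver gt_eqF// => -[->].
move=> r; have /cvgeyPge/(_ r) H := vy.
have [b Ib rb] := near_endpoint cd H.
by exists b => //; move: rb; rewrite /= pv.
Qed.

End weight_version.

Section duality.
Context {R : realType}.
Local Notation T := (lebesgueR R).
Local Notation mu := (leb R).
Local Open Scope ereal_scope.
Variables (c d : \bar R) (cd : c < d).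
Local Notation I := (oitv c d).
Variables (v : T -> \bar R) (w : R -> R) (v0 : T -> R).
Hypothesis mv : measurable_fun I v.
Hypothesis vpos : \forall x \ae mu, I x -> 0 < v x.
Hypotheses (v00 : forall t, (0 <= v0 t)%R) (mv0 : measurable_fun [set: T] v0).
Hypothesis lv0 : loc_int c d v0.
Hypothesis vv0 : {ae mu, forall x : T, I x -> v x = (v0 x)%:E}.
Local Notation V := (prim c v0).
Hypothesis V0 : forall x, I x -> (0 < V x)%R.
Hypothesis wV : forall x, I x -> w x = (V x)^-1%R.
Hypothesis Vy : forall r, exists2 b, I b & (r <= V b)%R.

Let mI : measurable (I : set T). Proof. exact: measurable_oitvL. Qed.

Let I_in a b x : I a -> I b -> (a <= x <= b)%R -> I x.
Proof. by move=> Ia Ib; exact: (oitv_interval Ia Ib). Qed.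

Variable g : T -> \bar R.
Hypothesis mg : measurable_fun I g.

Local Notation Z := (Cs c d w).
Local Notation N := (Ch_norm c d w).

(** The weight itself has primitive V, of norm 1. *)
Lemma weight_Cs : Z v.
Proof.
apply: (cesaro_bounded_Cs lv0 V0 wV mv mv0 lv0 vv0).
exact: (weight_bounded v00 lv0 mv0).
Qed.

(** v g is finite almost everywhere and v does not vanish. *)
Lemma finite_dual : mu.-integrable I (fun x => v x * g x) ->
  exists2 g0 : T -> R, measurable_fun [set: T] g0 &
    {ae mu, forall x : T, I x -> g x = (g0 x)%:E}.
Proof.
move=> ivg; apply: real_version => //.
apply: filterS3 vpos vv0 (integrable_ae mI ivg) => x vx v0x vgx Ix.
move: (vx Ix) (vgx Ix); rewrite v0x// lte_fin; case: (g x) => [//| |] v0p.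
  by rewrite gt0_muley ?lte_fin.
by rewrite gt0_muleNy ?lte_fin.
Qed.

Section version.
Variable g0 : T -> R.
Hypothesis mg0 : measurable_fun [set: T] g0.
Hypothesis gg0 : {ae mu, forall x : T, I x -> g x = (g0 x)%:E}.

Lemma product_version (f : T -> \bar R) (f0 : T -> R) : measurable_fun I f ->
  measurable_fun [set: T] f0 -> {ae mu, forall x : T, I x -> f x = (f0 x)%:E} ->
  {ae mu, forall x : T, I x -> f x * g x = (f0 x * g0 x)%:E} /\
  (mu.-integrable I (fun x => f x * g x) <->
   mu.-integrable I (EFin \o (fun x => f0 x * g0 x)%R)).
Proof.
move=> mf mf0 ff0.
have E : {ae mu, forall x : T, I x -> f x * g x = (f0 x * g0 x)%:E}.
  by apply: filterS2 ff0 gg0 => x fx gx Ix; rewrite fx// gx// EFinM.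
split => //.
have mfg : measurable_fun I (fun x => f x * g x) by exact: emeasurable_funM.
have mfg0 : measurable_fun [set: T] (fun x => f0 x * g0 x)%R by exact: measurable_funM.
have Ea : \int[mu]_(x in I) `|f x * g x| = \int[mu]_(x in I) `|(f0 x * g0 x)%:E|.
  apply: ae_eq_integral.
  - exact: mI.
  - exact: (measurableT_comp (@abse_measurable R setT) mfg).
  - apply: (measurableT_comp (@abse_measurable R setT)).
    by apply/measurable_EFinP; exact: measurable_funTS mfg0.
  - by apply: filterS E => x fx Ix; rewrite fx.
split=> /integrableP[_ h]; apply/integrableP; split.
- by apply/measurable_EFinP; exact: measurable_funTS mfg0.
- by move: h; rewrite Ea.
- exact: mfg.
- by rewrite Ea.
Qed.

Lemma product_integral (f : T -> \bar R) (f0 : T -> R) : measurable_fun I f ->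
  measurable_fun [set: T] f0 -> {ae mu, forall x : T, I x -> f x = (f0 x)%:E} ->
  mu.-integrable I (EFin \o (fun x => f0 x * g0 x)%R) ->
  \int[mu]_(x in I) (f x * g x) = (\int[mu]_(x in I) (f0 x * g0 x)%R)%:E.
Proof.
move=> mf mf0 ff0 i0; have [E _] := product_version mf mf0 ff0.
rewrite /Rintegral fineK; last exact: integrable_fin_num i0.
apply: ae_eq_integral.
- exact: mI.
- exact: emeasurable_funM.
- exact: measurable_int i0.
- by apply: filterS E => x fx Ix; rewrite fx.
Qed.

Section necessary.
Hypothesis wg : weak_associated I Z N g.
Let A := fine (weak_associated_norm I Z N g).

(** The supremum is not over the empty set, since v is in the space and is
    not the zero class. *)
Lemma weak_norm_fin : weak_associated_norm I Z N g = A%:E /\ (0 <= A)%R.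
Proof.
have [_ _ Wy] := wg.
have W0 : 0 <= weak_associated_norm I Z N g.
  have vn0 : ~ (v = cst 0 %[ae mu in I]).
    move=> ve0.
    have [x Ix [vx /= ve]] : exists2 x : R, I x & 0 < v x /\ v x = cst 0 x.
      apply: (ae_oitv_exists cd (P := fun x => 0 < v x /\ v x = cst 0 x)).
      by apply: filterS2 vpos ve0 => x h1 h2 Ix; split; [exact: h1|exact: h2].
    by move: vx; rewrite ve ltxx.
  apply: (@le_trans _ _ (`|\int[mu]_(x in I) (v x * g x)| / N v)).
    by rewrite mule_ge0// inve_ge0; apply: Ch_norm_ge0.
  apply: ereal_sup_ubound; exists v => //; split => //; exact: weight_Cs.
split; last by rewrite /A fine_ge0.
by rewrite /A fineK// ge0_fin_numE.
Qed.

Lemma weak_dual f0 : cesaro_bounded c d v0 f0 ->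
  mu.-integrable I (EFin \o (fun x => f0 x * g0 x)%R).
Proof.
move=> bf; have [mf0 lf0 _] := bf.
have mf : measurable_fun I (EFin \o f0) by apply/measurable_EFinP; exact: measurable_funTS mf0.
have ff0 : {ae mu, forall x : T, I x -> (EFin \o f0) x = (f0 x)%:E} by exact: aeW.
have Zf := cesaro_bounded_Cs lv0 V0 wV mf mf0 lf0 ff0 bf.
have [_ + _] := wg => /(_ _ Zf).
by move/(product_version mf mf0 ff0).2.
Qed.

(** The supremum that defines the dual norm leaves out the zero class, for
    which the pairing vanishes. *)
Lemma weak_dual_le f0 (n : R) : cesaro_bounded c d v0 f0 -> (0 <= n)%R ->
  (forall x, I x -> (Num.norm (prim c f0 x) <= n * V x)%R) ->
  (Num.norm (\int[mu]_(t in I) (f0 t * g0 t)) <= A * n)%R.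
Proof.
move=> bf n0 fn; have [mf0 lf0 _] := bf.
have mf : measurable_fun I (EFin \o f0) by apply/measurable_EFinP; exact: measurable_funTS mf0.
have ff0 : {ae mu, forall x : T, I x -> (EFin \o f0) x = (f0 x)%:E} by exact: aeW.
have Zf := cesaro_bounded_Cs lv0 V0 wV mf mf0 lf0 ff0 bf.
have [WA A0] := weak_norm_fin.
have PI := product_integral mf mf0 ff0 (weak_dual bf).
have [fz|fnz] := pselect (EFin \o f0 = cst 0 %[ae mu in I]).
  have -> : (\int[mu]_(t in I) (f0 t * g0 t) = 0)%R.
    apply: EFin_inj; rewrite -PI.
    transitivity (\int[mu]_(x in I) (0 : \bar R)); last exact: integral0.
    apply: ae_eq_integral.
    - exact: mI.
    - exact: emeasurable_funM.
    - exact: measurable_cst.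
    - by apply: filterS fz => x fx Ix; rewrite fx//= mul0e.
  by rewrite normr0 mulr_ge0.
apply: (@divide_norm_le _ _ (N (EFin \o f0))) => //.
  apply/andP; split; first exact: Ch_norm_ge0.
  exact/(Ch_normP lv0 V0 wV mf mf0 lf0 ff0 n0).
rewrite -WA; apply: ereal_sup_ubound; exists (EFin \o f0) => //=.
by rewrite PI.
Qed.

Lemma weak_weighted_integral : mu.-integrable I (EFin \o (fun t => v0 t * Num.norm (g0 t))%R) /\
  (\int[mu]_(t in I) (v0 t * Num.norm (g0 t)) <= A)%R.
Proof. exact: (weighted_dual_le v00 lv0 mv0 mg0 weak_dual weak_dual_le). Qed.

Lemma weak_average_bvar dl : (0 < dl)%R -> bvar (shrunk c d dl)
  (fun y => dl^-1 * \int[mu]_(t in `[y, y + dl[) (V t * g0 t))%R (2 * A).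
Proof. by move=> dl0; exact: (average_bvar v00 lv0 mv0 V0 dl0 mg0 weak_dual weak_dual_le). Qed.

Lemma weak_locally_integrable a b : I a -> I b -> (a <= b)%R ->
  mu.-integrable (`[a, b[%classic : set T) (EFin \o (fun t => V t * g0 t)%R).
Proof.
move=> Ia Ib; rewrite le_eqVlt => /predU1P[->|ab].
  by rewrite set_itvco0; exact: integrable_set0.
have ab0 : (0 < b - a)%R by rewrite subr_gt0.
have sa : shrunk c d (b - a) a by split => //; rewrite addrC subrK.
have := dual_locally_integrable v00 lv0 mv0 V0 ab0 weak_dual sa.
by rewrite [(a + _)%R]addrC subrK.
Qed.

Lemma weak_representative : exists k : R -> R, bvar I k (2 * A) /\
  {ae mu, forall x : T, I x -> k x = (V x * g0 x)%R}.
Proof.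
exact: (bv_representative cd weak_locally_integrable weak_average_bvar).
Qed.

End necessary.

Section sufficient.
Variables (k p : R -> R) (S B : R).
Hypotheses (kp : dominated I k p) (pS : forall x, I x -> (0 <= p x <= S)%R).
Hypothesis kg : {ae mu, forall x : T, I x -> k x = (V x * g0 x)%R}.
Hypothesis intvg : mu.-integrable I (EFin \o (fun t => v0 t * Num.norm (g0 t))%R).
Hypothesis vgB : (\int[mu]_(t in I) (v0 t * Num.norm (g0 t)) <= B)%R.

Let gk : {ae mu, forall x : T, I x -> g0 x = (k x / V x)%R}.
Proof.
by apply: filterS kg => x kx Ix; rewrite kx// mulrC mulKf// gt_eqF// V0.
Qed.

Let SB0 : (0 <= 3 * S + B)%R.
Proof.
have [a [b [Iab _ _ _ _]]] := oitv_exhaustion cd.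
have S0 : (0 <= S)%R by have /andP[/le_trans] := pS (Iab 0%N).1; exact.
rewrite addr_ge0 ?mulr_ge0// (le_trans _ vgB)// Rintegral_ge0// => t _.
by rewrite mulr_ge0.
Qed.

(** [dual_le] with n the norm of f; that f g is integrable comes from the
    finite Cs norm of f. *)
Lemma weak_associated_suff : weak_associated I Z N g /\
  weak_associated_norm I Z N g <= (3 * S + B)%:E.
Proof.
have Zf f : Z f -> mu.-integrable I (fun x => f x * g x) /\
    `|\int[mu]_(x in I) (f x * g x)| / N f <= (3 * S + B)%:E.
  move=> Zf; have [f0 [mf0 lf0 ff0]] := L1loc_version cd Zf.1.
  have mf := Zf.1.1.
  have [n' n'0 fn'] := Cs_cesaro_bounded lv0 V0 wV mf mf0 lf0 ff0 Zf.
  have i0 := dual_integrable cd v00 lv0 V0 Vy kp pS gk mg0 intvg vgB mf0 lf0 fn'.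
  split; first exact/(product_version mf mf0 ff0).2.
  rewrite (product_integral mf mf0 ff0 i0).
  have N0 : 0 <= N f := Ch_norm_ge0 c d w f.
  have Nn' : N f <= n'%:E.
    apply/(Ch_normP lv0 V0 wV mf mf0 lf0 ff0 n'0) => x Ix.
    apply: le_trans (fn' _ Ix).
    exact: le_normr_Rintegral (measurable_oitvL _ _) (lf0 _ Ix).
  have Nfin : N f \is a fin_num by rewrite ge0_fin_numE// (le_lt_trans Nn')// ltry.
  pose n := fine (N f).
  have n0 : (0 <= n)%R by exact: fine_ge0.
  have fn x : I x -> (Num.norm (prim c f0 x) <= n * V x)%R.
    move: x; apply/(Ch_normP lv0 V0 wV mf mf0 lf0 ff0 n0).
    by rewrite fineK.
  have := dual_le cd v00 lv0 V0 Vy kp pS gk mg0 intvg vgB mf0 lf0 fn' fn.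
  by rewrite -[N f]fineK//; exact: le_divide_norm.
have Wle : weak_associated_norm I Z N g <= (3 * S + B)%:E.
  by apply: ge_ereal_sup => _ [f [Zff _] <-]; exact: (Zf f Zff).2.
split => //; split => //.
  by move=> f /Zf[].
exact: le_lt_trans Wle (ltry _).
Qed.

Local Notation L := (fun t : T => Lnorm mu +oo (g \_ (coitv t d))).
Local Notation H := (tail_sup c d (fun x => k x / V x)%R).

Let Lle t : I t -> 0 <= L t <= (H t)%:E.
Proof.
move=> It; rewrite Lnorm_ge0/= Lnorm.unlock leb_setT_gt0.
have kS x : I x -> (Num.norm (k x) <= S)%R.
  exact: (rep_bounded cd v00 lv0 V0 Vy kp pS gk intvg vgB).
apply/ess_supP; apply: filterS2 gg0 gk => x gx g0x /=.
rewrite patchE; case: ifPn => [/set_mem|_]; last first.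
  by rewrite abse0 lee_fin; apply: (tail_sup_ge0 v00 lv0 V0 kS).
rewrite /coitv/= lee_fin => /andP[tx xd].
have Ix : I x.
  by apply/andP; split => //; rewrite (lt_le_trans (andP It).1)// lee_fin.
by rewrite gx// g0x// lee_fin; exact: (tail_sup_ge v00 lv0 V0 kS).
Qed.

Let L_nonincreasing s t : I s -> I t -> (s <= t)%R -> L t <= L s.
Proof.
move=> Is It st; rewrite Lnorm.unlock leb_setT_gt0.
apply: le_ess_sup; apply: aeW => x /=; rewrite !patchE.
case: ifPn => [/set_mem|_]; last by rewrite abse0 abse_ge0.
rewrite /coitv/= lee_fin => /andP[tx xd].
by rewrite mem_set//= lee_fin xd andbT (le_trans st).
Qed.

(** The essential supremum of |g| over [t, d) is at most the tail supremum
    of |k| / V, whose integral against v is finite. It is a monotone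
    function of t, hence measurable. *)
Lemma lnorm_integral_lty : \int[mu]_(t in I) (v t * L t) < +oo.
Proof.
have kS x : I x -> (Num.norm (k x) <= S)%R.
  exact: (rep_bounded cd v00 lv0 V0 Vy kp pS gk intvg vgB).
pose l t := fine (L t).
have LE t : I t -> L t = (l t)%:E.
  move=> It; have /andP[L0 LH] := Lle It.
  by rewrite /l fineK// ge0_fin_numE// (le_lt_trans LH)// ltry.
have l0 t : I t -> (0 <= l t <= H t)%R.
  by move=> It; rewrite -!lee_fin -LE//; exact: Lle.
have lni s t : I s -> I t -> (s <= t)%R -> (l t <= l s)%R.
  by move=> Is It st; rewrite -lee_fin -!LE//; exact: L_nonincreasing.
have [a [b [Iab sub nd UI]]] := exhaustion_co cd.
have ml_itv x y : I x -> I y -> (x <= y)%R -> measurable_fun (`[x, y[%classic : set T) (l : T -> R).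
  move=> Ix Iy xy.
  have hI z : `[x, y[%classic z -> I z.
    by rewrite /= in_itv/= => /andP[xz zy]; apply: (I_in Ix Iy); rewrite xz ltW.
  apply: (@dominated_measurable _ _ l (fun z => - l z)%R (- l x)%R 0%R).
  - exact: measurable_itvL.
  - move=> r s /hI Ir /hI Is rs.
    rewrite ler0_norm ?subr_le0; last exact: lni.
    by rewrite opprB opprK addrC.
  - move=> r xr; have Ir := hI _ xr; rewrite lerN2 oppr_le0.
    have /andP[-> _] := l0 _ Ir; rewrite andbT lni//.
    by move: xr; rewrite /= in_itv/= => /andP[].
have ml : measurable_fun (I : set T) (l : T -> R).
  rewrite -UI; apply/measurable_fun_bigcup => n; first exact: measurable_itvL.
  by case: (Iab n) => Ia Ib ab; exact: ml_itv.
have mvl : measurable_fun (I : set T) (fun t => v0 t * l t)%R.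
  by apply: measurable_funM => //; exact: measurable_funTS mv0.
have mL : measurable_fun (I : set T) L.
  apply: (@eq_measurable_fun _ _ _ _ _ (EFin \o l)).
    by move=> t /set_mem It; rewrite LE.
  exact/measurable_EFinP.
rewrite (_ : integral _ _ _ = \int[mu]_(t in I) (v0 t * l t)%:E); last first.
  apply: ae_eq_integral.
  - exact: mI.
  - exact: emeasurable_funM.
  - exact/measurable_EFinP.
  - by apply: filterS vv0 => x vx Ix; rewrite vx// LE// EFinM.
apply: (@le_lt_trans _ _ (S + S + B)%:E); last exact: ltry.
apply: (ge0_integral_exhaustion cd).
- exact/measurable_EFinP.
- by move=> x Ix; rewrite lee_fin mulr_ge0//; have /andP[] := l0 _ Ix.
move=> x y Ix Iy xy.
have hI z : `[x, y[%classic z -> I z.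
  by rewrite /= in_itv/= => /andP[xz zy]; apply: (I_in Ix Iy); rewrite xz ltW.
have iH := tail_sup_integrable v00 lv0 V0 kS Ix Iy xy.
have iHf := integrable_fin_num (measurable_itvL _) iH.
apply: (@le_trans _ _ (\int[mu]_(t in `[x, y[) (v0 t * H t))%R%:E).
  rewrite /Rintegral fineK//; apply: ge0_le_integral.
  - exact: measurable_itvL.
  - by move=> z /hI Iz; rewrite lee_fin mulr_ge0//; have /andP[] := l0 _ Iz.
  - by apply/measurable_EFinP; exact: measurable_funS mI hI mvl.
  - exact: measurable_int iH.
  - by move=> z /hI Iz; rewrite lee_fin ler_wpM2l//; have /andP[] := l0 _ Iz.
rewrite lee_fin (le_trans (tail_sup_integral_le v00 lv0 V0 kp kS Ix Iy xy))//.
have := weighted_quotient_le cd v00 lv0 V0 kp pS gk intvg vgB Ix Iy xy.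
move=> h; rewrite lerD// lerD2l.
by have /andP[? ?] := pS Ix; have /andP[? ?] := pS Iy; lra.
Qed.

End sufficient.
End version.
End duality.

(** * The duality theorem *)

Section representatives.
Context {R : realType}.
Local Notation T := (lebesgueR R).
Local Notation mu := (leb R).
Local Open Scope ereal_scope.
Variables (c d : \bar R) (cd : c < d).
Local Notation I := (oitv c d).
Variables (v : T -> \bar R) (w : R -> R) (v0 : T -> R).
Hypothesis mv : measurable_fun I v.
Hypothesis vpos : \forall x \ae mu, I x -> 0 < v x.
Hypotheses (v00 : forall t, (0 <= v0 t)%R) (mv0 : measurable_fun [set: T] v0).
Hypothesis lv0 : loc_int c d v0.
Hypothesis vv0 : {ae mu, forall x : T, I x -> v x = (v0 x)%:E}.
Local Notation V := (prim c v0).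
Hypothesis V0 : forall x, I x -> (0 < V x)%R.
Hypothesis wV : forall x, I x -> w x = (V x)^-1%R.
Hypothesis Vy : forall r, exists2 b, I b & (r <= V b)%R.
Variables (g : T -> \bar R) (g0 : T -> R).
Hypothesis mg : measurable_fun I g.
Hypothesis mg0 : measurable_fun [set: T] g0.
Hypothesis gg0 : {ae mu, forall x : T, I x -> g x = (g0 x)%:E}.

Let mI : measurable (I : set T). Proof. exact: measurable_oitvL. Qed.

Lemma L0class_version (k : R -> R) :
  L0class I (fun x => ((w x)^-1)%:E * g x) (EFin \o k) <->
  measurable_fun (I : set T) (k : T -> R) /\
  {ae mu, forall x : T, I x -> k x = (V x * g0 x)%R}.
Proof.
split=> -[mk kg]; split.
- exact/measurable_EFinP.
- apply: filterS2 kg gg0 => x kx gx Ix; apply: EFin_inj.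
  by have := kx Ix; rewrite /= gx// wV// invrK EFinM.
- exact/measurable_EFinP.
- apply: filterS2 kg gg0 => x kx gx Ix /=.
  by rewrite kx// gx// wV// invrK EFinM.
Qed.

Lemma weighted_integrable : mu.-integrable I (fun x => v x * g x) ->
  mu.-integrable I (EFin \o (fun t => v0 t * Num.norm (g0 t))%R).
Proof.
move=> /(product_version mg mg0 gg0 mv mv0 vv0).2 i0.
have := integrable_norm i0; apply: eq_integrable => // t _ /=.
by rewrite normrM ger0_norm.
Qed.

Lemma weighted_integral : mu.-integrable I (fun x => v x * g x) ->
  \int[mu]_(x in I) `|v x * g x| =
  (\int[mu]_(t in I) (v0 t * Num.norm (g0 t)))%R%:E.
Proof.
move=> ivg; have i1 := weighted_integrable ivg.
rewrite /Rintegral fineK; last exact: integrable_fin_num i1.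
have [E _] := product_version mg mg0 gg0 mv mv0 vv0.
apply: ae_eq_integral.
- exact: mI.
- exact: (measurableT_comp (@abse_measurable R setT) (emeasurable_funM mv mg)).
- exact: measurable_int i1.
- by apply: filterS E => x fx Ix; rewrite fx//= normrM ger0_norm.
Qed.

Lemma prim_measurable : measurable_fun (I : set T) (V : T -> R).
Proof.
have [a [b [Iab sub nd UI]]] := exhaustion_co cd.
rewrite -UI; apply/measurable_fun_bigcup => n; first exact: measurable_itvL.
have [Ia Ib ab] := Iab n.
have hI z : `[a n, b n[%classic z -> I z /\ (z <= b n)%R.
  rewrite /= in_itv/= => /andP[xz zy]; split; last exact: ltW.
  by apply: (oitv_interval Ia Ib); rewrite xz ltW.
apply: (@dominated_measurable _ _ V V 0%R (V (b n))).
- exact: measurable_itvL.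
- move=> x y /hI[Ix _] /hI[Iy _] xy.
  by rewrite ger0_norm// subr_ge0 (prim_nondecreasing v00 lv0).
- move=> x /hI[Ix xb].
  by rewrite (ltW (V0 Ix)) (prim_nondecreasing v00 lv0).
Qed.

End representatives.

(** Here A is the dual norm, B the integral of v |g| and S the total
    variation of the charge. *)
Lemma dual_constants {R : realFieldType} (A B S : R) : 0 <= B -> 0 <= S ->
  A <= 3 * S + B -> S <= 5 * (2 * A) -> B <= A ->
  3^-1 * A <= B + S /\ B + S <= 11 * A.
Proof. by move=> B0 S0 AS SA BA; split; lra. Qed.

Local Open Scope ereal_scope.

Theorem theorem3p6 (R : realType) :
  exists c1 c2 : R, (0 < c1)%R /\ (0 < c2)%R /\
  forall (c d : \bar R) (v : lebesgueR R -> \bar R) (w : R -> R)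
    (g : lebesgueR R -> \bar R),
  let I := oitv c d in
  let mu := leb R in
  c < d ->
  measurable_fun I v ->
  (\forall x \ae mu, I x -> 0 < v x) ->
  L1loc c d v ->
  \int[mu]_(t in oitv c b) v t @[b --> within [set b | b < d] (nbhs d)]
    --> +oo ->
  (forall x, I x -> (w x)%:E = (\int[mu]_(t in oitv c x%:E) v t)^-1) ->
  measurable_fun I g ->
  (weak_associated I (Cs c d w) (Ch_norm c d w) g <->
    [/\ mu.-integrable I (fun x => v x * g x),
        exists gt : R -> R,
          L0class I (fun x => ((w x)^-1)%:E * g x) (EFin \o gt) /\ BPV I gt &
        \int[mu]_(t in I) (v t * Lnorm mu +oo (g \_ (coitv t d))) < +oo]) /\
  (weak_associated I (Cs c d w) (Ch_norm c d w) g ->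
    forall gt : R -> R,
      L0class I (fun x => ((w x)^-1)%:E * g x) (EFin \o gt) -> BPV I gt ->
      let A := weak_associated_norm I (Cs c d w) (Ch_norm c d w) g in
      let B := \int[mu]_(x in I) `|v x * g x| +
               total_variation_charge (lambda_ I gt) I in
      c1%:E * A <= B /\ B <= c2%:E * A).
Proof.
exists (3^-1)%R, 11%R; split; first by rewrite invr_gt0.
split=> // c d v w g I mu cd mv vpos lv vy wv mg.
have [v0 [[v00 mv0] lv0 vv0 V0w Vy]] := weight_version cd vpos lv vy wv.
have V0 x (Ix : I x) := (V0w x Ix).1.
have wV x (Ix : I x) := (V0w x Ix).2.
have mI : measurable (I : set (lebesgueR R)) by exact: measurable_oitvL.
have wint : weak_associated I (Cs c d w) (Ch_norm c d w) g ->
    mu.-integrable I (fun x => v x * g x).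
  move=> [_ + _]; apply.
  exact: (weight_Cs mv v00 mv0 lv0 vv0 V0 wV).
split.
  split=> [wg|[ivg [gt [gt_class gt_bv]] _]].
    have ivg := wint wg.
    have [g0 mg0 gg0] := finite_dual vpos vv0 mg ivg.
    have [k [kA kg]] := weak_representative cd mv vpos v00 mv0 lv0 vv0 V0 wV mg mg0 gg0 wg.
    have [p [kp pS]] := bvar_dominated kA.
    have mk : measurable_fun (I : set (lebesgueR R)) (k : lebesgueR R -> R).
      by exact: (bv_measurable kp pS).
    have intvg := weighted_integrable mv v00 mv0 vv0 mg mg0 gg0 ivg.
    split => //.
      exists k; split; first by apply/(L0class_version wV gg0).
      by apply/BPVP; eexists; exact: kA.
    exact: (lnorm_integral_lty cd mv v00 mv0 lv0 vv0 V0 Vy gg0 kp pS kg intvg (lexx _)).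
  have [g0 mg0 gg0] := finite_dual vpos vv0 mg ivg.
  have [_ kg] := (L0class_version wV gg0 gt).1 gt_class.
  have [S /bvar_dominated[p [kp pS]]] := (BPVP _ _).1 gt_bv.
  have intvg := weighted_integrable mv v00 mv0 vv0 mg mg0 gg0 ivg.
  exact: (weak_associated_suff cd v00 lv0 V0 wV Vy mg mg0 gg0 kp pS kg intvg (lexx _)).1.
move=> wg gt gt_class gt_bv A B.
have ivg := wint wg.
have [g0 mg0 gg0] := finite_dual vpos vv0 mg ivg.
have [mgt kg] := (L0class_version wV gg0 gt).1 gt_class.
have [S /bvar_dominated[p [kp pS]]] := (BPVP _ _).1 gt_bv.
have [WA A0] := weak_norm_fin cd mv vpos v00 mv0 lv0 vv0 V0 wV wg.
set a := fine _ in WA A0.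
have [intvg vgA] := weak_weighted_integral cd mv vpos v00 mv0 lv0 vv0 V0 wV mg mg0 gg0 wg.
have E := weighted_integral mv v00 mv0 vv0 mg mg0 gg0 ivg.
have lam := lambda_is_lambda cd kp pS.
have [q [rq qtv]] := bvar_dominated (is_lambda_bvar lam).
have tvfin : total_variation_charge (lambda_ I gt) I \is a fin_num.
  exact: (total_variation_charge_fin _ (oitv_measurable c d)).
set tv := fine _ in qtv.
(* The right-limit function is a representative of V g too; its variation is
   bounded by that of the charge, whence the bound of the dual norm. *)
have rg : {ae mu, forall x : lebesgueR R, I x -> rlim gt x = (prim c v0 x * g0 x)%R}.
  by apply: filterS2 (rlim_ae cd kp pS) kg => x h1 h2 Ix; rewrite -h1// h2.
have low := (weak_associated_suff cd v00 lv0 V0 wV Vy mg mg0 gg0 rq qtv rg intvg (lexx _)).2.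
have mu_ : measurable_fun (I : set (lebesgueR R)) (fun x => prim c v0 x * g0 x)%R.
  apply: measurable_funM; first exact: (prim_measurable cd v00 lv0 V0).
  exact: measurable_funTS mg0.
(* Conversely the averages of V g bound the variation of the same function,
   hence the mass of the charge. *)
have rb : bvar I (rlim gt) (2 * a)%R.
  apply: (rlim_bvar cd kp pS mu_).
    by apply: filterS kg => x kx Ix; rewrite kx.
  move=> dl dl0.
  exact: (weak_average_bvar cd mv vpos v00 mv0 lv0 vv0 V0 wV mg mg0 gg0 wg dl0).
have [q' [rq' q'S]] := bvar_dominated rb.
have up := total_variation_lambda_le cd kp pS rq' q'S.
rewrite /A /B E; move: low up vgA.
rewrite WA -(fineK tvfin) -/tv -!EFinM -EFinD !lee_fin.
have b0 : (0 <= \int[mu]_(t in I) (v0 t * Num.norm (g0 t)))%R.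
  by apply: Rintegral_ge0 => t _; rewrite mulr_ge0.
have t0 : (0 <= tv)%R.
  have [b Ib _] := Vy 0%R.
  by have /andP[/le_trans] := qtv b Ib; exact.
by move=> low up vgA; exact: dual_constants.
Qed.
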